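(* Let $G$ be a closed group of Weyl-transitive, type-preserving automorphisms of a thick, locally finite building $(\Delta,\delta)$. Let $g\in G$ and let $a$ be a simplex such that $a$ and $g.a$ are aligned and $q(g.a,a)$ is minimal among all simplices $b$ for which $b$ and $g.b$ are aligned. Then the stabilizer $G_a$ is tidy for $g$ and $s(g)=q(g.a,a)$.
   Context: $(\Delta,\delta)$ is a building of type $(W,S)$, $S$ finite; simplices are spherical residues. Type-preserving automorphisms preserve $\delta$; Weyl-transitive means any two pairs of chambers with equal Weyl distance are mapped to each other by some element of $G$ (so $q_s$, the number of chambers $s$-adjacent to a given chamber, is constant). $G$ has the compact-open topology. A compact open subgroup $U$ is tidy for $g$ if it minimizes $|gUg^{-1}:gUg^{-1}\cap U|$, the minimum being the scale $s(g)$. For residues $\mathcal{A},\mathcal{B}$ let $\operatorname{proj}_{\mathcal{B}}(\mathcal{A})=\{\operatorname{proj}_{\mathcal{B}}(x):x\in\mathcal{A}\}$, $\operatorname{proj}_{\mathcal{B}}(x)$ being the chamber of $\mathcal{B}$ closest to $x$. Simplices $a,b$ with residues $\mathcal{A},\mathcal{B}$ are aligned if $\operatorname{proj}_{\mathcal{B}}(\mathcal{A})=\mathcal{B}$ and $\operatorname{proj}_{\mathcal{A}}(\mathcal{B})=\mathcal{A}$. In the Davis realisation, walls are fixed sets of reflections in apartments; the thickness of a wall $m$ is $q(m)=q_s$ for any panel of cotype $s$ contained in $m$, and $q(a,b)=\prod q(m)$ over the walls $m$ of an apartment containing $a$ and $b$ that separate $a$ from $b$. *)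

(* Defs.v *)
(* Buildings as W-metric spaces (Abramenko-Brown, Def. 5.1),
   groups of automorphisms as sets of permutations of the chambers,
   compact-open (= pointwise convergence on chambers) topology. *)
From Stdlib Require Import List Arith.
Import ListNotations.

Record is_group (T : Type) (mul : T -> T -> T) (one : T) (inv : T -> T) : Prop := {
  grp_assoc : forall x y z, mul x (mul y z) = mul (mul x y) z;
  grp_onel  : forall x, mul one x = x;
  grp_invl  : forall x, mul (inv x) x = one
}.

Fixpoint gpow {T : Type} (mul : T -> T -> T) (one : T) (x : T) (n : nat) : T :=
  match n with 0 => one | Datatypes.S k => mul x (gpow mul one x k) end.

Record Cox := {
  cW : Type;
  cmul : cW -> cW -> cW;
  cone : cW;
  cinv : cW -> cW;
  cS : cW -> Prop
}.

Definition wprod (X : Cox) (l : list (cW X)) : cW X :=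
  fold_right (cmul X) (cone X) l.

(* (W,S) is a Coxeter system: S finite set of involutions generating W,
   and W has the presentation < S | (st)^{m_st} = 1 >, expressed by the
   universal property: every map f : S -> H into a group satisfying the
   Coxeter relations of W extends to a homomorphism W -> H. *)
Record coxeter_system (X : Cox) : Prop := {
  cs_group : is_group (cW X) (cmul X) (cone X) (cinv X);
  cs_finite : exists l : list (cW X), forall s, cS X s <-> In s l;
  cs_invol : forall s, cS X s -> s <> cone X /\ cmul X s s = cone X;
  cs_gen : forall w, exists l, Forall (cS X) l /\ w = wprod X l;
  cs_pres : forall (H : Type) (hmul : H -> H -> H) (hone : H) (hinv : H -> H),
      is_group H hmul hone hinv ->
      forall f : cW X -> H,
      (forall s t n, cS X s -> cS X t ->
         gpow (cmul X) (cone X) (cmul X s t) n = cone X ->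
         gpow hmul hone (hmul (f s) (f t)) n = hone) ->
      exists phi : cW X -> H,
        (forall u v, phi (cmul X u v) = hmul (phi u) (phi v)) /\
        (forall s, cS X s -> phi s = f s)
}.

Definition wlen (X : Cox) (w : cW X) (n : nat) : Prop :=
  (exists l, length l = n /\ Forall (cS X) l /\ w = wprod X l) /\
  (forall l, Forall (cS X) l -> w = wprod X l -> n <= length l).

Definition in_WJ (X : Cox) (J : cW X -> Prop) (w : cW X) : Prop :=
  exists l, Forall J l /\ w = wprod X l.

Definition is_reflection (X : Cox) (t : cW X) : Prop :=
  exists u s, cS X s /\ t = cmul X (cmul X u s) (cinv X u).

(* the root (half-apartment of W) of the wall of t containing 1 *)
Definition in_root (X : Cox) (t u : cW X) : Prop :=
  forall n m, wlen X u n -> wlen X (cmul X t u) m -> n < m.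

Record Bldg (X : Cox) := {
  ch : Type;
  wdist : ch -> ch -> cW X
}.
Arguments ch {X}.
Arguments wdist {X}.

Record is_building (X : Cox) (B : Bldg X) : Prop := {
  WD1 : forall x y, wdist B x y = cone X <-> x = y;
  WD2 : forall x y x' s w, wdist B x y = w -> cS X s -> wdist B x' x = s ->
          (wdist B x' y = cmul X s w \/ wdist B x' y = w) /\
          (forall n, wlen X w n -> wlen X (cmul X s w) (Datatypes.S n) ->
             wdist B x' y = cmul X s w);
  WD3 : forall x y s w, wdist B x y = w -> cS X s ->
          exists x', wdist B x' x = s /\ wdist B x' y = cmul X s w
}.

Definition thick (X : Cox) (B : Bldg X) : Prop :=
  forall x s, cS X s -> exists y1 y2, y1 <> y2 /\ wdist B x y1 = s /\ wdist B x y2 = s.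

Definition locally_finite (X : Cox) (B : Bldg X) : Prop :=
  forall x s, cS X s -> exists l : list (ch B), forall y, wdist B x y = s -> In y l.

Definition panel_count (X : Cox) (B : Bldg X) (x : ch B) (s : cW X) (k : nat) : Prop :=
  exists l : list (ch B), NoDup l /\ length l = k /\
    forall y, In y l <-> wdist B x y = s.

Definition gdist (X : Cox) (B : Bldg X) (x y : ch B) (n : nat) : Prop :=
  wlen X (wdist B x y) n.

(* residues (as sets of chambers); simplices = spherical residues *)
Definition is_residue_of_type (X : Cox) (B : Bldg X) (J : cW X -> Prop)
    (R : ch B -> Prop) : Prop :=
  exists x, forall y, R y <-> in_WJ X J (wdist B x y).

Definition is_simplex (X : Cox) (B : Bldg X) (R : ch B -> Prop) : Prop :=
  exists J : cW X -> Prop, (forall s, J s -> cS X s) /\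
    (exists l : list (cW X), forall w, in_WJ X J w <-> In w l) /\
    is_residue_of_type X B J R.

Definition is_proj (X : Cox) (B : Bldg X) (R : ch B -> Prop) (x y : ch B) : Prop :=
  R y /\ forall z n m, R z -> gdist X B x y n -> gdist X B x z m -> n <= m.

Definition proj_onto (X : Cox) (B : Bldg X) (A R : ch B -> Prop) : Prop :=
  forall y, (exists x, A x /\ is_proj X B R x y) <-> R y.

Definition aligned (X : Cox) (B : Bldg X) (A R : ch B -> Prop) : Prop :=
  proj_onto X B A R /\ proj_onto X B R A.

Definition img {C : Type} (g : C -> C) (A : C -> Prop) : C -> Prop :=
  fun y => exists x, A x /\ y = g x.

(* apartments: isometric images phi : W -> C, delta(phi u, phi v) = u^-1 v *)
Definition apt_iso (X : Cox) (B : Bldg X) (phi : cW X -> ch B) : Prop :=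
  forall u v, wdist B (phi u) (phi v) = cmul X (cinv X u) v.

Definition wall_separates (X : Cox) (B : Bldg X) (phi : cW X -> ch B)
    (t : cW X) (A R : ch B -> Prop) : Prop :=
  ((forall u, A (phi u) -> in_root X t u) /\ (forall u, R (phi u) -> ~ in_root X t u)) \/
  ((forall u, A (phi u) -> ~ in_root X t u) /\ (forall u, R (phi u) -> in_root X t u)).

(* thickness of the wall of t is k: q_s for a panel {phi u, phi (u s)} in it *)
Definition wall_thickness (X : Cox) (q : cW X -> nat) (t : cW X) (k : nat) : Prop :=
  exists u s, cS X s /\ cmul X t u = cmul X u s /\ k = q s.

Inductive prod_rel {T : Type} (f : T -> nat -> Prop) : list T -> nat -> Prop :=
| prod_nil : prod_rel f [] 1
| prod_cons : forall t ts k n, f t k -> prod_rel f ts n -> prod_rel f (t :: ts) (k * n).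

Definition qval (X : Cox) (B : Bldg X) (q : cW X -> nat) (A R : ch B -> Prop)
    (n : nat) : Prop :=
  exists phi : cW X -> ch B, apt_iso X B phi /\
    (exists u, A (phi u)) /\ (exists u, R (phi u)) /\
    exists ts : list (cW X), NoDup ts /\
      (forall t, In t ts <-> (is_reflection X t /\ wall_separates X B phi t A R)) /\
      prod_rel (wall_thickness X q) ts n.

Definition is_aut (X : Cox) (B : Bldg X) (h : ch B -> ch B) : Prop :=
  (forall x y, wdist B (h x) (h y) = wdist B x y) /\
  exists h' : ch B -> ch B, forall x, h' (h x) = x /\ h (h' x) = x.

Definition is_subgroup {C : Type} (G U : (C -> C) -> Prop) : Prop :=
  (forall h, U h -> G h) /\
  U (fun x => x) /\
  (forall u v, U u -> U v -> U (fun x => u (v x))) /\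
  (forall u, U u -> exists v, U v /\ forall x, v (u x) = x /\ u (v x) = x).

Definition Aut (X : Cox) (B : Bldg X) : (ch B -> ch B) -> Prop := is_aut X B.

(* G is closed in Aut(Delta) for the compact-open (pointwise) topology *)
Definition closed_in_Aut (X : Cox) (B : Bldg X) (G : (ch B -> ch B) -> Prop) : Prop :=
  forall h, is_aut X B h ->
    (forall F : list (ch B), exists g, G g /\ forall x, In x F -> g x = h x) -> G h.

Definition weyl_transitive (X : Cox) (B : Bldg X) (G : (ch B -> ch B) -> Prop) : Prop :=
  forall x y x' y', wdist B x y = wdist B x' y' ->
    exists h, G h /\ h x = x' /\ h y = y'.

Definition open_in {C : Type} (G V : (C -> C) -> Prop) : Prop :=
  (forall h, V h -> G h) /\
  forall h, V h -> exists F : list C, forall h', G h' ->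
    (forall x, In x F -> h' x = h x) -> V h'.

Definition compact_in {C : Type} (G K : (C -> C) -> Prop) : Prop :=
  (forall h, K h -> G h) /\
  forall (I : Type) (O : I -> (C -> C) -> Prop),
    (forall i, open_in G (O i)) ->
    (forall k, K k -> exists i, O i k) ->
    exists l : list I, forall k, K k -> exists i, In i l /\ O i k.

Definition compact_open_subgroup {C : Type} (G U : (C -> C) -> Prop) : Prop :=
  is_subgroup G U /\ open_in G U /\ compact_in G U.

Definition conjg {C : Type} (g : C -> C) (U : (C -> C) -> Prop) : (C -> C) -> Prop :=
  fun h => exists u, U u /\ forall x, h (g x) = g (u x).

Definition inter {C : Type} (A B : (C -> C) -> Prop) : (C -> C) -> Prop :=
  fun h => A h /\ B h.

Definition in_lcoset {C : Type} (r : C -> C) (K : (C -> C) -> Prop) (a : C -> C) : Prop :=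
  exists b, K b /\ forall x, a x = r (b x).

Definition has_index {C : Type} (A B : (C -> C) -> Prop) (n : nat) : Prop :=
  exists r : list (C -> C), length r = n /\
    (forall ri, In ri r -> A ri) /\
    (forall a, A a -> exists ri, In ri r /\ in_lcoset ri (inter A B) a) /\
    (forall i j, i < n -> j < n -> i <> j ->
       ~ in_lcoset (nth i r (fun x => x)) (inter A B) (nth j r (fun x => x))).

Definition displacement {C : Type} (g : C -> C) (U : (C -> C) -> Prop) (n : nat) : Prop :=
  has_index (conjg g U) U n.

Definition tidy {C : Type} (G : (C -> C) -> Prop) (g : C -> C) (U : (C -> C) -> Prop) : Prop :=
  compact_open_subgroup G U /\
  exists n, displacement g U n /\
    forall V m, compact_open_subgroup G V -> displacement g V m -> n <= m.

Definition scale {C : Type} (G : (C -> C) -> Prop) (g : C -> C) (n : nat) : Prop :=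
  exists U, compact_open_subgroup G U /\ displacement g U n /\
    forall V m, compact_open_subgroup G V -> displacement g V m -> n <= m.

Definition stab {C : Type} (G : (C -> C) -> Prop) (A : C -> Prop) : (C -> C) -> Prop :=
  fun h => G h /\ forall y, A y <-> img h A y.

(* Main.v *)
(* Let [x] be the Weyl distance from [gA] to [A], realized at a chamber [c] of [gA].
   Alignment makes [A] and [gA] parallel, so the index of the stabilizer is the
   number of chambers at distance [x] from [c], which is the product of the
   thicknesses of the walls separating [gA] from [A].

   For the lower bound, take a chamber [c] of minimal displacement and let [w] be
   the Weyl distance from [c] to [g c]. In the Tits cone of [W], replace the base
   point by iterated midpoints of its orbit under [w]; these stay between the
   chambers of [v] and [w v]. After many iterations the sign of every root changes
   at most once along the orbit, so one can walk to a generic point with this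
   property by cyclic shifts of [w] of constant length. The chamber reached
   conjugates [w] to [x u], where [u] lies in a finite parabolic subgroup [W_J]
   normalized by [x], and [x] is straight: l(x^k) = k l(x). Hence there is a
   simplex [R] aligned with [gR] for which q(g^k R, R) = q(gR, R)^k.

   If [V] is compact open of displacement [m], covering by cosets shows that
   q(g^k R, R) is at most a constant times [m^k]. So q(gR, R) <= m, and minimality
   of [A] gives the theorem. *)

(* A root may change sign many times along the orbit of a chamber under [w]; this is what keeps
   powers of reduced words from being reduced. That one number of iterations serves all roots rests
   on finiteness: a root that changes sign is, up to a scalar and a translation by a power of [w],
   one of the finitely many inversions of [w]. A root oscillating periodically with mean zero can
   never be given a sign; averaging over a period makes it vanish along the whole orbit, and such
   roots account for [W_J]. Genericity keeps the other sign-changing roots away from zero at the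
   point finally reached.

   The Tits cone takes the place of a metric space with an axis: only signs and bounds of root
   values enter, never lengths of vectors. Comparing exponential rates in k absorbs the discrepancy
   between an arbitrary [V] and the stabilizer of [R] in a constant. *)
Require Import Defs.
From Stdlib Require Import List Arith.
From Stdlib Require Import Lia ZArith Reals Lra Permutation.
From Stdlib Require Import Classical ClassicalEpsilon FunctionalExtensionality ProofIrrelevance.
Import ListNotations.

(** * Elementary group theory *)

Section AbstractGroup.
Context {T : Type} {mul : T -> T -> T} {one : T} {inv : T -> T}
  (HG : is_group T mul one inv).

Lemma grp_invr x : mul x (inv x) = one.
Proof.
  rewrite <- (grp_onel _ _ _ _ HG (mul x (inv x))).
  rewrite <- (grp_invl _ _ _ _ HG (inv x)) at 1.
  rewrite <- (grp_assoc _ _ _ _ HG), (grp_assoc _ _ _ _ HG (inv x) x (inv x)).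
  now rewrite (grp_invl _ _ _ _ HG), (grp_onel _ _ _ _ HG), (grp_invl _ _ _ _ HG).
Qed.

Lemma grp_oner x : mul x one = x.
Proof.
  rewrite <- (grp_invl _ _ _ _ HG x), (grp_assoc _ _ _ _ HG), grp_invr.
  apply (grp_onel _ _ _ _ HG).
Qed.

Lemma grp_invl_cancel x y : mul (inv x) (mul x y) = y.
Proof. now rewrite (grp_assoc _ _ _ _ HG), (grp_invl _ _ _ _ HG), (grp_onel _ _ _ _ HG). Qed.

Lemma grp_invr_cancel x y : mul x (mul (inv x) y) = y.
Proof. now rewrite (grp_assoc _ _ _ _ HG), grp_invr, (grp_onel _ _ _ _ HG). Qed.

Lemma grp_cancel_l x y z : mul x y = mul x z -> y = z.
Proof. intro E. rewrite <- (grp_invl_cancel x y), E. apply grp_invl_cancel. Qed.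

Lemma grp_cancel_r x y z : mul y x = mul z x -> y = z.
Proof.
  intro E. rewrite <- (grp_oner y), <- (grp_oner z), <- (grp_invr x).
  now rewrite !(grp_assoc _ _ _ _ HG), E.
Qed.

Lemma grp_inv_unique x y : mul x y = one -> y = inv x.
Proof. intro E. apply (grp_cancel_l x). now rewrite E, grp_invr. Qed.

Lemma grp_inv_inv x : inv (inv x) = x.
Proof. symmetry. apply grp_inv_unique, (grp_invl _ _ _ _ HG). Qed.

Lemma grp_inv_mul x y : inv (mul x y) = mul (inv y) (inv x).
Proof.
  symmetry. apply grp_inv_unique.
  now rewrite <- (grp_assoc _ _ _ _ HG), grp_invr_cancel, grp_invr.
Qed.

Lemma grp_inv_one : inv one = one.
Proof. symmetry. apply grp_inv_unique, (grp_onel _ _ _ _ HG). Qed.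

Lemma gpow_add x m n : gpow mul one x (m + n) = mul (gpow mul one x m) (gpow mul one x n).
Proof.
  induction m as [|m IH]; simpl.
  - now rewrite (grp_onel _ _ _ _ HG).
  - now rewrite IH, (grp_assoc _ _ _ _ HG).
Qed.

Lemma gpow_mul x m n : gpow mul one x m = one -> gpow mul one x (n * m) = one.
Proof.
  intro E. induction n as [|n IH]; simpl; trivial.
  now rewrite gpow_add, E, IH, (grp_onel _ _ _ _ HG).
Qed.

Lemma gpow_swap x y n : mul (mul x (gpow mul one (mul y x) n)) y = gpow mul one (mul x y) (S n).
Proof.
  induction n as [|n IH]; simpl.
  - now rewrite !grp_oner.
  - simpl in IH. rewrite <- IH. now rewrite !(grp_assoc _ _ _ _ HG).
Qed.

Lemma gpow_inv x n : gpow mul one (inv x) n = inv (gpow mul one x n).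
Proof.
  induction n as [|n IH]; simpl gpow.
  - now rewrite grp_inv_one.
  - change (mul x (gpow mul one x n)) with (gpow mul one x (1 + n)).
    rewrite Nat.add_comm, gpow_add, grp_inv_mul, IH. simpl. now rewrite grp_oner.
Qed.

End AbstractGroup.

Ltac gsimp :=
  match goal with H : coxeter_system ?X |- _ =>
    let G := constr:(cs_group X H) in
    repeat (rewrite ?(grp_onel _ _ _ _ G), ?(grp_oner G), ?(grp_inv_mul G), ?(grp_inv_inv G),
      ?(grp_inv_one G), ?(grp_invr G), ?(grp_invl _ _ _ _ G), <- ?(grp_assoc _ _ _ _ G),
      ?(grp_invl_cancel G), ?(grp_invr_cancel G))
  end.

Ltac gsimp_in K :=
  match goal with H : coxeter_system ?X |- _ =>
    let G := constr:(cs_group X H) in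
    repeat (rewrite ?(grp_onel _ _ _ _ G), ?(grp_oner G), ?(grp_inv_mul G), ?(grp_inv_inv G),
      ?(grp_inv_one G), ?(grp_invr G), ?(grp_invl _ _ _ _ G), <- ?(grp_assoc _ _ _ _ G),
      ?(grp_invl_cancel G), ?(grp_invr_cancel G) in K)
  end.

Lemma nat_least (P : nat -> Prop) : (exists n, P n) -> exists n, P n /\ forall m, P m -> n <= m.
Proof.
  intros [n Hn]. revert Hn. induction n as [n IH] using lt_wf_ind. intro Hn.
  destruct (classic (exists m, m < n /\ P m)) as [[m [Hm Pm]]|Hno].
  - exact (IH m Hm Pm).
  - exists n. split; trivial. intros m Pm. destruct (le_lt_dec n m); trivial.
    exfalso. apply Hno. now exists m.
Qed.

(** * The length function of a Coxeter system *)

Section CoxeterSystem.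
Context {X : Cox} (HX : coxeter_system X).
Local Notation "a ** b" := (cmul X a b) (at level 40, left associativity).
Local Notation e := (cone X).
Local Notation inv := (cinv X).
Local Notation GX := (cs_group X HX).
Local Notation mulA := (grp_assoc _ _ _ _ GX).
Local Notation mul1 := (grp_onel _ _ _ _ GX).
Local Notation pw := (gpow (cmul X) e).
Local Notation word := (wprod X).

Lemma gen_sq s : cS X s -> s ** s = e.
Proof. intro Hs. exact (proj2 (cs_invol X HX s Hs)). Qed.

Lemma gen_neq_one s : cS X s -> s <> e.
Proof. intro Hs. exact (proj1 (cs_invol X HX s Hs)). Qed.

Lemma gen_inv s : cS X s -> inv s = s.
Proof. intro Hs. symmetry. apply (grp_inv_unique GX), gen_sq, Hs. Qed.

Lemma gen_cancel s w : cS X s -> s ** (s ** w) = w.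
Proof. intro Hs. now rewrite mulA, gen_sq, mul1. Qed.

Lemma gen_cancel_r s w : cS X s -> w ** s ** s = w.
Proof. intro Hs. rewrite <- mulA, gen_sq by trivial. gsimp. reflexivity. Qed.

Lemma wprod_app l1 l2 : word (l1 ++ l2) = word l1 ** word l2.
Proof.
  unfold wprod. induction l1 as [|a l IH]; simpl.
  - gsimp. reflexivity.
  - rewrite IH. gsimp. reflexivity.
Qed.

Lemma wprod_rev l : Forall (cS X) l -> word (rev l) = inv (word l).
Proof.
  induction 1 as [|a l Ha Hl IH]; simpl.
  - gsimp. reflexivity.
  - rewrite wprod_app, IH. simpl. gsimp. now rewrite (gen_inv a).
Qed.

Lemma wlen_exists w : exists n, wlen X w n.
Proof.
  destruct (cs_gen X HX w) as [l [Hl El]].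
  destruct (nat_least (fun n => exists l, length l = n /\ Forall (cS X) l /\ w = word l))
    as [n [Hn Hmin]].
  - exists (length l), l. auto.
  - exists n. split; trivial. intros l' H1 H2. apply Hmin. exists l'. auto.
Qed.

Definition len (w : cW X) : nat := epsilon (inhabits 0) (wlen X w).

Lemma len_spec w : wlen X w (len w).
Proof. exact (epsilon_spec (inhabits 0) (wlen X w) (wlen_exists w)). Qed.

Lemma wlen_len w n : wlen X w n <-> n = len w.
Proof.
  split.
  - intros [[l [E1 [H1 W1]]] M1]. destruct (len_spec w) as [[l' [E2 [H2 W2]]] M2].
    specialize (M1 l' H2 W2). specialize (M2 l H1 W1). lia.
  - intros ->. apply len_spec.
Qed.

Lemma reduced_word w : exists l, Forall (cS X) l /\ w = word l /\ length l = len w.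
Proof. destruct (len_spec w) as [[l [E1 [H1 W1]]] _]. now exists l. Qed.

Lemma len_wprod l : Forall (cS X) l -> len (word l) <= length l.
Proof. intro Hl. destruct (len_spec (word l)) as [_ M]. now apply M. Qed.

Lemma len_one : len e = 0.
Proof. assert (H := len_wprod [] (Forall_nil _)). simpl in H. lia. Qed.

Lemma len_zero w : len w = 0 -> w = e.
Proof.
  intro E. destruct (reduced_word w) as [l [Hl [-> L]]].
  rewrite E in L. destruct l; [reflexivity|discriminate].
Qed.

Lemma len_mul a b : len (a ** b) <= len a + len b.
Proof.
  destruct (reduced_word a) as [l [Hl [El Ll]]]. destruct (reduced_word b) as [k [Hk [Ek Lk]]].
  rewrite <- Ll, <- Lk, <- length_app, El, Ek, <- wprod_app.
  apply len_wprod, Forall_app; auto.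
Qed.

Lemma len_inv a : len (inv a) = len a.
Proof.
  assert (H : forall a, len (inv a) <= len a).
  { intro b. destruct (reduced_word b) as [l [Hl [El Ll]]].
    rewrite <- Ll, El, <- wprod_rev by trivial. rewrite <- length_rev.
    apply len_wprod, Forall_rev, Hl. }
  apply Nat.le_antisymm; auto. rewrite <- (grp_inv_inv GX a) at 1. apply H.
Qed.

Lemma len_gen s : cS X s -> len s <= 1.
Proof.
  intro Hs. assert (H := len_wprod [s] (Forall_cons _ Hs (Forall_nil _))).
  simpl in H. revert H. gsimp. auto.
Qed.

Lemma len_gen_eq s : cS X s -> len s = 1.
Proof.
  intro Hs. assert (H := len_gen s Hs). destruct (len s) as [|[|]] eqn:E; try lia.
  destruct (gen_neq_one s Hs). now apply len_zero.
Qed.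

Lemma xorb_group : is_group bool xorb false (fun b => b).
Proof. split; intros; destruct x; try destruct y; try destruct z; reflexivity. Qed.

(** The sign character. Each relator goes to a power of [xorb true true = false], so the relations
    hold whatever the orders are. It is what excludes [len (s ** w) = len w]. *)
Lemma parity_hom : exists p : cW X -> bool,
  (forall u v, p (u ** v) = xorb (p u) (p v)) /\ (forall s, cS X s -> p s = true).
Proof.
  apply (cs_pres X HX bool xorb false (fun b => b) xorb_group (fun _ => true)).
  intros s t n _ _ _. induction n as [|n IH]; simpl; auto.
Qed.

Lemma len_gen_mul_neq s w : cS X s -> len (s ** w) <> len w.
Proof.
  intro Hs. destruct parity_hom as [p [Hp1 Hp2]].
  assert (P1 : p e = false).
  { generalize (Hp1 e e). gsimp. destruct (p e); simpl; congruence. }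
  assert (HO : forall l, Forall (cS X) l -> p (word l) = Nat.odd (length l)).
  { induction 1 as [|a l Ha Hl IH]; [exact P1|].
    simpl wprod. rewrite Hp1, Hp2, IH by trivial. change (length (a :: l)) with (S (length l)).
    rewrite Nat.odd_succ, <- Nat.negb_odd. now destruct (Nat.odd (length l)). }
  assert (HP : forall w, p w = Nat.odd (len w)).
  { intro v. destruct (reduced_word v) as [l [Hl [El Ll]]]. now rewrite <- Ll, <- HO, <- El. }
  intro E. generalize (Hp1 s w). rewrite (Hp2 s Hs), HP, HP, E.
  destruct (Nat.odd (len w)); discriminate.
Qed.

Lemma len_gen_mul s w : cS X s -> len (s ** w) = S (len w) \/ len w = S (len (s ** w)).
Proof.
  intro Hs. assert (H1 := len_mul s w). assert (H2 := len_mul s (s ** w)).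
  rewrite gen_cancel in H2 by trivial. assert (H3 := len_gen s Hs).
  assert (H4 := len_gen_mul_neq s w Hs). lia.
Qed.

Lemma len_mul_gen s w : cS X s -> len (w ** s) = S (len w) \/ len w = S (len (w ** s)).
Proof.
  intro Hs. assert (H := len_gen_mul s (inv w) Hs).
  assert (E : s ** inv w = inv (w ** s)) by (gsimp; now rewrite (gen_inv s)).
  now rewrite E, !len_inv in H.
Qed.

Lemma left_descent w : w <> e -> exists s, cS X s /\ len w = S (len (s ** w)).
Proof.
  intro N. destruct (reduced_word w) as [l [Hl [El Ll]]]. destruct l as [|s l]; [easy|].
  inversion Hl as [|? ? Hs Hl']; subst. exists s. split; trivial.
  destruct (len_gen_mul s (word (s :: l)) Hs) as [E|E]; trivial.
  assert (H := len_wprod l Hl'). simpl wprod in E. rewrite gen_cancel in E by trivial.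
  simpl in *. lia.
Qed.

Lemma right_descent w : w <> e -> exists s, cS X s /\ len w = S (len (w ** s)).
Proof.
  intro N. destruct (left_descent (inv w)) as [s [Hs E]].
  - intro H. apply N. rewrite <- (grp_inv_inv GX w), H. gsimp. reflexivity.
  - exists s. split; trivial.
    assert (E' : s ** inv w = inv (w ** s)) by (gsimp; now rewrite (gen_inv s)).
    now rewrite E', !len_inv in E.
Qed.

Lemma reduced_tail s l : Forall (cS X) (s :: l) -> len (word (s :: l)) = S (length l) ->
  len (word l) = length l.
Proof.
  intros Hl E. inversion Hl as [|? ? Hs Hl']; subst.
  assert (H1 := len_wprod l Hl'). assert (H2 := len_mul s (word l)).
  assert (H3 := len_gen s Hs). simpl in *. unfold wprod in *. lia.
Qed.

Fixpoint alt (s t : cW X) (k : nat) : list (cW X) :=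
  match k with 0 => [] | S k => s :: alt t s k end.

Lemma alt_Forall s t k : cS X s -> cS X t -> Forall (cS X) (alt s t k).
Proof. revert s t. induction k; simpl; auto. Qed.

Lemma alt_length s t k : length (alt s t k) = k.
Proof. revert s t. induction k; simpl; auto. Qed.

(** When [k] is the order of [s ** t] the first factor disappears and the braid relation remains. *)
Lemma alt_quotient s t k : cS X s -> cS X t ->
  word (alt s t k) = pw (s ** t) k ** word (alt t s k).
Proof.
  revert s t. induction k as [|k IH]; intros s t Hs Ht.
  - simpl. gsimp. reflexivity.
  - rewrite <- (gpow_swap GX). simpl wprod.
    rewrite (IH t s) by trivial. rewrite <- !mulA.
    now rewrite (gen_cancel t).
Qed.

(** A target group for [cs_pres]: bijections are bundled with their inverses because [is_group] asks
    for an inverse operation on the whole type. *)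
Record perm (T : Type) := {
  pfun : T -> T; pinv : T -> T;
  pinv_pfun : forall x, pinv (pfun x) = x;
  pfun_pinv : forall x, pfun (pinv x) = x
}.
Arguments pfun {T}. Arguments pinv {T}. Arguments pinv_pfun {T}. Arguments pfun_pinv {T}.

Lemma perm_ext {T} (a b : perm T) : (forall x, pfun a x = pfun b x) -> a = b.
Proof.
  intro E. assert (E' : forall x, pinv a x = pinv b x).
  { intro x. rewrite <- (pinv_pfun b (pinv a x)), <- E, pfun_pinv. reflexivity. }
  destruct a as [f g p1 p2], b as [f' g' p1' p2']. simpl in *.
  apply functional_extensionality in E. apply functional_extensionality in E'. subst.
  f_equal; apply proof_irrelevance.
Qed.

Definition perm_id {T} : perm T :=
  {| pfun := fun x => x; pinv := fun x => x;
     pinv_pfun := fun x => eq_refl; pfun_pinv := fun x => eq_refl |}.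

Program Definition perm_comp {T} (a b : perm T) : perm T :=
  {| pfun := fun x => pfun a (pfun b x); pinv := fun x => pinv b (pinv a x) |}.
Next Obligation. now rewrite !pinv_pfun. Qed.
Next Obligation. now rewrite !pfun_pinv. Qed.

Definition perm_inv {T} (a : perm T) : perm T :=
  {| pfun := pinv a; pinv := pfun a; pinv_pfun := pfun_pinv a; pfun_pinv := pinv_pfun a |}.

Lemma perm_group T : is_group (perm T) perm_comp perm_id perm_inv.
Proof. split; intros; apply perm_ext; intros; simpl; trivial. apply pinv_pfun. Qed.

Definition is_order (w : cW X) (m : nat) : Prop :=
  1 <= m /\ pw w m = cone X /\
  forall k, 1 <= k < m -> pw w k <> cone X.

(* Tits' bilinear form on simple roots, with the value -1 for infinite order. *)
Definition tits_form (s t : cW X) : R :=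
  if excluded_middle_informative (exists m, is_order (cmul X s t) m)
  then (- cos (PI / INR (epsilon (inhabits 0%nat) (is_order (cmul X s t)))))%R
  else (-1)%R.

(* The contragredient of Tits' representation: [x] is the linear form taking
   the value [x s] on the simple root of [s], so that only values are stored. *)
Definition refl (s : cW X) (x : cW X -> R) : cW X -> R :=
  fun r => (x r - 2 * tits_form s r * x s)%R.

Definition lincomb (a b : R) (x y : cW X -> R) : cW X -> R :=
  fun r => (a * x r + b * y r)%R.

(** * The geometric representation *)

Section TitsForm.
Local Notation B := tits_form.
Local Open Scope R_scope.

Lemma order_exists w n : (1 <= n)%nat -> pw w n = e -> exists m, is_order w m.
Proof.
  intros Hn En.
  destruct (nat_least (fun n => 1 <= n /\ pw w n = e)%nat) as [m [[H1 H2] H3]].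
  - now exists n.
  - exists m. repeat split; trivial. intros k Hk E. assert (H := H3 k (conj (proj1 Hk) E)). lia.
Qed.

Lemma order_unique w m m' : is_order w m -> is_order w m' -> m = m'.
Proof.
  intros [H1 [H2 H3]] [H1' [H2' H3']].
  destruct (lt_eq_lt_dec m m') as [[H|H]|H]; trivial; exfalso.
  - apply (H3' m); auto.
  - apply (H3 m'); auto.
Qed.

Lemma order_divides w m n : is_order w m -> pw w n = e -> exists k, (n = k * m)%nat.
Proof.
  intros [H1 [H2 H3]] E. exists (n / m)%nat.
  assert (D := Nat.div_mod n m ltac:(lia)).
  rewrite D, (gpow_add GX), Nat.mul_comm, (gpow_mul GX) in E by trivial.
  revert E. gsimp. intro E. destruct (Nat.eq_dec (n mod m) 0); try lia.
  exfalso. apply (H3 (n mod m)%nat); trivial. split; try lia. apply Nat.mod_upper_bound. lia.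
Qed.

Lemma gpow_swap_one s t n : cS X s -> cS X t ->
  pw (s ** t) n = e -> pw (t ** s) n = e.
Proof.
  intros Hs Ht E. assert (E' : t ** s = inv (s ** t)).
  { gsimp. now rewrite (gen_inv s), (gen_inv t). }
  rewrite E', (gpow_inv GX), E. gsimp. reflexivity.
Qed.

Lemma is_order_swap s t m : cS X s -> cS X t -> is_order (s ** t) m -> is_order (t ** s) m.
Proof.
  intros Hs Ht [H1 [H2 H3]]. split; [trivial|split].
  - now apply gpow_swap_one.
  - intros k Hk E. apply (H3 k Hk). now apply gpow_swap_one.
Qed.

Lemma tits_form_order s t m : is_order (s ** t) m -> B s t = - cos (PI / INR m).
Proof.
  intro H. unfold tits_form. destruct (excluded_middle_informative _) as [E|E].
  - rewrite (order_unique (s ** t) _ m (epsilon_spec (inhabits 0%nat) _ E) H). reflexivity.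
  - exfalso. apply E. now exists m.
Qed.

Lemma tits_form_infinite s t : (forall m, ~ is_order (s ** t) m) -> B s t = -1.
Proof.
  intro H. unfold tits_form. destruct (excluded_middle_informative _) as [[m E]|E]; trivial.
  destruct (H m E).
Qed.

Lemma tits_form_diag s : cS X s -> B s s = 1.
Proof.
  intro Hs. rewrite (tits_form_order s s 1).
  - simpl. replace (PI / 1) with PI by field. rewrite cos_PI. lra.
  - split; [lia|split].
    + simpl. rewrite gen_sq by trivial. gsimp. reflexivity.
    + intros k Hk. lia.
Qed.

Lemma tits_form_sym s t : cS X s -> cS X t -> B s t = B t s.
Proof.
  intros Hs Ht. destruct (classic (exists m, is_order (s ** t) m)) as [[m Hm]|N].
  - rewrite (tits_form_order s t m), (tits_form_order t s m); auto. now apply is_order_swap.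
  - rewrite !tits_form_infinite; trivial.
    + intros m Hm. apply N. exists m. now apply is_order_swap.
    + intros m Hm. apply N. now exists m.
Qed.

Lemma is_order_ge2 s t m : cS X s -> cS X t -> s <> t -> is_order (s ** t) m -> (2 <= m)%nat.
Proof.
  intros Hs Ht N [H1 [H2 H3]]. destruct (Nat.eq_dec m 1) as [->|]; try lia.
  exfalso. apply N. simpl in H2. revert H2. gsimp. intro E.
  apply (grp_inv_unique GX) in E. now rewrite E, (gen_inv s).
Qed.

Lemma order_angle m : (2 <= m)%nat ->
  let th := PI / INR m in 0 < th <= PI / 2 /\ INR m * th = PI /\ 0 < sin th.
Proof.
  intros Hm th. assert (P := PI_RGT_0). assert (Hm2 : 2 <= INR m) by (apply (le_INR 2 m Hm)).
  assert (E : INR m * th = PI) by (unfold th; field; lra).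
  assert (T : 0 < th) by (unfold th; apply Rdiv_lt_0_compat; lra).
  assert (T2 : th <= PI / 2) by nra.
  repeat split; trivial. apply sin_gt_0; lra.
Qed.

Lemma refl_gen s x : cS X s -> refl s x s = - x s.
Proof. intro Hs. unfold refl. rewrite tits_form_diag by trivial. ring. Qed.

Lemma refl_sq s x : cS X s -> refl s (refl s x) = x.
Proof.
  intro Hs. apply functional_extensionality. intro r.
  unfold refl at 1. rewrite refl_gen by trivial. unfold refl. ring.
Qed.

Lemma refl_fix s x : x s = 0 -> refl s x = x.
Proof. intro E. apply functional_extensionality. intro r. unfold refl. rewrite E. ring. Qed.

Lemma refl_lincomb s a b x y : refl s (lincomb a b x y) = lincomb a b (refl s x) (refl s y).
Proof. apply functional_extensionality. intro r. unfold refl, lincomb. ring. Qed.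

(* On the span of the two forms [B s] and [B t] the product of the two
   reflections is the rotation by twice [PI / m]; the complement is fixed. *)
Lemma rotation_power s t m x k : cS X s -> cS X t -> s <> t -> is_order (s ** t) m ->
  let th := PI / INR m in let c := cos th in let d := sin th in
  let a := (x s + c * x t) / d² in let b := (x t + c * x s) / d² in
  let P := (a - b * c) * cos (2 * INR k * th) - b * d * sin (2 * INR k * th) in
  let Q := (a - b * c) * sin (2 * INR k * th) + b * d * cos (2 * INR k * th) in
  Nat.iter k (fun y => refl s (refl t y)) x =
  fun r => x r + (P + Q * c / d - a) * B s r + (Q / d - b) * B t r.
Proof.
  intros Hs Ht N Ho th c d a b. assert (Hm := is_order_ge2 s t m Hs Ht N Ho).
  destruct (order_angle m Hm) as [Hth [Eth Hd]]. fold th in Hth, Eth, Hd. fold d in Hd.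
  assert (Est : B s t = - c) by now apply tits_form_order.
  assert (Ets : B t s = - c) by (rewrite tits_form_sym; trivial).
  assert (Ess := tits_form_diag s Hs). assert (Ett := tits_form_diag t Ht).
  assert (Ecd : c * c = 1 - d * d).
  { assert (H := sin2_cos2 th). unfold Rsqr in H. fold c d in H. lra. }
  assert (D : d * d = 1 - c * c) by lra.
  (* [a] and [b] are chosen so that [x - a B s - b B t] vanishes at [s] and [t]. In the plane where
     [B s] is (1, 0) and [B t] is (-c, d), the remaining component is (a - b c, b d); rotating it
     gives (P, Q). *)
  assert (Xs : x s = a - b * c) by (unfold a, b, Rsqr; rewrite D; field; nra).
  assert (Xt : x t = b - a * c) by (unfold a, b, Rsqr; rewrite D; field; nra).
  induction k as [|k IH].
  - intros P Q. apply functional_extensionality. intro r. unfold P, Q.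
    replace (2 * INR 0 * th) with 0 by (simpl; ring). rewrite cos_0, sin_0. simpl. field. lra.
  - intros P Q. simpl Nat.iter. rewrite IH. clear IH.
    set (P0 := (a - b * c) * cos (2 * INR k * th) - b * d * sin (2 * INR k * th)).
    set (Q0 := (a - b * c) * sin (2 * INR k * th) + b * d * cos (2 * INR k * th)).
    assert (HP : P = P0 * (c * c - d * d) - Q0 * (2 * d * c)).
    { unfold P, P0, Q0. rewrite S_INR.
      replace (2 * (INR k + 1) * th) with (2 * INR k * th + 2 * th) by ring.
      rewrite cos_plus, sin_plus, cos_2a, sin_2a. fold c d. ring. }
    assert (HQ : Q = P0 * (2 * d * c) + Q0 * (c * c - d * d)).
    { unfold Q, P0, Q0. rewrite S_INR.
      replace (2 * (INR k + 1) * th) with (2 * INR k * th + 2 * th) by ring.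
      rewrite cos_plus, sin_plus, cos_2a, sin_2a. fold c d. ring. }
    apply functional_extensionality. intro r. unfold refl.
    rewrite Est, Ets, Ess, Ett, Xs, Xt, HP, HQ.
    field_simplify_eq; [|lra].
    replace (d ^ 3) with (d * (1 - c * c)) by (rewrite <- D; ring).
    replace (d ^ 2) with (1 - c * c) by (rewrite <- D; ring).
    ring.
Qed.

Lemma refl_power_relation s t n x : cS X s -> cS X t -> pw (s ** t) n = e ->
  Nat.iter n (fun y => refl s (refl t y)) x = x.
Proof.
  intros Hs Ht En. destruct (classic (s = t)) as [<-|N].
  - clear En. induction n as [|n IH]; trivial. simpl. now rewrite IH, refl_sq.
  - destruct n as [|n]; trivial. destruct (order_exists (s ** t) (S n)) as [m Hm]; [lia|trivial|].
    destruct (order_divides _ m _ Hm En) as [k Ek]. rewrite Ek. clear En Ek.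
    assert (Em : forall y, Nat.iter m (fun y => refl s (refl t y)) y = y).
    { intro y. rewrite (rotation_power s t m) by trivial.
      destruct (order_angle m (is_order_ge2 s t m Hs Ht N Hm)) as [_ [Eth Hd]].
      apply functional_extensionality. intro r.
      rewrite Rmult_assoc, Eth.
      rewrite cos_2PI, sin_2PI. generalize dependent (sin (PI / INR m)). intros d Hd.
      generalize (cos (PI / INR m)). intro c. unfold Rsqr. field. intro E0; rewrite E0 in Hd; lra. }
    induction k as [|k IH]; trivial. simpl Nat.mul. now rewrite Nat.iter_add, IH, Em.
Qed.

End TitsForm.

(** * The action of the Coxeter group and the positivity of roots *)

Definition is_act (F : cW X -> (cW X -> R) -> cW X -> R) : Prop :=
  (forall u v x, F (cmul X u v) x = F u (F v x)) /\ (forall x, F e x = x) /\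
  (forall s x, cS X s -> F s x = refl s x).

Definition act : cW X -> (cW X -> R) -> cW X -> R :=
  epsilon (inhabits (fun _ x => x)) is_act.

(** The value at [x] of the root obtained by applying [v] to the simple root of [s]; its reflection
    is [v ** s ** inv v]. Roots occur only through such pairs, and different pairs may name the same
    root. *)
Definition val (v s : cW X) (x : cW X -> R) : R := act (inv v) x s.

Lemma val_def v s x : val v s x = act (inv v) x s.
Proof. reflexivity. Qed.

(** An interior point of the fundamental chamber: [act u one_pt] stands for the chamber [u]. On
    these points every root has absolute value at least 1, and this gap makes the estimates
    uniform. *)
Definition one_pt : cW X -> R := fun _ => 1%R.

Section Action.
Local Notation B := tits_form.
Local Open Scope R_scope.

Lemma act_spec : is_act act.
Proof.
  apply (epsilon_spec (inhabits (fun (_ : cW X) (x : cW X -> R) => x)) is_act).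
  (* [cs_pres] wants a total map; off the generators [perm_id] is a placeholder. *)
  set (f := fun s : cW X =>
    match excluded_middle_informative (cS X s) with
    | left Hs => {| pfun := refl s; pinv := refl s;
                    pinv_pfun := fun x => refl_sq s x Hs;
                    pfun_pinv := fun x => refl_sq s x Hs |}
    | right _ => perm_id
    end).
  assert (Hf : forall s, cS X s -> forall x, pfun (f s) x = refl s x).
  { intros s Hs x. unfold f. destruct (excluded_middle_informative _); [reflexivity|easy]. }
  destruct (cs_pres X HX _ _ _ _ (perm_group (cW X -> R)) f) as [phi [H1 H2]].
  - intros s t n Hs Ht En. apply perm_ext. intro x. simpl.
    rewrite <- (refl_power_relation s t n x Hs Ht En) at 2. clear En.
    induction n as [|n IH]; trivial. simpl. now rewrite !Hf, IH.
  - exists (fun w => pfun (phi w)). split; [|split].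
    + intros u v x. now rewrite H1.
    + assert (E : phi e = perm_id).
      { apply (grp_cancel_l (perm_group _) (phi e)). rewrite <- H1, (grp_oner (perm_group _)).
        f_equal. gsimp. reflexivity. }
      intro x. now rewrite E.
    + intros s x Hs. rewrite H2 by trivial. now apply Hf.
Qed.

Lemma act_mul u v x : act (u ** v) x = act u (act v x).
Proof. apply act_spec. Qed.

Lemma act_gen s x : cS X s -> act s x = refl s x.
Proof. apply act_spec. Qed.

Lemma act_one x : act e x = x.
Proof. apply act_spec. Qed.

Lemma act_inv_l u x : act (inv u) (act u x) = x.
Proof. rewrite <- act_mul. gsimp. apply act_one. Qed.

Lemma act_inv_r u x : act u (act (inv u) x) = x.
Proof. rewrite <- act_mul. gsimp. apply act_one. Qed.

Lemma gen_ind (P : cW X -> Prop) : P e -> (forall s w, cS X s -> P w -> P (s ** w)) -> forall w, P w.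
Proof.
  intros H1 H2 w. destruct (cs_gen X HX w) as [l [Hl ->]].
  induction Hl as [|s l Hs Hl IH]; simpl; auto.
Qed.

Lemma act_lincomb w a b x y : act w (lincomb a b x y) = lincomb a b (act w x) (act w y).
Proof.
  induction w as [|s w Hs IH] using gen_ind.
  - now rewrite !act_one.
  - rewrite !act_mul, IH, !(act_gen s), refl_lincomb by trivial. reflexivity.
Qed.

Lemma val_lincomb v s a b x y : val v s (lincomb a b x y) = a * val v s x + b * val v s y.
Proof. rewrite !val_def. rewrite act_lincomb. reflexivity. Qed.

Lemma val_act v s w x : val v s (act w x) = val (inv w ** v) s x.
Proof. rewrite !val_def. rewrite <- act_mul. gsimp. reflexivity. Qed.

Lemma val_gen v s x : cS X s -> val (v ** s) s x = - val v s x.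
Proof.
  intro Hs. rewrite !val_def. gsimp. rewrite (gen_inv s) by trivial.
  rewrite act_mul, act_gen by trivial. now apply refl_gen.
Qed.

(* The coefficients [sin (k th) / sin th] of the roots of a dihedral group. *)
Fixpoint chebyshev (c : R) (k : nat) : R :=
  match k with
  | 0 => 0
  | S k' => match k' with 0 => 1 | S k'' => 2 * c * chebyshev c k' - chebyshev c k'' end
  end.

Lemma chebyshev_step c k : chebyshev c (S (S k)) = 2 * c * chebyshev c (S k) - chebyshev c k.
Proof. reflexivity. Qed.

Lemma chebyshev_sin th k : chebyshev (cos th) k * sin th = sin (INR k * th).
Proof.
  enough (H : chebyshev (cos th) k * sin th = sin (INR k * th) /\
    chebyshev (cos th) (S k) * sin th = sin (INR (S k) * th)) by apply H.
  induction k as [|k [IH1 IH2]].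
  - split; [simpl; rewrite !Rmult_0_l, sin_0; lra|]. simpl. rewrite !Rmult_1_l. reflexivity.
  - split; trivial. rewrite chebyshev_step, Rmult_minus_distr_r, IH1.
    replace (2 * cos th * chebyshev (cos th) (S k) * sin th)
      with (2 * cos th * (chebyshev (cos th) (S k) * sin th)) by ring.
    rewrite IH2, !S_INR.
    replace ((INR k + 1 + 1) * th) with ((INR k + 1) * th + th) by ring.
    replace (INR k * th) with ((INR k + 1) * th - th) by ring.
    rewrite sin_plus, sin_minus. ring.
Qed.

(** The case of infinite order, where [B s t = -1]: the limit of sin (k th) / sin th as th tends to
    0. *)
Lemma chebyshev_infinite k : chebyshev 1 k = INR k.
Proof.
  enough (H : chebyshev 1 k = INR k /\ chebyshev 1 (S k) = INR (S k)) by apply H.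
  induction k as [|k [IH1 IH2]]; [simpl; lra|].
  split; trivial. rewrite chebyshev_step, IH1, IH2, !S_INR. ring.
Qed.

Lemma sin_ge_middle th x : 0 < th <= PI / 2 -> th <= x <= PI - th -> sin th <= sin x.
Proof.
  intros Hth Hx. destruct (Rle_dec x (PI / 2)) as [H|H].
  - apply sin_incr_1; lra.
  - rewrite <- (sin_PI_x x). apply sin_incr_1; lra.
Qed.

(** For 0 < j < m one has sin (j th) >= sin th. The gap between 0 and 1, rather than mere
    nonnegativity, is what carries the lower bound [c] through [tits_positivity]; the last clause
    keeps one coefficient alive. *)
Lemma chebyshev_pos s t k : cS X s -> cS X t -> s <> t ->
  (forall m, is_order (s ** t) m -> (k < m)%nat) ->
  let U := chebyshev (- B s t) in
  (U k = 0 \/ 1 <= U k) /\ (U (S k) = 0 \/ 1 <= U (S k)) /\ (1 <= U k \/ 1 <= U (S k)).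
Proof.
  intros Hs Ht N Hk U. destruct (classic (exists m, is_order (s ** t) m)) as [[m Hm]|No].
  - assert (Hm2 := is_order_ge2 s t m Hs Ht N Hm). specialize (Hk m Hm).
    destruct (order_angle m Hm2) as [Hth [Eth Hd]]. set (th := PI / INR m) in *.
    assert (EU : forall j, U j * sin th = sin (INR j * th)).
    { intro j. unfold U. rewrite (tits_form_order s t m) by trivial. rewrite Ropp_involutive.
      apply chebyshev_sin. }
    assert (U0 : U 0%nat = 0) by reflexivity.
    assert (Um : U m = 0) by (specialize (EU m); rewrite Eth, sin_PI in EU; nra).
    assert (Uj : forall j, (1 <= j < m)%nat -> 1 <= U j).
    { intros j Hj. assert (H : sin th <= sin (INR j * th)).
      { apply sin_ge_middle; trivial. destruct Hj as [H1 H2].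
        apply (le_INR 1) in H1. simpl in H1. apply (le_INR (S j)) in H2. rewrite S_INR in H2. nra. }
      rewrite <- EU in H. nra. }
    assert (HUk : U k = 0 \/ 1 <= U k) by (destruct k; [now left|right; apply Uj; lia]).
    assert (HUk1 : U (S k) = 0 \/ 1 <= U (S k)).
    { destruct (Nat.eq_dec (S k) m) as [->|]; [now left|right; apply Uj; lia]. }
    repeat split; trivial.
    destruct k as [|k]; [right|left]; apply Uj; lia.
  - assert (EU : forall j, U j = INR j).
    { intro j. unfold U. rewrite tits_form_infinite; [|intros m Hm; apply No; now exists m].
      replace (- -1) with 1 by ring. apply chebyshev_infinite. }
    rewrite !EU. assert (Pk := pos_INR k). rewrite S_INR. repeat split; try lra.
    destruct k; [now left|right]. rewrite S_INR. assert (H := pos_INR k). lra.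
Qed.

(** The induction carries both orders of the letters, since removing a first letter exchanges them,
    and two consecutive values of [k], since the Chebyshev recursion has depth two. *)
Lemma alt_value s t k y : cS X s -> cS X t ->
  let U := chebyshev (- B s t) in
  act (word (alt t s k)) y s =
  if Nat.even k then U (S k) * y s + U k * y t else U (S k) * y t + U k * y s.
Proof.
  intros Hs Ht U.
  enough (H : forall k s' t', (s' = s /\ t' = t) \/ (s' = t /\ t' = s) ->
     (act (word (alt t' s' k)) y s' =
       if Nat.even k then U (S k) * y s' + U k * y t' else U (S k) * y t' + U k * y s') /\
     (act (word (alt t' s' (S k))) y s' =
       if Nat.even (S k) then U (S (S k)) * y s' + U (S k) * y t'
       else U (S (S k)) * y t' + U (S k) * y s')) by (apply H; auto).
  clear k. induction k as [|k IH]; intros s' t' D.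
  all: assert (Hs' : cS X s') by (destruct D as [[-> ->]|[-> ->]]; trivial).
  all: assert (Ht' : cS X t') by (destruct D as [[-> ->]|[-> ->]]; trivial).
  all: assert (EB : B t' s' = B s t)
    by (destruct D as [[-> ->]|[-> ->]]; trivial; now apply tits_form_sym).
  - split.
    + simpl. rewrite act_one. unfold U. simpl. ring.
    + simpl Nat.even. unfold U. rewrite chebyshev_step. simpl.
      rewrite act_mul, act_one, act_gen by trivial. unfold refl. rewrite EB. ring.
  - destruct (IH s' t' D) as [IH1 IH2]. split; trivial.
    assert (D' : (t' = s /\ s' = t) \/ (t' = t /\ s' = s)) by tauto.
    destruct (IH t' s' D') as [IH1' IH2'].
    change (alt t' s' (S (S k))) with (t' :: alt s' t' (S k)).
    change (word (t' :: alt s' t' (S k))) with (t' ** word (alt s' t' (S k))).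
    rewrite act_mul, act_gen by trivial. unfold refl. rewrite IH2', EB.
    change (alt s' t' (S k)) with (s' :: alt t' s' k).
    change (word (s' :: alt t' s' k)) with (s' ** word (alt t' s' k)).
    rewrite act_mul, act_gen, refl_gen, IH1 by trivial.
    unfold U. rewrite (chebyshev_step _ (S k)), (chebyshev_step _ k).
    rewrite (Nat.even_succ_succ k), Nat.even_succ, <- Nat.negb_even.
    destruct (Nat.even k); simpl negb; cbv iota; ring.
Qed.

(* Tits: take a maximal alternating prefix in [s, t] of a reduced word; it is
   shorter than the order of [s t], so that the value is a nonnegative
   combination of two values covered by induction. *)
Theorem tits_positivity c y u s : 0 <= c -> (forall r, cS X r -> c <= y r) ->
  cS X s -> len (s ** u) = S (len u) -> c <= act u y s.
Proof.
  intros Hc Hy. remember (len u) as n eqn:En. revert u s En.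
  induction n as [n IH] using lt_wf_ind. intros u s En Hs L.
  destruct (classic (u = e)) as [->|Nu]; [rewrite act_one; auto|].
  destruct (left_descent u Nu) as [t [Ht Lt]].
  assert (Nst : s <> t) by (intros ->; lia).
  set (P := fun k => exists v, u = word (alt t s k) ** v /\ (len u = k + len v)%nat).
  assert (HP1 : P 1%nat).
  { exists (t ** u). simpl. gsimp. rewrite gen_cancel by trivial. split; [trivial|lia]. }
  (* The least [len u - k] gives the longest alternating prefix. *)
  destruct (nat_least (fun j => (j <= len u)%nat /\ P (len u - j)%nat)) as [j [[Hj Pj] Mj]].
  { exists (len u - 1)%nat. split; [lia|]. now replace (len u - (len u - 1))%nat with 1%nat by lia. }
  set (k := (len u - j)%nat) in *. destruct Pj as [v [Eu Lu]].
  assert (Mk : ~ P (S k)).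
  { intros [v' [E' L']]. assert (Hk : (S k <= len u)%nat) by lia.
    specialize (Mj (len u - S k)%nat). replace (len u - (len u - S k))%nat with (S k) in Mj by lia.
    assert (H : (j <= len u - S k)%nat) by (apply Mj; split; [lia|now exists v']). lia. }
  assert (Hk : (1 <= k)%nat).
  { specialize (Mj (len u - 1)%nat). replace (len u - (len u - 1))%nat with 1%nat in Mj by lia.
    assert (H : (j <= len u - 1)%nat) by (apply Mj; split; [lia|trivial]). lia. }
  (* If the prefix reached length [m], the braid relation would let [u] begin with [s], against
     [L]. *)
  assert (Hord : forall m, is_order (s ** t) m -> (k < m)%nat).
  { intros m Hm. destruct (le_lt_dec m k) as [H|H]; trivial. exfalso.
    assert (Esplit : forall i (a b : cW X), alt a b (m + i) =
      alt a b m ++ (if Nat.even m then alt a b i else alt b a i)).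
    { clear. induction m as [|m IHm]; intros i a b; trivial.
      rewrite Nat.even_succ, <- Nat.negb_even. cbn [Nat.add alt app]. rewrite IHm.
      now destruct (Nat.even m). }
    replace k with (m + (k - m))%nat in Eu by lia. rewrite Esplit, wprod_app in Eu.
    assert (Em : word (alt t s m) = word (alt s t m)).
    { symmetry. rewrite (alt_quotient s t m) by trivial. rewrite (proj1 (proj2 Hm)).
      gsimp. reflexivity. }
    rewrite Em in Eu. destruct m as [|m]; [destruct Hm; lia|].
    set (r := if Nat.even (S m) then alt t s (k - S m) else alt s t (k - S m)) in Eu.
    assert (Esu : s ** u = word (alt t s m ++ r) ** v).
    { rewrite Eu, wprod_app. simpl wprod. gsimp. now rewrite gen_cancel. }
    assert (Fr : Forall (cS X) (alt t s m ++ r)).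
    { apply Forall_app. split; [now apply alt_Forall|unfold r; destruct (Nat.even (S m)); now apply alt_Forall]. }
    assert (Lr : (length (alt t s m ++ r) = k - 1)%nat).
    { rewrite length_app, alt_length. unfold r. destruct (Nat.even (S m)); rewrite alt_length; lia. }
    assert (H1 := len_mul (word (alt t s m ++ r)) v).
    assert (H2 := len_wprod _ Fr). rewrite <- Esu in H1. lia. }
  assert (Hnext : forall i (a b : cW X), word (alt a b (S i)) =
    word (alt a b i) ** (if Nat.even i then a else b)).
  { clear - HX. induction i as [|i IHi]; intros a b.
    - simpl. gsimp. reflexivity.
    - change (word (alt a b (S (S i)))) with (a ** word (alt b a (S i))).
      rewrite IHi. change (word (alt a b (S i))) with (a ** word (alt b a i)).
      rewrite Nat.even_succ, <- Nat.negb_even. gsimp. now destruct (Nat.even i). }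
  (* [r2] would continue the prefix and [r1] is its last letter. A reduced word of [v] can begin
     with neither: the first by maximality, the second because the factorization is length
     additive. *)
  set (r1 := if Nat.even k then s else t). set (r2 := if Nat.even k then t else s).
  assert (Hr1 : cS X r1) by (unfold r1; now destruct (Nat.even k)).
  assert (Hr2 : cS X r2) by (unfold r2; now destruct (Nat.even k)).
  assert (L2 : len (r2 ** v) = S (len v)).
  { destruct (len_gen_mul r2 v Hr2) as [H|H]; trivial. exfalso. apply Mk.
    exists (r2 ** v). rewrite Hnext. fold r2. split; [|lia].
    gsimp. rewrite gen_cancel by trivial. exact Eu. }
  assert (L1 : len (r1 ** v) = S (len v)).
  { destruct (len_gen_mul r1 v Hr1) as [H|H]; trivial. exfalso.
    destruct k as [|i]; [lia|].
    assert (Er : r1 = if Nat.even i then t else s).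
    { unfold r1. rewrite Nat.even_succ, <- Nat.negb_even. now destruct (Nat.even i). }
    rewrite Hnext, <- Er in Eu.
    assert (H1 := len_mul (word (alt t s i)) (r1 ** v)).
    rewrite mulA, <- Eu in H1.
    assert (H2 := len_wprod _ (alt_Forall t s i Ht Hs)). rewrite alt_length in H2. lia. }
  assert (IHs : forall r, cS X r -> len (r ** v) = S (len v) -> c <= act v y r).
  { intros r Hr Lr. apply (IH (len v)); trivial. lia. }
  assert (V1 := IHs r1 Hr1 L1). assert (V2 := IHs r2 Hr2 L2).
  rewrite Eu, act_mul, (alt_value s t k (act v y)) by trivial.
  destruct (chebyshev_pos s t k Hs Ht Nst Hord) as [C1 [C2 C3]].
  unfold r1, r2 in V1, V2. destruct (Nat.even k); nra.
Qed.

End Action.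

(** The closed chamber [u] of the Tits cone; a point on a wall belongs to several. *)
Definition inC (u : cW X) (y : cW X -> R) : Prop :=
  forall r, cS X r -> (0 <= val u r y)%R.

Lemma list_argmin {A : Type} (l : list A) (P : A -> Prop) (f : A -> R) :
  (exists a, In a l /\ P a) ->
  exists a, In a l /\ P a /\ forall b, In b l -> P b -> (f a <= f b)%R.
Proof.
  induction l as [|c l IH]; intros [a [Ha Pa]]; [easy|].
  destruct (classic (exists a, In a l /\ P a)) as [E|N].
  - destruct (IH E) as [b [Hb [Pb Mb]]].
    destruct (classic (P c /\ (f c <= f b)%R)) as [[Pc Lc]|Nc].
    + exists c. split; [now left|split; trivial]. intros d [<-|Hd] Pd; [lra|].
      specialize (Mb d Hd Pd). lra.
    + exists b. split; [now right|split; trivial]. intros d [<-|Hd] Pd; [|auto].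
      destruct (Rle_dec (f b) (f c)); trivial. exfalso. apply Nc. split; [trivial|lra].
  - destruct Ha as [<-|Ha]; [|exfalso; apply N; now exists a].
    exists c. split; [now left|split; trivial]. intros d [<-|Hd] Pd; [lra|].
    exfalso. apply N. now exists d.
Qed.

(** * Roots and chambers of the Tits cone *)

Section Roots.
Local Notation B := tits_form.
Local Notation chp u := (act u one_pt).
Local Open Scope R_scope.

Lemma chp_pos u s : cS X s -> len (s ** u) = S (len u) -> 1 <= chp u s.
Proof.
  intros Hs L. apply tits_positivity; trivial; [lra|]. intros r _. unfold one_pt. lra.
Qed.

Lemma chp_neg u s : cS X s -> len u = S (len (s ** u)) -> chp u s <= -1.
Proof.
  intros Hs L. rewrite <- (gen_cancel s u) by trivial.
  rewrite act_mul, act_gen, refl_gen by trivial.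
  assert (H := chp_pos (s ** u) s Hs). rewrite gen_cancel in H by trivial. specialize (H L). lra.
Qed.

Lemma chp_dichotomy u s : cS X s -> 
  (1 <= chp u s /\ len (s ** u) = S (len u)) \/ (chp u s <= -1 /\ len u = S (len (s ** u))).
Proof.
  intro Hs. destruct (len_gen_mul s u Hs) as [L|L]; [left|right]; split; trivial.
  - now apply chp_pos.
  - now apply chp_neg.
Qed.

Lemma val_chp v s u : val v s (chp u) = chp (inv v ** u) s.
Proof. rewrite val_def, <- act_mul. reflexivity. Qed.

(** The dictionary between sides of walls and lengths; all later case distinctions on sides go
    through it. *)
Lemma val_chp_dichotomy v s u : cS X s ->
  (1 <= val v s (chp u) /\ len (s ** (inv v ** u)) = S (len (inv v ** u))) \/
  (val v s (chp u) <= -1 /\ len (inv v ** u) = S (len (s ** (inv v ** u)))).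
Proof. intro Hs. rewrite val_chp. now apply chp_dichotomy. Qed.

Lemma val_self v s : cS X s -> val v s (chp v) = 1.
Proof. intro Hs. rewrite val_chp. gsimp. rewrite act_one. reflexivity. Qed.

Lemma val_self_gen v s : cS X s -> val v s (chp (v ** s)) = -1.
Proof.
  intro Hs. rewrite val_chp. gsimp. rewrite act_gen, refl_gen by trivial. reflexivity.
Qed.

Lemma inC_chp u : inC u (chp u).
Proof. intros r Hr. rewrite val_self by trivial. lra. Qed.

Lemma inC_act u w y : inC u y -> inC (w ** u) (act w y).
Proof. intros H r Hr. rewrite val_act. gsimp. auto. Qed.

Lemma inC_pos u y v s : cS X s -> inC u y -> 0 < val v s (chp u) -> 0 <= val v s y.
Proof.
  intros Hs Hy H. destruct (val_chp_dichotomy v s u Hs) as [[_ L]|[H' _]]; [|lra].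
  rewrite val_def. rewrite <- (act_inv_r u y), <- act_mul.
  apply tits_positivity; trivial. lra.
Qed.

Lemma inC_neg u y v s : cS X s -> inC u y -> val v s (chp u) < 0 -> val v s y <= 0.
Proof.
  intros Hs Hy H. assert (H1 := val_gen v s (chp u) Hs). assert (H2 := val_gen v s y Hs).
  assert (H3 := inC_pos u y (v ** s) s Hs Hy). lra.
Qed.

Lemma val_neg_side u y v s : cS X s -> inC u y -> val v s y < 0 -> val v s (chp u) <= -1.
Proof.
  intros Hs Hy H. destruct (val_chp_dichotomy v s u Hs) as [[H1 _]|[H1 _]]; trivial.
  assert (H2 := inC_pos u y v s Hs Hy). lra.
Qed.

Lemma in_WJ_one (J : cW X -> Prop) : in_WJ X J e.
Proof. exists []. split; [constructor|reflexivity]. Qed.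

Lemma in_WJ_cons (J : cW X -> Prop) s u : J s -> in_WJ X J u -> in_WJ X J (s ** u).
Proof. intros Hs [l [Hl ->]]. exists (s :: l). split; [now constructor|reflexivity]. Qed.

Lemma in_WJ_fix (J : cW X -> Prop) z u : (forall s, J s -> cS X s /\ z s = 0) ->
  in_WJ X J u -> act u z = z.
Proof.
  intros HJ [l [Hl ->]]. induction Hl as [|s l Hs Hl IH]; [apply act_one|].
  change (word (s :: l)) with (s ** word l). destruct (HJ s Hs) as [H1 H2].
  rewrite act_mul, IH, act_gen by trivial. now apply refl_fix.
Qed.

(** Positivity forces a left descent [s] of [u] to vanish at [act u z], so stripping it does not
    move that point. By induction the point is [z] itself, and then [z s = 0]. *)
Lemma stabilizer_in_WJ z u : inC e z -> inC (inv u) z ->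
  in_WJ X (fun s => cS X s /\ z s = 0) u.
Proof.
  intros Hz. remember (len u) as n eqn:En. revert u En.
  induction n as [|n IH]; intros u En Hu.
  - rewrite (len_zero u) by auto. apply in_WJ_one.
  - destruct (left_descent u) as [s [Hs L]].
    { intros ->. rewrite len_one in En. lia. }
    assert (Pz : forall r, cS X r -> 0 <= z r).
    { intros r Hr. specialize (Hz r Hr). rewrite val_def in Hz. revert Hz. gsimp.
      now rewrite act_one. }
    assert (Pu : forall r, cS X r -> 0 <= act u z r).
    { intros r Hr. specialize (Hu r Hr). rewrite val_def in Hu. revert Hu. now gsimp. }
    assert (E0 : act u z s = 0).
    { apply Rle_antisym; [|auto]. 
      assert (H : 0 <= act (s ** u) z s).
      { apply tits_positivity; trivial; [lra|]. now rewrite gen_cancel. }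
      rewrite act_mul, act_gen, refl_gen in H by trivial. lra. }
    assert (Esu : act (s ** u) z = act u z).
    { rewrite act_mul, act_gen by trivial. now apply refl_fix. }
    assert (W : in_WJ X (fun s => cS X s /\ z s = 0) (s ** u)).
    { apply IH; [lia|]. intros r Hr. rewrite val_def, (grp_inv_inv GX), Esu. auto. }
    assert (Ez : act (s ** u) z = z) by (revert W; apply in_WJ_fix; auto).
    rewrite <- (gen_cancel s u) by trivial. apply in_WJ_cons; trivial. split; trivial.
    congruence.
Qed.

Lemma gen_pair_in_WJ r u : cS X r -> in_WJ X (fun s => cS X s /\ s = r) u -> u = e \/ u = r.
Proof.
  intros Hr [l [Hl ->]]. induction Hl as [|s l [_ ->] Hl IH]; [now left|].
  change (word (r :: l)) with (r ** word l). destruct IH as [->| ->].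
  - right. gsimp. reflexivity.
  - left. now apply gen_sq.
Qed.

Lemma val_refl_mul a r s y : cS X r -> cS X s -> r ** a = a ** s ->
  act a y r = y s * act a (B s) r.
Proof.
  intros Hr Hs E. assert (H : act (r ** a) y r = act (a ** s) y r) by now rewrite E.
  rewrite !act_mul, (act_gen r), refl_gen, (act_gen s) in H by trivial.
  assert (E2 : refl s y = lincomb 1 (- 2 * y s) y (B s)).
  { apply functional_extensionality. intro q. unfold refl, lincomb. ring. }
  rewrite E2, act_lincomb in H. unfold lincomb in H. lra.
Qed.

(** A nonzero factor of unknown sign is enough to transport zeros, and signs up to one global
    change. *)
Lemma same_wall_proportional u r v s : cS X r -> cS X s ->
  u ** r ** inv u = v ** s ** inv v ->
  exists k, k <> 0 /\ forall y, val u r y = k * val v s y.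
Proof.
  intros Hr Hs E. set (a := inv u ** v).
  assert (Ea : r ** a = a ** s).
  { unfold a. apply (grp_cancel_l GX u). gsimp.
    apply (grp_cancel_r GX (inv v)). gsimp. gsimp_in E. exact E. }
  assert (H : forall y, val u r y = act a (B s) r * val v s y).
  { intro y. rewrite !val_def. rewrite Rmult_comm, <- (val_refl_mul a r s) by trivial.
    rewrite <- act_mul. unfold a. gsimp. reflexivity. }
  exists (act a (B s) r). split; trivial. intro E0.
  specialize (H (chp u)). rewrite val_self, E0 in H by trivial. lra.
Qed.

(* [gamma = y |-> act a y r] is a nonnegative functional which becomes
   nonpositive after the reflection [s]; hence it is a multiple of evaluation at
   [s], so [r a s a^-1] fixes an interior point of the facet [r]. *)
Lemma fold_equality a r s : cS X r -> cS X s ->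
  len (r ** a) = S (len a) -> len (a ** s) = S (len (r ** (a ** s))) -> r ** a = a ** s.
Proof.
  intros Hr Hs L1 L2.
  assert (P1 : forall y, (forall q, cS X q -> 0 <= y q) -> 0 <= act a y r).
  { intros y Hy. apply tits_positivity; trivial. lra. }
  assert (P2 : forall y, (forall q, cS X q -> 0 <= y q) -> act (a ** s) y r <= 0).
  { intros y Hy. assert (H : 0 <= act (r ** (a ** s)) y r).
    { apply tits_positivity; trivial; [lra|]. now rewrite gen_cancel. }
    rewrite (act_mul r), (act_gen r), refl_gen in H by trivial. lra. }
  assert (P3 : forall y, (forall q, cS X q -> 0 <= y q) -> y s = 0 -> act a y r = 0).
  { intros y Hy E. assert (H1 := P1 y Hy). assert (H2 := P2 y Hy).
    rewrite act_mul, (act_gen s), refl_fix in H2 by trivial. lra. }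
  (* Split [y] into its positive and negative parts, both of which vanish at [s]. *)
  assert (P4 : forall y, y s = 0 -> act a y r = 0).
  { intros y E.
    assert (Ey : y = lincomb 1 (-1) (fun q => Rmax (y q) 0) (fun q => Rmax (- y q) 0)).
    { apply functional_extensionality. intro q. unfold lincomb, Rmax.
      destruct (Rle_dec (y q) 0), (Rle_dec (- y q) 0); lra. }
    rewrite Ey, act_lincomb. unfold lincomb. rewrite !P3; try lra.
    - intros q _. apply Rmax_r.
    - rewrite E, Ropp_0. unfold Rmax. destruct (Rle_dec 0 0); lra.
    - intros q _. apply Rmax_r.
    - rewrite E. unfold Rmax. destruct (Rle_dec 0 0); lra. }
  set (E := fun q : cW X => if excluded_middle_informative (q = s) then 1 else 0).
  assert (Es : E s = 1) by (unfold E; destruct (excluded_middle_informative _); easy).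
  assert (P5 : forall y, act a y r = y s * act a E r).
  { intro y. assert (H : act a (lincomb 1 (- y s) y E) r = 0).
    { apply P4. unfold lincomb. rewrite Es. ring. }
    rewrite act_lincomb in H. unfold lincomb in H. lra. }
  assert (HE : act a E r <> 0).
  { intro E0. assert (H := P5 one_pt). rewrite E0 in H.
    assert (H1 := chp_pos a r Hr L1). lra. }
  set (f := fun q : cW X => if excluded_middle_informative (q = r) then 0 else 1).
  assert (Fr : f r = 0) by (unfold f; destruct (excluded_middle_informative _); easy).
  assert (Fq : forall q, f q = 0 -> q = r).
  { intros q. unfold f. destruct (excluded_middle_informative _); trivial. lra. }
  assert (Fp : forall q, 0 <= f q).
  { intro q. unfold f. destruct (excluded_middle_informative _); lra. }
  set (h := r ** a ** s ** inv a).
  assert (Hh : act h f = f).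
  { unfold h. rewrite !act_mul.
    assert (E0 : act (inv a) f s = 0).
    { assert (H := P5 (act (inv a) f)). rewrite act_inv_r, Fr in H.
      symmetry in H. apply Rmult_integral in H. tauto. }
    rewrite (act_gen s), refl_fix, act_inv_r, act_gen by trivial.
    now apply refl_fix. }
  assert (W : in_WJ X (fun q => cS X q /\ f q = 0) h).
  { apply stabilizer_in_WJ.
    - intros q Hq. rewrite val_def. gsimp. rewrite act_one. auto.
    - intros q Hq. rewrite val_def. gsimp. rewrite Hh. auto. }
  (* [h] fixes a point whose only zero is at [r], so it is [e] or [r]; the second would give
     [s = e]. *)
  destruct (gen_pair_in_WJ r h Hr) as [Eh|Eh].
  { destruct W as [l [Hl El]]. exists l. split; trivial. revert Hl. apply Forall_impl.
    intros q [H1 H2]. auto. }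
  - unfold h in Eh. apply (grp_cancel_r GX s). rewrite gen_cancel_r by trivial.
    apply (grp_cancel_r GX (inv a)). rewrite Eh. gsimp. reflexivity.
  - exfalso. apply (gen_neq_one s Hs). unfold h in Eh.
    rewrite <- !mulA in Eh.
    rewrite <- (grp_oner GX r) in Eh at 2.
    apply (grp_cancel_l GX) in Eh.
    apply (grp_cancel_l GX a). gsimp.
    apply (grp_cancel_r GX (inv a)). gsimp. exact Eh.
Qed.

Lemma wall_unique u r v s : cS X r -> cS X s ->
  val u r (chp v) * val u r (chp (v ** s)) < 0 -> u ** r ** inv u = v ** s ** inv v.
Proof.
  intros Hr Hs H.
  enough (Ea : r ** (inv u ** v) = inv u ** v ** s).
  { apply (grp_cancel_l GX (inv u)). apply (grp_cancel_r GX v).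
    gsimp. gsimp_in Ea. exact Ea. }
  destruct (val_chp_dichotomy u r v Hr) as [[H1 L1]|[H1 L1]],
    (val_chp_dichotomy u r (v ** s) Hr) as [[H2 L2]|[H2 L2]]; try nra.
  - apply fold_equality; trivial. gsimp. exact L2.
  - assert (E : r ** (inv u ** (v ** s)) = inv u ** (v ** s) ** s).
    { apply fold_equality; trivial. gsimp. rewrite gen_sq by trivial. gsimp. exact L1. }
    apply (grp_cancel_r GX s). gsimp. rewrite gen_sq by trivial. gsimp.
    gsimp_in E. rewrite gen_sq in E by trivial. gsimp_in E. exact E.
Qed.

Lemma val_reflection v s y : cS X s -> val v s (act (v ** s ** inv v) y) = - val v s y.
Proof.
  intro Hs. rewrite val_act. gsimp. rewrite (gen_inv s) by trivial. now apply val_gen.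
Qed.

(** The deleted letter is the one at which the gallery crosses the wall: by [wall_unique] the
    reflection swaps the two chambers there. Keeping the letters in [J] makes the result usable
    inside cosets of [W_J]. *)
Lemma exchange (J : cW X -> Prop) v s p l : (forall r, J r -> cS X r) -> cS X s -> Forall J l ->
  val v s (chp p) * val v s (chp (p ** word l)) < 0 ->
  exists l', Forall J l' /\ length l = S (length l') /\
    v ** s ** inv v ** (p ** word l) = p ** word l'.
Proof.
  intros HJ Hs Hl. revert p. induction Hl as [|r l Hr Hl IH]; intros p H.
  - simpl in H. gsimp_in H. nra.
  - assert (Hr' := HJ r Hr). change (word (r :: l)) with (r ** word l) in *.
    destruct (Rlt_dec (val v s (chp p) * val v s (chp (p ** r))) 0) as [N|N].
    + exists l. split; [trivial|split; [reflexivity|]].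
      rewrite (wall_unique v s p r) by trivial. gsimp. now rewrite gen_cancel.
    + destruct (IH (p ** r)) as [l' [H1 [H2 H3]]].
      { revert H N. rewrite !mulA.
        destruct (val_chp_dichotomy v s p Hs) as [[A1 _]|[A1 _]],
          (val_chp_dichotomy v s (p ** r) Hs) as [[A2 _]|[A2 _]]; intros; nra. }
      exists (r :: l'). split; [now constructor|split; [simpl; lia|]].
      simpl wprod. gsimp_in H3. gsimp. exact H3.
Qed.

Lemma strong_exchange v s u : cS X s ->
  val v s (chp e) * val v s (chp u) < 0 -> (len (v ** s ** inv v ** u) < len u)%nat.
Proof.
  intros Hs H. destruct (reduced_word u) as [l [Hl [El Ll]]].
  destruct (exchange (cS X) v s e l (fun _ H => H) Hs Hl) as [l' [H1 [H2 H3]]].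
  - gsimp. now rewrite <- El.
  - rewrite <- El in H3. rewrite !mul1 in H3. rewrite H3.
    assert (H4 := len_wprod l' H1). lia.
Qed.

(** A single gallery from [a] to [b] crosses every separating wall, so its steps, recorded as
    (chamber, letter), list them all. *)
Lemma inversions a b : exists L : list (cW X * cW X),
  (forall p, In p L -> cS X (snd p)) /\
  forall v s, cS X s -> val v s (chp a) * val v s (chp b) < 0 ->
    exists p, In p L /\ v ** s ** inv v = fst p ** snd p ** inv (fst p).
Proof.
  destruct (reduced_word (inv a ** b)) as [l [Hl [El _]]].
  assert (Eb : b = a ** word l) by (rewrite <- El; gsimp; reflexivity).
  clear El. subst b. revert a. induction Hl as [|r l Hr Hl IH]; intro a.
  - exists []. split; [easy|]. intros v s Hs H. simpl in H. gsimp_in H. nra.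
  - destruct (IH (a ** r)) as [L [H1 H2]]. exists ((a, r) :: L). split.
    + intros p [<-|Hp]; auto.
    + intros v s Hs H. change (word (r :: l)) with (r ** word l) in H.
      destruct (Rlt_dec (val v s (chp a) * val v s (chp (a ** r))) 0) as [N|N].
      * exists (a, r). split; [now left|]. now apply wall_unique.
      * destruct (H2 v s Hs) as [p [Hp Ep]].
        { revert H N. rewrite !mulA.
          destruct (val_chp_dichotomy v s a Hs) as [[A1 _]|[A1 _]],
          (val_chp_dichotomy v s (a ** r) Hs) as [[A2 _]|[A2 _]]; intros; nra. }
        exists p. split; [now right|trivial].
Qed.

(** A letter of [b] that shortens the product recrosses a wall between [e] and [a]. One sign pattern
    suffices, as [(v ** s, s)] names the opposite root. *)
Lemma len_additive a b :
  (forall v s, cS X s -> val v s (chp e) < 0 -> 0 < val v s (chp a) ->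
    val v s (chp (a ** b)) < 0 -> False) -> len (a ** b) = (len a + len b)%nat.
Proof.
  remember (len b) as n eqn:En. revert b En. induction n as [|n IH]; intros b En H.
  - rewrite (len_zero b) by auto. gsimp. lia.
  - destruct (right_descent b) as [r [Hr L]].
    { intros ->. rewrite len_one in En. lia. }
    assert (Ab : a ** b = a ** (b ** r) ** r).
    { gsimp. rewrite gen_sq by trivial. gsimp. reflexivity. }
    assert (Pa : 0 < val (a ** (b ** r)) r (chp a)).
    { destruct (val_chp_dichotomy (a ** (b ** r)) r a Hr) as [[A _]|[_ A]]; [lra|exfalso].
      rewrite <- (len_inv (_ ** _)), <- (len_inv (r ** _)) in A. gsimp_in A.
      lia. }
    assert (IHb : len (a ** (b ** r)) = (len a + n)%nat).
    { apply IH; [lia|]. intros v s Hs H1 H2 H3.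
      destruct (val_chp_dichotomy v s (a ** b) Hs) as [[A _]|[A _]];
        [|apply (H v s Hs); trivial; lra].
      destruct (same_wall_proportional v s (a ** (b ** r)) r) as [k [_ Ek]]; trivial.
      { apply wall_unique; trivial. rewrite <- Ab. nra. }
      rewrite Ek, val_self in H3 by trivial. rewrite Ek in H2. nra. }
    destruct (len_mul_gen r (a ** (b ** r)) Hr) as [A|A]; rewrite <- Ab in A; [lia|exfalso].
    destruct (val_chp_dichotomy (a ** (b ** r)) r e Hr) as [[_ C]|[C _]].
    + rewrite <- (len_inv (_ ** _)), <- (len_inv (inv _ ** _)) in C. gsimp_in C.
      lia.
    + apply (H (a ** (b ** r)) r Hr); trivial; [lra|].
      rewrite Ab, val_self_gen by trivial. lra.
Qed.

(** Follows the segment from [x] to [y] chamber by chamber. Every wall crossed has [vy] on its far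
    side, so [len (inv v ** vy)] decreases even when several walls are met at the same parameter. *)
Lemma walk (Q : cW X -> Prop) v0 vy x y :
  Q v0 -> inC v0 x -> inC vy y ->
  (forall v s t, Q v -> cS X s -> 0 <= t <= 1 -> inC v (lincomb (1 - t) t x y) ->
     val v s (lincomb (1 - t) t x y) = 0 -> val v s y < 0 -> Q (v ** s)) ->
  forall t, 0 <= t <= 1 -> exists v, Q v /\ inC v (lincomb (1 - t) t x y).
Proof.
  intros Q0 Hx Hy Step t1 Ht1.
  enough (Main : forall n v t0, n = len (inv v ** vy) -> Q v -> 0 <= t0 <= t1 ->
    inC v (lincomb (1 - t0) t0 x y) -> exists v, Q v /\ inC v (lincomb (1 - t1) t1 x y)).
  { apply (Main _ v0 0 eq_refl Q0); [lra|].
    replace (lincomb (1 - 0) 0 x y) with x; trivial.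
    apply functional_extensionality. intro q. unfold lincomb. ring. }
  destruct (cs_finite X HX) as [S HS].
  induction n as [n IH] using lt_wf_ind. intros v t0 En Qv Ht0 H0.
  destruct (classic (inC v (lincomb (1 - t1) t1 x y))) as [|N]; [now exists v|].
  set (f := fun r t => val v r (lincomb (1 - t) t x y)) in *.
  assert (Ef : forall r t, f r t = (1 - t) * val v r x + t * val v r y).
  { intros r t. apply val_lincomb. }
  set (z := fun r => val v r x / (val v r x - val v r y)).
  destruct (list_argmin S (fun r => f r t1 < 0) z) as [s [Is [Fs Ms]]].
  { apply NNPP. intro N2. apply N. intros r Hr. apply Rnot_lt_le. intro Hlt. apply N2.
    exists r. split; [now apply HS|trivial]. }
  assert (Hs : cS X s) by now apply HS.
  assert (Hz : forall r, cS X r -> f r t1 < 0 ->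
    t0 <= z r < t1 /\ (forall t, t <= z r -> 0 <= f r t) /\ f r (z r) = 0 /\ val v r y < 0).
  { intros r Hr Hf. assert (F0 : 0 <= f r t0) by apply (H0 r Hr). rewrite Ef in Hf, F0.
    assert (D : 0 < val v r x - val v r y) by nra.
    assert (Ez : z r * (val v r x - val v r y) = val v r x) by (unfold z; field; lra).
    repeat split.
    - apply Rnot_lt_le. intro C. nra.
    - apply Rnot_le_lt. intro C. nra.
    - intros t Htz. rewrite Ef. nra.
    - rewrite Ef. nra.
    - apply Rnot_le_lt. intro C. nra. }
  destruct (Hz s Hs Fs) as [[Z1 Z2] [Z3 [Z4 Z5]]].
  assert (Hv : inC v (lincomb (1 - z s) (z s) x y)).
  { intros r Hr. change (0 <= f r (z s)). destruct (Rlt_dec (f r t1) 0) as [C|C].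
    - destruct (Hz r Hr C) as [_ [Hz2 _]]. apply Hz2, Ms; trivial. now apply HS.
    - assert (F0 : 0 <= f r t0) by apply (H0 r Hr). rewrite Ef in *. nra. }
  assert (Hvs : inC (v ** s) (lincomb (1 - z s) (z s) x y)).
  { intros r Hr. rewrite val_def. gsimp. rewrite (gen_inv s), act_mul, act_gen by trivial.
    rewrite refl_fix by exact Z4. apply (Hv r Hr). }
  assert (Qs : Q (v ** s)) by (apply (Step v s (z s)); trivial; lra).
  apply (IH (len (inv (v ** s) ** vy))) with (v := v ** s) (t0 := z s); trivial; [|lra].
  assert (Hn := val_neg_side vy y v s Hs Hy Z5).
  destruct (val_chp_dichotomy v s vy Hs) as [[A _]|[_ A]]; [lra|].
  gsimp. rewrite (gen_inv s) by trivial. lia.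
Qed.

Lemma cone_convex v0 vy x y t : inC v0 x -> inC vy y -> 0 <= t <= 1 ->
  exists v, inC v (lincomb (1 - t) t x y).
Proof.
  intros Hx Hy Ht.
  destruct (walk (fun _ => True) v0 vy x y I Hx Hy (fun _ _ _ _ _ _ _ _ _ => I) t Ht) as [v [_ Hv]].
  now exists v.
Qed.

End Roots.

(** * Averages of two-sided sequences *)

Section Averages.
Local Open Scope R_scope.

Lemma Rabs_le_inv a b : Rabs a <= b -> - b <= a <= b.
Proof. intro H. assert (H1 := Rle_abs a). assert (H2 := Rle_abs (- a)). rewrite Rabs_Ropp in H2. lra. Qed.

Definition avg (g : Z -> R) : Z -> R := fun j => (g j + g (j + 1)%Z) / 2.

(** The mean of g j, ..., g (j + K) with binomial weights. *)
Definition avgn (K : nat) (g : Z -> R) : Z -> R := Nat.iter K avg g.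

Fixpoint psum (n : nat) (g : Z -> R) (j : Z) : R :=
  match n with 0 => 0 | S n => g j + psum n g (j + 1)%Z end.

Definition periodic (p : nat) (g : Z -> R) : Prop := forall j, g (j + Z.of_nat p)%Z = g j.

Lemma avgn_S K g j : avgn (S K) g j = (avgn K g j + avgn K g (j + 1)%Z) / 2.
Proof. reflexivity. Qed.

Lemma avgn_add K L g : avgn (K + L) g = avgn K (avgn L g).
Proof. apply Nat.iter_add. Qed.

Lemma avgn_ext K f g j : (forall k, (j <= k <= j + Z.of_nat K)%Z -> f k = g k) ->
  avgn K f j = avgn K g j.
Proof.
  revert j. induction K as [|K IH]; intros j H.
  - apply H. lia.
  - rewrite !avgn_S, (IH j), (IH (j + 1)%Z); trivial; intros k Hk; apply H; lia.
Qed.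

Lemma avgn_le K f g j : (forall k, f k <= g k) -> avgn K f j <= avgn K g j.
Proof.
  intro H. revert j. induction K as [|K IH]; intro j; [apply H|].
  rewrite !avgn_S. assert (H1 := IH j). assert (H2 := IH (j + 1)%Z). lra.
Qed.

Lemma avgn_affine K a c g j : avgn K (fun k => c + a * g k) j = c + a * avgn K g j.
Proof.
  revert j. induction K as [|K IH]; intro j; [reflexivity|]. rewrite !avgn_S, !IH. lra.
Qed.

Lemma avgn_const K c j : avgn K (fun _ => c) j = c.
Proof.
  revert j. induction K as [|K IH]; intro j; [reflexivity|]. rewrite !avgn_S, !IH. lra.
Qed.

Lemma avgn_periodic K p g : periodic p g -> periodic p (avgn K g).
Proof.
  intro H. induction K as [|K IH]; intro j; [apply H|]. rewrite !avgn_S, <- (IH j), <- (IH (j + 1)%Z).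
  do 3 f_equal. lia.
Qed.

Lemma psum_snoc n g j : psum (S n) g j = psum n g j + g (j + Z.of_nat n)%Z.
Proof.
  revert j. induction n as [|n IH]; intro j.
  - simpl. rewrite Z.add_0_r. ring.
  - change (g j + psum (S n) g (j + 1)%Z = psum (S n) g j + g (j + Z.of_nat (S n))%Z).
    rewrite IH. simpl psum. replace (j + 1 + Z.of_nat n)%Z with (j + Z.of_nat (S n))%Z by lia. ring.
Qed.

Lemma psum_periodic p g j j' : periodic p g -> psum p g j = psum p g j'.
Proof.
  intro H. assert (E : forall j, psum p g (j + 1)%Z = psum p g j).
  { intro i. assert (H1 := psum_snoc p g i). simpl in H1. rewrite (H i) in H1. lra. }
  assert (E0 : forall j, psum p g j = psum p g 0%Z).
  { intro i. induction i as [|i IH|i IH] using Z.peano_ind; trivial.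
    - unfold Z.succ. now rewrite E.
    - rewrite <- IH, <- (E (Z.pred i)). f_equal. lia. }
  now rewrite E0, (E0 j').
Qed.

Lemma psum_affine n a c g j : psum n (fun k => c + a * g k) j = INR n * c + a * psum n g j.
Proof.
  revert j. induction n as [|n IH]; intro j; [simpl; ring|].
  rewrite S_INR. simpl. rewrite IH. ring.
Qed.

Lemma psum_avg n g j : psum n (avg g) j = (psum n g j + psum n g (j + 1)%Z) / 2.
Proof.
  revert j. induction n as [|n IH]; intro j; [simpl; lra|].
  simpl. rewrite IH. unfold avg. lra.
Qed.

Lemma psum_avgn K p g j : periodic p g -> psum p (avgn K g) j = psum p g j.
Proof.
  intro H. induction K as [|K IH]; [reflexivity|].
  change (avgn (S K) g) with (avg (avgn K g)). rewrite psum_avg.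
  rewrite (psum_periodic p (avgn K g) (j + 1) j) by now apply avgn_periodic.
  rewrite IH. lra.
Qed.

Lemma psum_nonneg n g j : (forall k, 0 <= g k) -> 0 <= psum n g j.
Proof.
  intro H. revert j. induction n as [|n IH]; intro j; simpl; [lra|].
  assert (H1 := H j). assert (H2 := IH (j + 1)%Z). lra.
Qed.

(** Every binomial weight is at least 2^-n. *)
Lemma avgn_ge_psum n g j : (forall k, 0 <= g k) -> (/ 2) ^ n * psum (S n) g j <= avgn n g j.
Proof.
  intro H. revert j. induction n as [|n IH]; intro j.
  - simpl. lra.
  - rewrite avgn_S. assert (H1 := IH j). assert (H2 := IH (j + 1)%Z).
    assert (H3 := psum_nonneg n g (j + 1) H). assert (Hp : 0 < (/ 2) ^ n) by (apply pow_lt; lra).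
    assert (E1 : psum (S (S n)) g j = g j + psum (S n) g (j + 1)%Z) by reflexivity.
    assert (E2 : psum (S n) g j = g j + psum n g (j + 1)%Z) by reflexivity.
    rewrite E1, <- tech_pow_Rmult. rewrite E2 in H1. nra.
Qed.

(** Apply [avgn_ge_psum] to M - g, which is nonnegative and has sum p M over a period; likewise to M
    + g. *)
Lemma avgn_contraction p g M : (1 <= p)%nat -> periodic p g -> psum p g 0 = 0 ->
  (forall k, Rabs (g k) <= M) -> forall j, Rabs (avgn p g j) <= (1 - (/ 2) ^ p) * M.
Proof.
  intros Hp Hper H0 HM j.
  enough (H : forall h, periodic p h -> psum p h 0 = 0 -> (forall k, Rabs (h k) <= M) ->
      avgn p h j <= (1 - (/ 2) ^ p) * M).
  { apply Rabs_le. split; [|now apply H].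
    assert (H1 : avgn p (fun k => 0 + (-1) * g k) j <= (1 - (/ 2) ^ p) * M).
    { apply H.
      - intro k. now rewrite Hper.
      - rewrite psum_affine, H0. ring.
      - intro k. replace (0 + -1 * g k) with (- g k) by ring. now rewrite Rabs_Ropp. }
    rewrite avgn_affine in H1. lra. }
  clear - Hp. intros h Hper H0 HM.
  assert (HM0 : 0 <= M) by (assert (H := HM 0%Z); assert (H' := Rabs_pos (h 0%Z)); lra).
  assert (Hr : forall k, 0 <= M + -1 * h k).
  { intro k. assert (H := HM k). assert (H' := Rle_abs (h k)). lra. }
  assert (H1 := avgn_ge_psum p _ j Hr). rewrite avgn_affine in H1.
  rewrite psum_snoc, psum_affine, (psum_periodic p h j 0 Hper), H0 in H1.
  assert (H2 := Hr (j + Z.of_nat p)%Z). assert (Hq : 0 < (/ 2) ^ p) by (apply pow_lt; lra).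
  apply (le_INR 1) in Hp. simpl in Hp.
  assert (H3 : M <= INR p * M + -1 * 0 + (M + -1 * h (j + Z.of_nat p)%Z)) by nra.
  apply (Rmult_le_compat_l ((/ 2) ^ p)) in H3; lra.
Qed.

Lemma avgn_bounded K g M j : (forall k, Rabs (g k) <= M) -> Rabs (avgn K g j) <= M.
Proof.
  intro H. apply Rabs_le. split.
  - rewrite <- (avgn_const K (- M) j). apply avgn_le. intro k.
    assert (H1 := H k). apply Rabs_le_inv in H1. lra.
  - rewrite <- (avgn_const K M j). apply avgn_le. intro k.
    assert (H1 := H k). apply Rabs_le_inv in H1. lra.
Qed.

Lemma avgn_iterated_contraction p q g M : (1 <= p)%nat -> periodic p g -> psum p g 0 = 0 ->
  (forall k, Rabs (g k) <= M) -> forall j, Rabs (avgn (q * p) g j) <= (1 - (/ 2) ^ p) ^ q * M.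
Proof.
  intros Hp Hper H0 HM. induction q as [|q IH]; intro j.
  - simpl. rewrite Rmult_1_l. apply HM.
  - simpl Nat.mul. rewrite avgn_add, <- tech_pow_Rmult, Rmult_assoc.
    apply avgn_contraction; trivial.
    + now apply avgn_periodic.
    + now rewrite psum_avgn.
Qed.

(** The averages approach the mean mu / p at a geometric rate. [K0] does not depend on [g]: one
    exponent has to serve a whole hull of points. *)
Lemma periodic_positive p M mu : (1 <= p)%nat -> 0 < mu ->
  exists K0, forall K, (K0 <= K)%nat -> forall g, periodic p g -> (forall k, Rabs (g k) <= M) ->
    psum p g 0 = mu -> forall j, 0 < avgn K g j.
Proof.
  intros Hp Hmu. assert (Hp' := le_INR 1 p Hp). simpl in Hp'.
  set (c := mu / INR p). assert (Hc : 0 < c) by (apply Rdiv_lt_0_compat; lra).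
  assert (Hq : 0 < (/ 2) ^ p) by (apply pow_lt; lra).
  assert (Hq1 : (/ 2) ^ p <= 1).
  { rewrite <- (pow1 p). apply pow_incr. lra. }
  set (M' := Rmax M 0 + c). assert (HM' : 0 < M').
  { unfold M'. assert (H := Rmax_r M 0). lra. }
  destruct (pow_lt_1_zero (1 - (/ 2) ^ p)) with (y := c / M') as [q Hqq].
  - rewrite Rabs_pos_eq; lra.
  - now apply Rdiv_lt_0_compat.
  - exists (q * p)%nat. intros K HK g Hper HM Hsum j.
    replace K with ((K - q * p) + q * p)%nat by lia. rewrite avgn_add.
    specialize (Hqq q (le_n q)). apply Rabs_def2 in Hqq. destruct Hqq as [Hqq _].
    assert (HB : forall k, Rabs (avgn (q * p) (fun k => - c + 1 * g k) k) <=
      (1 - (/ 2) ^ p) ^ q * M').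
    { apply avgn_iterated_contraction; trivial.
      - intro k. now rewrite Hper.
      - rewrite psum_affine, Hsum. unfold c. field. lra.
      - intro k. specialize (HM k). apply Rabs_le_inv in HM. apply Rabs_le. unfold M'.
        assert (H1 := Rmax_l M 0). lra. }
    assert (HB2 := avgn_bounded (K - q * p) _ _ j HB).
    assert (E : avgn (K - q * p) (avgn (q * p) (fun k => - c + 1 * g k)) j =
      - c + avgn (K - q * p) (avgn (q * p) g) j).
    { rewrite <- !avgn_add, avgn_affine. ring. }
    rewrite E in HB2. apply Rabs_le_inv in HB2.
    assert (H3 : (1 - (/ 2) ^ p) ^ q * M' < c).
    { apply (Rmult_lt_compat_r M') in Hqq; trivial.
      replace (c / M' * M') with c in Hqq by (field; lra). exact Hqq. }
    lra.
Qed.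

(* A sequence which is at least 1 off a finite set dominates a periodic sequence
   of large period and positive mean. *)
Lemma eventually_positive (m : Z) (C : R) : (0 <= m)%Z ->
  exists K0, forall K, (K0 <= K)%nat -> forall g, (forall k, (k <= - m \/ m <= k)%Z -> 1 <= g k) ->
    (forall k, (- m <= k <= m)%Z -> - C <= g k) -> forall j, 0 < avgn K g j.
Proof.
  intro Hm. set (D := Rmax C 0). assert (HD1 := Rmax_l C 0). assert (HD2 := Rmax_r C 0).
  fold D in HD1, HD2. set (N := Z.to_nat (2 * m + 1)).
  (* [G] below equals -D on [N] residues modulo [p] and 1 on the others, with sum p - (1 + D) N over
     a period. This [p] makes the sum positive and exceeds [N]. *)
  destruct (INR_unbounded ((1 + D) * INR N + INR N)) as [p Hp].
  assert (HN : (1 <= N)%nat) by lia. assert (HN' := le_INR 1 N HN). simpl in HN'.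
  assert (HpN : (N < p)%nat) by (apply INR_lt; nra).
  set (G := fun k : Z => if Z_lt_dec ((k + m) mod Z.of_nat p) (Z.of_nat N) then - D else 1).
  assert (HG : periodic p G).
  { intro j. unfold G. replace (j + Z.of_nat p + m)%Z with (j + m + 1 * Z.of_nat p)%Z by lia.
    rewrite Z.mod_add by lia. reflexivity. }
  assert (HS : forall n, (n <= p)%nat -> INR n - (1 + D) * INR (min n N) <= psum n G (- m)).
  { induction n as [|n IH]; intro Hn; [simpl; lra|]. specialize (IH ltac:(lia)).
    rewrite psum_snoc. unfold G at 2.
    replace (- m + Z.of_nat n + m)%Z with (Z.of_nat n) by lia. rewrite Z.mod_small by lia.
    destruct (Z_lt_dec (Z.of_nat n) (Z.of_nat N)) as [H|H].
    - rewrite !Nat.min_l in * by lia. rewrite S_INR. lra.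
    - rewrite !Nat.min_r in * by lia. rewrite S_INR. lra. }
  specialize (HS p (le_n p)). rewrite Nat.min_r in HS by lia.
  destruct (periodic_positive p (D + 1) (psum p G 0)) as [K0 HK0]; [lia| |].
  { rewrite (psum_periodic p G 0 (- m) HG). nra. }
  exists K0. intros K HK g Hg1 Hg2 j. apply Rlt_le_trans with (avgn K G j).
  - apply HK0; trivial. intro k. unfold G. destruct (Z_lt_dec _ _); apply Rabs_le; lra.
  - apply avgn_le. intro k. unfold G.
    destruct (Z_le_dec k (- m)) as [H1|H1].
    { specialize (Hg1 k (or_introl H1)). destruct (Z_lt_dec _ _); lra. }
    destruct (Z_le_dec m k) as [H2|H2].
    { specialize (Hg1 k (or_intror H2)). destruct (Z_lt_dec _ _); lra. }
    rewrite Z.mod_small by lia. destruct (Z_lt_dec _ _) as [H|H]; [|lia].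
    specialize (Hg2 k ltac:(lia)). lra.
Qed.

(** Comes from i binom(n, i) = n binom(n - 1, i - 1). For -K - 1 < j < 0 the two coefficients have
    opposite signs, so a positive left side and a nonnegative average at [j] force a positive
    average at [j + 1]. *)
Lemma avgn_mul_index K f j : avgn (S K) (fun i => IZR i * f i) j =
  (IZR j * avgn K f j + IZR (Z.of_nat K + 1 + j) * avgn K f (j + 1)%Z) / 2.
Proof.
  enough (H : forall j, avgn (S K) (fun i => IZR i * f i) j =
    IZR j * avgn (S K) f j + (INR K + 1) / 2 * avgn K f (j + 1)%Z).
  { rewrite H, avgn_S, !plus_IZR, <- INR_IZR_INZ. lra. }
  clear j. induction K as [|K IH]; intro j.
  - unfold avgn. simpl. unfold avg. rewrite plus_IZR. lra.
  - rewrite avgn_S, !IH. rewrite (avgn_S (S K) f j), (avgn_S K f (j + 1)), plus_IZR, S_INR.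
    lra.
Qed.

(* The sequence [i |-> i f(i)] is eventually positive, and its averages are the
   combinations of consecutive averages of [f] given by [avgn_mul_index]. *)
Lemma single_sign_change (m : Z) (C : R) : (1 <= m)%Z ->
  exists K0, forall K, (K0 <= K)%nat -> forall f, (forall k, (m <= k)%Z -> 1 <= f k) ->
    (forall k, (k <= - m)%Z -> f k <= -1) -> (forall k, (- m <= k <= m)%Z -> Rabs (f k) <= C) ->
    forall j, 0 <= avgn K f j -> 0 < avgn K f (j + 1)%Z.
Proof.
  intro Hm. destruct (eventually_positive m (IZR m * Rabs C)) as [K1 HK1]; [lia|].
  destruct (eventually_positive m (Rabs C)) as [K2 HK2]; [lia|].
  exists (K1 + K2)%nat. intros K HK f Hf1 Hf2 Hf3.
  assert (HC : forall k, (- m <= k <= m)%Z -> Rabs (f k) <= Rabs C).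
  { intros k Hk. assert (H := Hf3 k Hk). assert (H' := Rle_abs C). lra. }
  assert (Hm' : 1 <= IZR m) by (apply IZR_le in Hm; exact Hm).
  (* From j >= 0 on, only indices k >= 0 are averaged, so [f] may be replaced by 1 on the negative
     half. *)
  assert (P : forall j, (0 <= j)%Z -> 0 < avgn K f j).
  { intros j Hj. rewrite (avgn_ext K f (fun k => if Z_le_dec 0 k then f k else 1)).
    - apply HK2; [lia| |].
      + intros k Hk. destruct (Z_le_dec 0 k); [apply Hf1; lia|lra].
      + intros k Hk. assert (H := HC k Hk). apply Rabs_le_inv in H.
        assert (H' := Rabs_pos C). destruct (Z_le_dec 0 k); lra.
    - intros k Hk. destruct (Z_le_dec 0 k); [reflexivity|lia]. }
  assert (N : forall j, (j <= - Z.of_nat K)%Z -> avgn K f j < 0).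
  { intros j Hj. enough (H : 0 < avgn K (fun k => 0 + -1 * f k) j) by (rewrite avgn_affine in H; lra).
    rewrite (avgn_ext K _ (fun k => if Z_le_dec k 0 then 0 + -1 * f k else 1)).
    - apply HK2; [lia| |].
      + intros k Hk. destruct (Z_le_dec k 0); [|lra].
        assert (H := Hf2 k ltac:(lia)). lra.
      + intros k Hk. assert (H := HC k Hk). apply Rabs_le_inv in H.
        assert (H' := Rabs_pos C). destruct (Z_le_dec k 0); lra.
    - intros k Hk. destruct (Z_le_dec k 0); [reflexivity|lia]. }
  intros j H0. destruct (Z_le_dec 0 j) as [H|H]; [apply P; lia|].
  destruct (Z_le_dec j (- Z.of_nat K)) as [H'|H']; [specialize (N j H'); lra|].
  assert (Q : 0 < avgn (S K) (fun i => IZR i * f i) j).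
  { apply HK1; [lia| |].
    - intros k [Hk|Hk].
      + assert (F := Hf2 k Hk). assert (Hk' := IZR_le _ _ Hk). rewrite opp_IZR in Hk'. nra.
      + assert (F := Hf1 k Hk). assert (Hk' := IZR_le _ _ Hk). nra.
    - intros k Hk. assert (F := HC k Hk). apply Rabs_le_inv in F. destruct Hk as [A1 A2].
      apply IZR_le in A1, A2. rewrite opp_IZR in A1. assert (HC' := Rabs_pos C).
      assert (F2 : Rabs (IZR k * f k) <= IZR m * Rabs C).
      { rewrite Rabs_mult. apply Rmult_le_compat; try apply Rabs_pos; apply Rabs_le; lra. }
      apply Rabs_le_inv in F2. lra. }
  rewrite avgn_mul_index in Q.
  assert (J1 : IZR j < 0) by (apply IZR_lt; lia).
  assert (J2 : 0 < IZR (Z.of_nat K + 1 + j)) by (apply IZR_lt; lia).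
  apply Rnot_le_lt. intro C0. nra.
Qed.

Lemma constant_sign (f : Z -> R) (I : Z -> Prop) :
  (forall k, 1 <= f k \/ f k <= -1) ->
  (forall i j k, I i -> I k -> (i <= j <= k)%Z -> I j) ->
  (forall k, I k -> I (k + 1)%Z -> ~ f k * f (k + 1)%Z < 0) ->
  (forall k, I k -> 1 <= f k) \/ (forall k, I k -> f k <= -1).
Proof.
  intros Hf HI H. destruct (classic (exists k, I k /\ 1 <= f k)) as [[k0 [I0 H0]]|No]; [left|right].
  - assert (Up : forall n, I (k0 + Z.of_nat n)%Z -> 1 <= f (k0 + Z.of_nat n)%Z).
    { induction n as [|n IH]; intro In; [now rewrite Z.add_0_r|].
      replace (k0 + Z.of_nat (S n))%Z with (k0 + Z.of_nat n + 1)%Z in * by lia.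
      assert (Im : I (k0 + Z.of_nat n)%Z) by (apply (HI k0 _ _ I0 In); lia).
      specialize (H _ Im In). specialize (IH Im). destruct (Hf (k0 + Z.of_nat n + 1)%Z); nra. }
    assert (Dn : forall n, I (k0 - Z.of_nat n)%Z -> 1 <= f (k0 - Z.of_nat n)%Z).
    { induction n as [|n IH]; intro In; [now rewrite Z.sub_0_r|].
      replace (k0 - Z.of_nat n)%Z with (k0 - Z.of_nat (S n) + 1)%Z in IH by lia.
      assert (Im : I (k0 - Z.of_nat (S n) + 1)%Z) by (apply (HI _ _ k0 In I0); lia).
      specialize (H _ In Im). specialize (IH Im). destruct (Hf (k0 - Z.of_nat (S n))%Z); nra. }
    intros k Ik. destruct (Z_le_dec k0 k).
    + replace k with (k0 + Z.of_nat (Z.to_nat (k - k0)))%Z in * by lia. auto.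
    + replace k with (k0 - Z.of_nat (Z.to_nat (k0 - k)))%Z in * by lia. auto.
  - intros k Ik. destruct (Hf k); trivial. exfalso. eauto.
Qed.

End Averages.

(** * Root values along the orbit of a point under the powers of [w] *)

Definition zpow (w : cW X) (k : Z) : cW X :=
  if Z_le_dec 0 k then pw w (Z.to_nat k)
  else inv (pw w (Z.to_nat (- k))).

Definition orb (w v s : cW X) (x : cW X -> R) (k : Z) : R :=
  val v s (act (zpow w k) x).

Lemma orb_def w v s x k : orb w v s x k = val v s (act (zpow w k) x).
Proof. reflexivity. Qed.

Definition mid (w : cW X) (x : cW X -> R) : cW X -> R :=
  lincomb (/ 2) (/ 2) x (act w x).

Lemma mid_def w x : mid w x = lincomb (/ 2) (/ 2) x (act w x).
Proof. reflexivity. Qed.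

Definition midn (w : cW X) (K : nat) (x : cW X -> R) : cW X -> R := Nat.iter K (mid w) x.

Fixpoint usum (w : cW X) (n : nat) (x : cW X -> R) : cW X -> R :=
  match n with 0 => fun _ => 0%R | S n => lincomb 1 1 x (usum w n (act w x)) end.

(* [orbit_hull w N] is a superset of the convex hull of the points [w^r one_pt],
   [0 <= r <= N], cut out by bounds on roots and means over their periods. *)
Definition in_hull (w : cW X) (N : nat) (u : cW X -> R) : Prop :=
  forall v s c, cS X s -> (forall r, (0 <= r <= Z.of_nat N)%Z -> (c <= orb w v s one_pt r)%R) ->
    (c <= val v s u)%R.

Definition same_means (w : cW X) (u : cW X -> R) : Prop :=
  forall v s p, cS X s -> (forall x, periodic p (orb w v s x)) ->
    psum p (orb w v s u) 0 = psum p (orb w v s one_pt) 0.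

Definition orbit_hull (w : cW X) (N : nat) (u : cW X -> R) : Prop :=
  in_hull w N u /\ same_means w u.

(** Satisfied by means over [P] steps of the orbit. It singles out the roots to which no sign can be
    given, so that they vanish on the whole orbit instead of at scattered times. *)
Definition balanced (w : cW X) (P : nat) (u : cW X -> R) : Prop :=
  forall v s p, cS X s -> 1 <= p -> Nat.divide p P -> (forall x, periodic p (orb w v s x)) ->
    psum p (orb w v s one_pt) 0 = 0%R -> forall j, orb w v s u j = 0%R.

(* The possible behaviours of a root along the orbit of [midn K u], uniformly
   in [orbit_hull]: constant sign, exactly one sign change, or periodic of mean 0. *)
Definition sorted_root (w : cW X) (N P K : nat) (F : (cW X -> R) -> Z -> R) : Prop :=
  ((forall u, orbit_hull w N u -> forall j, 0 < F (midn w K u) j) \/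
   (forall u, orbit_hull w N u -> forall j, F (midn w K u) j < 0) \/
   (forall u, orbit_hull w N u -> forall j,
      0 <= F (midn w K u) j -> 0 < F (midn w K u) (j + 1)%Z) \/
   (forall u, orbit_hull w N u -> forall j,
      F (midn w K u) j <= 0 -> F (midn w K u) (j + 1)%Z < 0) \/
   (forall u, balanced w P u -> forall j, F (midn w K u) j = 0))%R.

Lemma finite_injective_bounded {A : Type} (L : list A) (Bad : Z -> A -> Prop) :
  (forall k k' a, Bad k a -> Bad k' a -> k = k') ->
  exists m, (0 <= m)%Z /\ forall k a, In a L -> Bad k a -> (- m < k < m)%Z.
Proof.
  intro Inj. induction L as [|a L [m [Hm IH]]]; [now exists 0%Z|].
  destruct (classic (exists k, Bad k a)) as [[k Hk]|N].
  - exists (Z.max m (Z.abs k + 1)). split; [lia|]. intros k' a' [<-|Ha'] Hb.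
    + rewrite (Inj k' k a Hb Hk). lia.
    + specialize (IH k' a' Ha' Hb). lia.
  - exists m. split; trivial. intros k' a' [<-|Ha'] Hb; [|eauto]. exfalso. apply N. now exists k'.
Qed.

Lemma bounded_on_interval (g : Z -> R) (a : Z) (n : nat) :
  exists M, (0 <= M)%R /\ forall k, (a <= k < a + Z.of_nat n)%Z -> (Rabs (g k) <= M)%R.
Proof.
  induction n as [|n [M [HM IH]]]; [exists 0%R; split; [lra|lia]|].
  exists (Rmax M (Rabs (g (a + Z.of_nat n)%Z))). split.
  - assert (H := Rmax_l M (Rabs (g (a + Z.of_nat n)%Z))). lra.
  - intros k Hk. destruct (Z.eq_dec k (a + Z.of_nat n)) as [->|]; [apply Rmax_r|].
    apply Rle_trans with M; [apply IH; lia|apply Rmax_l].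
Qed.

Lemma periodic_bounded (g : Z -> R) p : 1 <= p -> periodic p g ->
  exists M, forall k, (Rabs (g k) <= M)%R.
Proof.
  intros Hp Hg. destruct (bounded_on_interval g 0 p) as [M [_ HM]]. exists M. intro k.
  assert (E : forall n k, g (k + n * Z.of_nat p)%Z = g k).
  { intro n. induction n as [|n IH|n IH] using Z.peano_ind; intro j.
    - f_equal. lia.
    - rewrite <- (IH j), <- (Hg (j + n * Z.of_nat p)%Z). f_equal. lia.
    - rewrite <- (IH j), <- (Hg (j + Z.pred n * Z.of_nat p)%Z). f_equal. lia. }
  rewrite (Z.div_mod k (Z.of_nat p)) by lia.
  replace (Z.of_nat p * (k / Z.of_nat p) + k mod Z.of_nat p)%Z
    with (k mod Z.of_nat p + (k / Z.of_nat p) * Z.of_nat p)%Z by lia.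
  rewrite E. apply HM. assert (H := Z.mod_pos_bound k (Z.of_nat p) ltac:(lia)). lia.
Qed.

Lemma avoid_list (l : list R) lo hi : (lo < hi)%R -> exists t, (lo < t < hi)%R /\ ~ In t l.
Proof.
  revert lo hi. induction l as [|r l IH]; intros lo hi H.
  - exists ((lo + hi) / 2)%R. split; [lra|easy].
  - destruct (Rlt_dec lo r) as [H1|H1], (Rlt_dec r hi) as [H2|H2].
    + destruct (IH lo r H1) as [t [Ht Nt]]. exists t. split; [lra|]. intros [E|E]; [lra|easy].
    + destruct (IH lo hi H) as [t [Ht Nt]]. exists t. split; [lra|]. intros [E|E]; [lra|easy].
    + destruct (IH lo hi H) as [t [Ht Nt]]. exists t. split; [lra|]. intros [E|E]; [lra|easy].
    + lra.
Qed.

Lemma avoid_zeros (l : list (R * R)) :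
  exists t, (0 < t < 1)%R /\ forall a b, In (a, b) l -> ~ (a = 0 /\ b = 0)%R -> ((1 - t) * a + t * b <> 0)%R.
Proof.
  destruct (avoid_list (map (fun p => fst p / (fst p - snd p))%R l) 0 1) as [t [Ht Nt]]; [lra|].
  exists t. split; trivial. intros a b Hab N0 E. apply Nt.
  assert (D : (a - b <> 0)%R). { intro E0. apply N0. assert (a = b) by lra. subst. lra. }
  apply in_map_iff. exists (a, b). split; trivial. simpl. field_simplify_eq; [lra|trivial].
Qed.

Lemma psum_multiple p n g : periodic p g -> psum (n * p) g 0 = (INR n * psum p g 0)%R.
Proof.
  intro H. assert (E : forall m k j, psum (m + k) g j = (psum m g j + psum k g (j + Z.of_nat m)%Z)%R).
  { clear. induction m as [|m IH]; intros k j.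
    - simpl. rewrite Z.add_0_r. ring.
    - cbn [Nat.add psum]. rewrite IH. replace (j + 1 + Z.of_nat m)%Z with (j + Z.of_nat (S m))%Z by lia. ring. }
  induction n as [|n IH]; [simpl; ring|]. simpl Nat.mul. rewrite Nat.add_comm, E, IH, S_INR.
  rewrite (psum_periodic p g (0 + Z.of_nat (n * p)) 0 H). ring.
Qed.

Lemma psum_plus p f g j : psum p (fun k => f k + g k)%R j = (psum p f j + psum p g j)%R.
Proof. revert j. induction p as [|p IH]; intro j; simpl; [ring|]. rewrite IH. ring. Qed.

Lemma psum_shift p g i j : psum p (fun k => g (k + i)%Z) j = psum p g (j + i)%Z.
Proof.
  revert j. induction p as [|p IH]; intro j; simpl; trivial. rewrite IH. do 2 f_equal. lia.
Qed.

Lemma psum_ext p f g j : (forall k, f k = g k) -> psum p f j = psum p g j.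
Proof. intro H. revert j. induction p as [|p IH]; intro j; simpl; trivial. now rewrite H, IH. Qed.

Lemma psum_zero p j : psum p (fun _ => 0%R) j = 0%R.
Proof. revert j. induction p as [|p IH]; intro j; simpl; trivial. rewrite IH. ring. Qed.

Lemma psum_psum p n g i : periodic p g ->
  psum p (fun j => psum n g (j + i)%Z) 0 = (INR n * psum p g 0)%R.
Proof.
  intro H. revert i. induction n as [|n IH]; intro i.
  - simpl. rewrite psum_zero. ring.
  - rewrite S_INR. simpl psum at 2. rewrite psum_plus, psum_shift.
    rewrite (psum_ext p (fun k => psum n g (k + i + 1)%Z) (fun j => psum n g (j + (i + 1))%Z))
      by (intro; f_equal; lia).
    rewrite IH, (psum_periodic p g (0 + i) 0 H). ring.
Qed.

Lemma psum_ge n g c j : (forall k, (j <= k < j + Z.of_nat n)%Z -> (c <= g k)%R) ->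
  (INR n * c <= psum n g j)%R.
Proof.
  revert j. induction n as [|n IH]; intros j H; [simpl; lra|].
  rewrite S_INR. simpl psum. assert (H1 := H j ltac:(lia)).
  assert (H2 : (INR n * c <= psum n g (j + 1))%R) by (apply IH; intros; apply H; lia). lra.
Qed.

Section Powers.
Context (w : cW X).
Local Notation zp := (zpow w).
Local Notation orb := (orb w).
Local Notation mid := (mid w).
Local Notation midn := (midn w).
Local Notation usum := (usum w).
Local Notation x0 := one_pt.
Local Open Scope R_scope.

Lemma zpow_zero : zp 0 = e.
Proof. reflexivity. Qed.

Lemma zpow_one : zp 1 = w.
Proof. unfold zpow. simpl. gsimp. reflexivity. Qed.

Lemma zpow_succ k : zp (k + 1) = w ** zp k.
Proof.
  unfold zpow. destruct (Z_le_dec 0 k), (Z_le_dec 0 (k + 1)); try lia.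
  - replace (Z.to_nat (k + 1)) with (S (Z.to_nat k)) by lia. reflexivity.
  - assert (k = -1)%Z by lia. subst. simpl. gsimp. reflexivity.
  - replace (Z.to_nat (- k)) with (Z.to_nat (- (k + 1)) + 1)%nat by lia.
    rewrite (gpow_add GX). simpl. gsimp. reflexivity.
Qed.

Lemma zpow_add j k : zp (j + k) = zp j ** zp k.
Proof.
  induction j as [|j IH|j IH] using Z.peano_ind.
  - rewrite zpow_zero. gsimp. reflexivity.
  - replace (Z.succ j + k)%Z with (j + k + 1)%Z by lia.
    unfold Z.succ. rewrite !zpow_succ, IH. gsimp. reflexivity.
  - apply (grp_cancel_l GX w). rewrite <- zpow_succ, mulA.
    rewrite <- zpow_succ. replace (Z.pred j + k + 1)%Z with (j + k)%Z by lia.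
    replace (Z.pred j + 1)%Z with j by lia. exact IH.
Qed.

Lemma zpow_opp k : zp (- k) = inv (zp k).
Proof.
  apply (grp_inv_unique GX). rewrite <- zpow_add. replace (k + - k)%Z with 0%Z by lia.
  apply zpow_zero.
Qed.

Lemma orb_zero v s x : orb v s x 0 = val v s x.
Proof. rewrite ?orb_def. rewrite zpow_zero, act_one. reflexivity. Qed.

Lemma orb_shift v s x k j : orb v s (act (zp k) x) j = orb v s x (j + k).
Proof. rewrite ?orb_def. now rewrite zpow_add, act_mul. Qed.

Lemma orb_act v s x j : orb v s (act w x) j = orb v s x (j + 1).
Proof. replace (act w x) with (act (zp 1) x) by now rewrite zpow_one. apply orb_shift. Qed.

Lemma orb_val v s x k : orb v s x k = val (zp (- k) ** v) s x.
Proof. rewrite ?orb_def. rewrite val_act, zpow_opp. reflexivity. Qed.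

Lemma orb_val_shift v s x j k : orb (zp (- k) ** v) s x j = orb v s x (j + k).
Proof.
  rewrite !orb_val. rewrite mulA, <- zpow_add.
  do 2 f_equal. f_equal. lia.
Qed.

Lemma orb_gen v s x k : cS X s -> orb (v ** s) s x k = - orb v s x k.
Proof. apply val_gen. Qed.

Lemma orb_lincomb v s a b x y k : orb v s (lincomb a b x y) k = a * orb v s x k + b * orb v s y k.
Proof. rewrite ?orb_def. rewrite act_lincomb. apply val_lincomb. Qed.

Lemma orb_midn v s K x j : orb v s (midn K x) j = avgn K (orb v s x) j.
Proof.
  revert j. induction K as [|K IH]; intro j; [reflexivity|].
  change (midn (S K) x) with (mid (midn K x)). rewrite ?mid_def.
  rewrite orb_lincomb, orb_act, !IH, avgn_S. lra.
Qed.

Lemma orb_usum v s n x j : orb v s (usum n x) j = psum n (orb v s x) j.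
Proof.
  revert x j. induction n as [|n IH]; intros x j.
  - change (usum 0 x) with (fun _ : cW X => 0). simpl.
    assert (E : (fun _ : cW X => 0) = lincomb 0 0 x x)
      by (apply functional_extensionality; intro; unfold lincomb; ring).
    rewrite E, orb_lincomb. ring.
  - change (usum (S n) x) with (lincomb 1 1 x (usum n (act w x))).
    rewrite orb_lincomb, IH. simpl. rewrite (psum_ext n _ (fun k => orb v s x (k + 1))).
    + rewrite psum_shift. ring.
    + intro k. apply orb_act.
Qed.

Lemma midn_lincomb K a b x y : midn K (lincomb a b x y) = lincomb a b (midn K x) (midn K y).
Proof.
  induction K as [|K IH]; [reflexivity|].
  change (midn (S K) ?x) with (mid (midn K x)). rewrite IH. rewrite ?mid_def.
  rewrite act_lincomb. apply functional_extensionality. intro r. unfold lincomb. ring.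
Qed.

Lemma act_midn K u x : u ** w = w ** u -> act u (midn K x) = midn K (act u x).
Proof.
  intro E. induction K as [|K IH]; [reflexivity|].
  change (midn (S K) ?x) with (mid (midn K x)). rewrite ?mid_def.
  rewrite act_lincomb, <- act_mul, E, act_mul, IH. reflexivity.
Qed.

Lemma in_hull_orb N u v s c j : in_hull w N u -> cS X s ->
  (forall r, (j <= r <= j + Z.of_nat N)%Z -> c <= orb v s x0 r) -> c <= orb v s u j.
Proof.
  intros Hu Hs H. rewrite orb_val. apply Hu; trivial. intros r Hr.
  rewrite orb_val_shift. apply H. lia.
Qed.

Lemma in_hull_orb_upper N u v s c j : in_hull w N u -> cS X s ->
  (forall r, (j <= r <= j + Z.of_nat N)%Z -> orb v s x0 r <= c) -> orb v s u j <= c.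
Proof.
  intros Hu Hs H. assert (H1 : - c <= orb (v ** s) s u j).
  { apply (in_hull_orb N); trivial. intros r Hr. rewrite orb_gen by trivial.
    specialize (H r Hr). lra. }
  rewrite orb_gen in H1 by trivial. lra.
Qed.

Lemma in_hull_orb_abs N u v s c j : in_hull w N u -> cS X s ->
  (forall r, (j <= r <= j + Z.of_nat N)%Z -> Rabs (orb v s x0 r) <= c) -> Rabs (orb v s u j) <= c.
Proof.
  intros Hu Hs H. apply Rabs_le. split.
  - apply (in_hull_orb N); trivial. intros r Hr. apply (Rabs_le_inv _ _ (H r Hr)).
  - apply (in_hull_orb_upper N); trivial. intros r Hr. apply (Rabs_le_inv _ _ (H r Hr)).
Qed.

Lemma in_hull_lincomb N x y t : 0 <= t <= 1 -> in_hull w N x -> in_hull w N y ->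
  in_hull w N (lincomb (1 - t) t x y).
Proof.
  intros Ht Hx Hy v s c Hs H. rewrite val_lincomb.
  assert (H1 := Hx v s c Hs H). assert (H2 := Hy v s c Hs H). nra.
Qed.

Lemma in_hull_le N N' x : (N <= N')%nat -> in_hull w N x -> in_hull w N' x.
Proof. intros HN Hx v s c Hs H. apply Hx; trivial. intros r Hr. apply H. lia. Qed.

Lemma in_hull_act N k x : in_hull w N x -> in_hull w (N + k) (act (zp (Z.of_nat k)) x).
Proof.
  intros Hx v s c Hs H. rewrite <- orb_zero, orb_shift. apply (in_hull_orb N); trivial.
  intros r Hr. apply H. lia.
Qed.

Lemma in_hull_midn N K x : in_hull w N x -> in_hull w (N + K) (midn K x).
Proof.
  intro Hx. induction K as [|K IH]; [now rewrite Nat.add_0_r|].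
  change (midn (S K) x) with (mid (midn K x)). rewrite ?mid_def.
  replace (/ 2) with (1 - / 2) at 1 by lra. apply in_hull_lincomb; [lra| |].
  - revert IH. apply in_hull_le. lia.
  - replace (act w (midn K x)) with (act (zp 1) (midn K x)) by now rewrite zpow_one.
    replace (N + S K)%nat with (N + K + 1)%nat by lia. now apply (in_hull_act (N + K) 1).
Qed.

Lemma in_hull_one : in_hull w 0 x0.
Proof. intros v s c Hs H. rewrite <- orb_zero. apply H. lia. Qed.

Lemma orbit_hull_one N : orbit_hull w N x0.
Proof.
  split.
  - apply (in_hull_le 0); [lia|apply in_hull_one].
  - intros v s p _ _. reflexivity.
Qed.

Lemma orbit_hull_lincomb N x y t : 0 <= t <= 1 -> orbit_hull w N x -> orbit_hull w N y ->
  orbit_hull w N (lincomb (1 - t) t x y).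
Proof.
  intros Ht [Hx1 Hx2] [Hy1 Hy2]. split; [now apply in_hull_lincomb|].
  intros v s p Hs Hp. rewrite (psum_ext p _ (fun k => (1 - t) * orb v s x k + t * orb v s y k))
    by (intro; apply orb_lincomb).
  assert (E1 := psum_affine p (1 - t) 0 (orb v s x) 0). assert (E2 := psum_affine p t 0 (orb v s y) 0).
  rewrite psum_plus.
  rewrite (psum_ext p (fun k => (1 - t) * orb v s x k) (fun k => 0 + (1 - t) * orb v s x k)), E1
    by (intro; ring).
  rewrite (psum_ext p (fun k => t * orb v s y k) (fun k => 0 + t * orb v s y k)), E2
    by (intro; ring).
  rewrite (Hx2 v s p Hs Hp), (Hy2 v s p Hs Hp). ring.
Qed.

Lemma orbit_hull_act N k x : orbit_hull w N x -> orbit_hull w (N + k) (act (zp (Z.of_nat k)) x).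
Proof.
  intros [H1 H2]. split; [now apply in_hull_act|]. intros v s p Hs Hp.
  rewrite (psum_ext p _ (fun j => orb v s x (j + Z.of_nat k))) by (intro; apply orb_shift).
  rewrite psum_shift, (psum_periodic p _ (0 + Z.of_nat k) 0 (Hp x)). now apply H2.
Qed.

(** The mean of the first [P] orbit points; the summand with coefficient 0 only turns [lincomb] into
    a scalar multiple. *)
Definition uavg (P : nat) : cW X -> R := lincomb (/ INR P) 0 (usum P x0) x0.

Lemma orb_uavg P v s j : orb v s (uavg P) j = psum P (orb v s x0) j / INR P.
Proof. unfold uavg. rewrite orb_lincomb, orb_usum. unfold Rdiv. ring. Qed.

Lemma orbit_hull_uavg P : (1 <= P)%nat -> orbit_hull w P (uavg P).
Proof.
  intro HP. assert (HP' := le_INR 1 P HP). simpl in HP'. split.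
  - intros v s c Hs H. rewrite <- orb_zero, orb_uavg.
    assert (H1 := psum_ge P (orb v s x0) c 0 ltac:(intros; apply H; lia)).
    apply Rmult_le_reg_l with (INR P); [lra|]. unfold Rdiv.
    rewrite (Rmult_comm (psum _ _ _)), <- Rmult_assoc, Rinv_r, Rmult_1_l by lra. exact H1.
  - intros v s p Hs Hp.
    rewrite (psum_ext p _ (fun j => 0 + / INR P * psum P (orb v s x0) (j + 0)))
      by (intro j; rewrite orb_uavg, Z.add_0_r; unfold Rdiv; ring).
    rewrite psum_affine, psum_psum by trivial. field. lra.
Qed.

Lemma balanced_uavg P : (1 <= P)%nat -> balanced w P (uavg P).
Proof.
  intros HP v s p Hs Hp [n ->] Hper H0 j. rewrite orb_uavg.
  assert (E : psum (n * p) (orb v s x0) j = psum (n * p) (orb v s x0) 0).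
  { apply psum_periodic. intro i. clear - Hper. induction n as [|n IH]; [now rewrite Z.add_0_r|].
    rewrite <- IH, <- (Hper x0 (i + Z.of_nat (n * p))%Z). f_equal. lia. }
  rewrite E, psum_multiple, H0 by trivial. unfold Rdiv. ring.
Qed.

Lemma balanced_act P k x : balanced w P x -> balanced w P (act (zp k) x).
Proof. intros H v s p Hs Hp Hd Hper H0 j. rewrite orb_shift. now apply (H v s p). Qed.

Lemma balanced_lincomb P a b x y : balanced w P x -> balanced w P y ->
  balanced w P (lincomb a b x y).
Proof.
  intros H1 H2 v s p Hs Hp Hd Hper H0 j.
  rewrite orb_lincomb, (H1 v s p), (H2 v s p); trivial. ring.
Qed.

Lemma orb_one_dichotomy v s k : cS X s -> 1 <= orb v s x0 k \/ orb v s x0 k <= -1.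
Proof.
  intro Hs. destruct (val_chp_dichotomy v s (zp k) Hs) as [[H _]|[H _]]; [now left|now right].
Qed.

(* Proportional translates of a root coincide up to sign, since all values at
   the base point have absolute value at least 1. *)
Lemma proportional_periodic v s c d : cS X s -> d <> 0%Z ->
  (forall x j, orb v s x (j + d) = c * orb v s x j) ->
  exists p, (1 <= p)%nat /\ forall x, periodic p (orb v s x).
Proof.
  intros Hs Hd H. assert (Habs : forall k, 1 <= Rabs (orb v s x0 k)).
  { intro k. destruct (orb_one_dichotomy v s k Hs) as [E|E];
      [rewrite Rabs_pos_eq|rewrite Rabs_left]; lra. }
  assert (Hpow : forall n j, Rabs (orb v s x0 (j + Z.of_nat n * d)) =
    Rabs c ^ n * Rabs (orb v s x0 j)).
  { induction n as [|n IH]; intro j.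
    - simpl. rewrite Rmult_1_l. f_equal. f_equal. lia.
    - replace (j + Z.of_nat (S n) * d)%Z with (j + Z.of_nat n * d + d)%Z by lia.
      rewrite H, Rabs_mult, IH. simpl. ring. }
  assert (Hc0 : Rabs c <> 0).
  { intro E. assert (A := Hpow 1%nat 0%Z). rewrite E in A. simpl in A.
    assert (B := Habs (0 + 1 * d)%Z). simpl in B. lra. }
  (* Otherwise the values at the base point would fall below 1 in one of the two directions. *)
  assert (Hc1 : Rabs c = 1).
  { assert (Hcp := Rabs_pos c).
    assert (Small : forall q, 0 < q < 1 -> forall M, 1 <= M -> exists n, q ^ n * M < 1).
    { intros q Hq M HM. destruct (pow_lt_1_zero q) with (y := / M) as [n Hn].
      - rewrite Rabs_pos_eq; lra.
      - apply Rinv_0_lt_compat. lra.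
      - exists n. specialize (Hn n (le_n n)). apply Rabs_def2 in Hn. destruct Hn as [Hn _].
        apply (Rmult_lt_compat_r M) in Hn; [|lra]. rewrite Rinv_l in Hn; lra. }
    destruct (Rtotal_order (Rabs c) 1) as [C|[C|C]]; trivial; exfalso.
    - destruct (Small (Rabs c) ltac:(lra) _ (Habs 0%Z)) as [n Hn]. rewrite <- Hpow in Hn.
      assert (A := Habs (0 + Z.of_nat n * d)%Z). lra.
    - assert (Hi : 0 < / Rabs c < 1).
      { split; [apply Rinv_0_lt_compat; lra|]. rewrite <- Rinv_1. apply Rinv_lt_contravar; lra. }
      destruct (Small (/ Rabs c) Hi _ (Habs 0%Z)) as [n Hn].
      assert (A := Hpow n (0 - Z.of_nat n * d)%Z).
      replace (0 - Z.of_nat n * d + Z.of_nat n * d)%Z with 0%Z in A by lia.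
      rewrite A, <- Rmult_assoc, <- Rpow_mult_distr, Rinv_l, pow1, Rmult_1_l in Hn by trivial.
      assert (A' := Habs (0 - Z.of_nat n * d)%Z). lra. }
  assert (Hcc : c * c = 1).
  { destruct (Rcase_abs c) as [C|C]; [rewrite Rabs_left in Hc1|rewrite Rabs_right in Hc1]; nra. }
  assert (H2 : forall x j, orb v s x (j + 2 * d) = orb v s x j).
  { intros x j. replace (j + 2 * d)%Z with (j + d + d)%Z by lia. rewrite !H, <- Rmult_assoc, Hcc. ring. }
  (* The factor 2 allows for c = -1. *)
  exists (Z.to_nat (2 * Z.abs d)). split; [lia|]. intros x j.
  destruct (Z_le_dec 0 d).
  - rewrite <- (H2 x j). f_equal. lia.
  - rewrite <- (H2 x (j + Z.of_nat (Z.to_nat (2 * Z.abs d)))%Z). f_equal. lia.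
Qed.

Definition constant_sign_from (v s : cW X) (m : Z) : Prop :=
  ((forall k, (m <= k)%Z -> 1 <= orb v s x0 k) \/ (forall k, (m <= k)%Z -> orb v s x0 k <= -1)) /\
  ((forall k, (k <= - m)%Z -> 1 <= orb v s x0 k) \/ (forall k, (k <= - m)%Z -> orb v s x0 k <= -1)).

(** Translated by [w^-k], a root changing sign between times k and k + 1 separates [e] from [w], so
    its wall is among the inversions of [w]. *)
Lemma sign_change_inversion (L : list (cW X * cW X)) v s k : cS X s ->
  (forall v s, cS X s -> val v s (act e x0) * val v s (act w x0) < 0 ->
    exists p, In p L /\ v ** s ** inv v = fst p ** snd p ** inv (fst p)) ->
  orb v s x0 k * orb v s x0 (k + 1) < 0 ->
  exists p, In p L /\
    zp (- k) ** v ** s ** inv (zp (- k) ** v) = fst p ** snd p ** inv (fst p).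
Proof.
  intros Hs HL H. apply HL; trivial. rewrite act_one.
  rewrite <- orb_val. rewrite <- (orb_zero _ s (act w x0)), orb_act, orb_val_shift, Z.add_comm.
  exact H.
Qed.

(** If two sign changes lead to the same inversion, two translates of the root are proportional and
    the root is periodic. Otherwise each of the finitely many inversions is used at most once, which
    confines the sign changes to a bounded window. *)
Lemma root_alternative v s : cS X s ->
  (exists p, (1 <= p)%nat /\ forall x, periodic p (orb v s x)) \/
  (exists m, (1 <= m)%Z /\ constant_sign_from v s m).
Proof.
  intro Hs. destruct (classic (exists p, (1 <= p)%nat /\ forall x, periodic p (orb v s x))) as [|N];
    [now left|right].
  destruct (inversions e w) as [L [HL1 HL2]].
  destruct (finite_injective_bounded L (fun k p => cS X (snd p) /\
    zp (- k) ** v ** s ** inv (zp (- k) ** v) = fst p ** snd p ** inv (fst p))) as [m [Hm Hbad]].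
  { intros k k' p [Hp E] [_ E']. destruct (Z.eq_dec k k') as [|Nk]; trivial. exfalso. apply N.
    destruct (same_wall_proportional (zp (- k) ** v) s (zp (- k') ** v) s) as [c [_ Hc]]; trivial.
    { now rewrite E, E'. }
    apply (proportional_periodic v s c (k - k')); trivial; [lia|]. intros x j.
    assert (H := Hc (act (zp (j - k')) x)).
    rewrite <- !orb_val, !orb_shift in H. replace (k + (j - k'))%Z with (j + (k - k'))%Z in H by lia.
    replace (k' + (j - k'))%Z with j in H by lia. exact H. }
  assert (Hno : forall k, ~ (- m < k < m)%Z -> ~ orb v s x0 k * orb v s x0 (k + 1) < 0).
  { intros k Hk H. apply Hk. destruct (sign_change_inversion L v s k Hs HL2 H) as [p [Hp Ep]].
    apply (Hbad k p Hp). split; auto. }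
  exists (m + 1)%Z.
  split; [lia|split]; (apply constant_sign; [intro k; now apply orb_one_dichotomy|lia|]);
    intros k H1 H2; apply Hno; lia.
Qed.

Lemma sorted_root_scale N P K F G c d : c <> 0 -> (forall x j, F x j = c * G x (j + d)%Z) ->
  sorted_root w N P K G -> sorted_root w N P K F.
Proof.
  intros Hc E H. unfold sorted_root.
  destruct (Rlt_dec 0 c) as [C|C]; [|assert (C' : c < 0) by lra];
  destruct H as [H|[H|[H|[H|H]]]];
    [left|right; left|do 2 right; left|do 3 right; left|do 4 right
    |right; left|left|do 3 right; left|do 2 right; left|do 4 right];
    intros u Hu j; rewrite !E; specialize (H u Hu (j + d)%Z);
    try (rewrite H; ring); try nra;
    replace (j + 1 + d)%Z with (j + d + 1)%Z by lia; intro A;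
    first [assert (A' : 0 <= G (midn K u) (j + d)%Z) by nra
      |assert (A' : G (midn K u) (j + d)%Z <= 0) by nra]; specialize (H A'); nra.
Qed.

Lemma sorted_root_opp N P K v s : cS X s ->
  sorted_root w N P K (orb (v ** s) s) -> sorted_root w N P K (orb v s).
Proof.
  intro Hs. apply (sorted_root_scale N P K _ _ (-1) 0); [lra|].
  intros x j. rewrite orb_gen, Z.add_0_r by trivial. ring.
Qed.

Lemma sorted_root_periodic N P p v s : cS X s -> (1 <= p)%nat -> Nat.divide p P ->
  (forall x, periodic p (orb v s x)) ->
  exists K0, forall K, (K0 <= K)%nat -> sorted_root w N P K (orb v s).
Proof.
  intros Hs Hp Hd Hper.
  enough (H : forall v, (forall x, periodic p (orb v s x)) -> 0 < psum p (orb v s x0) 0 ->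
    exists K0, forall K, (K0 <= K)%nat -> sorted_root w N P K (orb v s)).
  { destruct (Rtotal_order 0 (psum p (orb v s x0) 0)) as [C|[C|C]].
    - now apply H.
    - exists 0%nat. intros K _. right; right; right; right. intros u Hu j.
      rewrite orb_midn, (avgn_ext K _ (fun _ => 0)); [apply avgn_const|].
      intros k _. now apply (Hu v s p).
    - destruct (H (v ** s)) as [K0 HK0].
      + intros x j. rewrite !orb_gen by trivial. now rewrite Hper.
      + rewrite (psum_ext p _ (fun k => 0 + -1 * orb v s x0 k))
          by (intro; rewrite orb_gen by trivial; ring).
        rewrite psum_affine. lra.
      + exists K0. intros K HK. apply sorted_root_opp; auto. }
  clear v Hper. intros v Hper Hmu.
  destruct (periodic_bounded (orb v s x0) p Hp (Hper x0)) as [M HM].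
  destruct (periodic_positive p M (psum p (orb v s x0) 0) Hp Hmu) as [K0 HK0].
  exists K0. intros K HK. left. intros u [Hu1 Hu2] j. rewrite orb_midn. apply HK0; trivial.
  - intro k. apply (in_hull_orb_abs N); auto.
  - now apply Hu2.
Qed.

Lemma sorted_root_nonperiodic N P m v s : cS X s -> (1 <= m)%Z -> constant_sign_from v s m ->
  exists K0, forall K, (K0 <= K)%nat -> sorted_root w N P K (orb v s).
Proof.
  intros Hs Hm.
  enough (H : forall v, (forall k, (m <= k)%Z -> 1 <= orb v s x0 k) ->
    (forall k, (k <= - m)%Z -> 1 <= orb v s x0 k) \/ (forall k, (k <= - m)%Z -> orb v s x0 k <= -1) ->
    exists K0, forall K, (K0 <= K)%nat -> sorted_root w N P K (orb v s)).
  { intros [[H1|H1] H2]; [now apply H|].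
    destruct (H (v ** s)) as [K0 HK0].
    - intros k Hk. rewrite orb_gen by trivial. specialize (H1 k Hk). lra.
    - destruct H2 as [H2|H2]; [right|left]; intros k Hk; rewrite orb_gen by trivial;
        specialize (H2 k Hk); lra.
    - exists K0. intros K HK. apply sorted_root_opp; auto. }
  (* A point of the hull sees the base orbit through a window of length [N], so the ranges of
     constant sign shrink by [N]. *)
  clear v. intros v H1 H2. set (m' := (m + Z.of_nat N)%Z).
  destruct (bounded_on_interval (orb v s x0) (- m') (Z.to_nat (2 * m' + Z.of_nat N + 1)))
    as [M [_ HM]].
  assert (HuM : forall u, orbit_hull w N u -> forall k, (- m' <= k <= m')%Z -> Rabs (orb v s u k) <= M).
  { intros u [Hu _] k Hk. apply (in_hull_orb_abs N); trivial. intros r Hr. apply HM. lia. }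
  assert (Hu1 : forall u, orbit_hull w N u -> forall k, (m' <= k)%Z -> 1 <= orb v s u k).
  { intros u [Hu _] k Hk. apply (in_hull_orb N); trivial. intros r Hr. apply H1. lia. }
  destruct H2 as [H2|H2].
  - destruct (eventually_positive m' M) as [K0 HK0]; [lia|]. exists K0. intros K HK. left.
    intros u Hu j. rewrite orb_midn. apply HK0; trivial.
    + intros k [Hk|Hk]; [|now apply Hu1]. apply (in_hull_orb N); [apply Hu|trivial|].
      intros r Hr. apply H2. lia.
    + intros k Hk. apply (Rabs_le_inv _ _ (HuM u Hu k Hk)).
  - destruct (single_sign_change m' M) as [K0 HK0]; [lia|]. exists K0. intros K HK.
    right; right; left. intros u Hu j. rewrite !orb_midn. apply HK0; auto.
    intros k Hk. apply (in_hull_orb_upper N); [apply Hu|trivial|]. intros r Hr. apply H2. lia.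
Qed.

End Powers.

(** * Straight elements *)

Section StraightPoint.
Context (w : cW X).
Local Notation zp := (zpow w).
Local Notation orb := (orb w).
Local Notation mid := (mid w).
Local Notation midn := (midn w).
Local Notation x0 := one_pt.
Local Open Scope R_scope.

Lemma zpow_comm k : zp k ** w = w ** zp k.
Proof. now rewrite <- zpow_succ, zpow_add, zpow_one. Qed.

Lemma orbit_hull_le N N' u : (N <= N')%nat -> orbit_hull w N u -> orbit_hull w N' u.
Proof. intros HN [H1 H2]. split; trivial. now apply (in_hull_le w N). Qed.

Lemma common_period (L : list (cW X * cW X)) : exists P, (1 <= P)%nat /\
  forall q, In q L -> (exists p, (1 <= p)%nat /\ forall x, periodic p (orb (fst q) (snd q) x)) ->
    exists p, (1 <= p)%nat /\ Nat.divide p P /\ forall x, periodic p (orb (fst q) (snd q) x).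
Proof.
  induction L as [|q L [P [HP IH]]]; [exists 1%nat; split; [lia|easy]|].
  destruct (classic (exists p, (1 <= p)%nat /\ forall x, periodic p (orb (fst q) (snd q) x)))
    as [[p [Hp Hper]]|N].
  - exists (p * P)%nat. split; [nia|]. intros q' [<-|Hq'] H.
    + exists p. split; [trivial|split; [exists P; lia|trivial]].
    + destruct (IH q' Hq' H) as [p' [H1 [H2 H3]]]. exists p'. split; [trivial|split; [|trivial]].
      apply Nat.divide_mul_r, H2.
  - exists P. split; trivial. intros q' [<-|Hq'] H; [easy|auto].
Qed.

Lemma uniform_exponent (L : list (cW X * cW X)) N P :
  (forall q, In q L -> cS X (snd q)) ->
  (forall q, In q L -> (exists p, (1 <= p)%nat /\ forall x, periodic p (orb (fst q) (snd q) x)) ->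
    exists p, (1 <= p)%nat /\ Nat.divide p P /\ forall x, periodic p (orb (fst q) (snd q) x)) ->
  exists K0, forall K, (K0 <= K)%nat -> forall q, In q L ->
    sorted_root w N P K (orb (fst q) (snd q)).
Proof.
  induction L as [|q L IH]; intros HS HP; [now exists 0%nat|].
  destruct IH as [K0 HK0]; [intros; apply HS; now right|intros; apply HP; trivial; now right|].
  assert (Hq : exists K1, forall K, (K1 <= K)%nat -> sorted_root w N P K (orb (fst q) (snd q))).
  { destruct (root_alternative w (fst q) (snd q)) as [H|[m [Hm H]]]; [apply HS; now left| |].
    - destruct (HP q (or_introl eq_refl) H) as [p [H1 [H2 H3]]].
      apply (sorted_root_periodic w N P p); trivial. apply HS. now left.
    - apply (sorted_root_nonperiodic w N P m); trivial. apply HS. now left. }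
  destruct Hq as [K1 HK1]. exists (K0 + K1)%nat. intros K HK q' [<-|Hq'].
  - apply HK1. lia.
  - apply HK0; trivial. lia.
Qed.

Lemma sorted_root_constant N P K v s :  cS X s ->
  (forall k, 1 <= orb v s x0 k) -> sorted_root w N P K (orb v s).
Proof.
  intros Hs H. left. intros u [Hu _] j. rewrite orb_midn.
  apply Rlt_le_trans with (avgn K (fun _ => 1) j); [rewrite avgn_const; lra|].
  apply avgn_le. intro k. apply (in_hull_orb w N); auto.
Qed.

(** From finitely many roots to all: a root that changes sign is a multiple of a translate of a
    listed one, and [sorted_root] survives both operations; a root without sign change keeps its
    bound on the hull. *)
Lemma sorted_root_all L N P K :
  (forall p, In p L -> cS X (snd p)) ->
  (forall v s, cS X s -> val v s (act e x0) * val v s (act w x0) < 0 ->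
    exists p, In p L /\ v ** s ** inv v = fst p ** snd p ** inv (fst p)) ->
  (forall q, In q L -> sorted_root w N P K (orb (fst q) (snd q))) ->
  forall v s, cS X s -> sorted_root w N P K (orb v s).
Proof.
  intros HL1 HL2 HK v s Hs.
  destruct (classic (exists k, orb v s x0 k * orb v s x0 (k + 1) < 0)) as [[k Hk]|No].
  - destruct (sign_change_inversion w L v s k Hs HL2 Hk) as [q [Hq Eq]].
    destruct (same_wall_proportional (zp (- k) ** v) s (fst q) (snd q) Hs (HL1 q Hq) Eq)
      as [c [Hc Ec]].
    apply (sorted_root_scale w N P K _ (orb (fst q) (snd q)) c (- k)); auto.
    intros x j. assert (H := Ec (act (zp (j - k)) x)).
    rewrite <- !(orb_zero w), orb_val_shift, !orb_shift in H.
    replace (0 + k + (j - k))%Z with j in H by lia. now rewrite H, Z.add_0_l.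
  - destruct (constant_sign (orb v s x0) (fun _ => True)) as [H|H]; auto.
    + intro k. now apply orb_one_dichotomy.
    + intros k _ _ H. apply No. now exists k.
    + apply sorted_root_constant; auto.
    + apply sorted_root_opp; trivial. apply sorted_root_constant; trivial. intro k.
      rewrite orb_gen by trivial. specialize (H k I). lra.
Qed.

Definition in_cone (x : cW X -> R) : Prop := exists v, inC v x.

Lemma in_cone_act u x : in_cone x -> in_cone (act u x).
Proof. intros [v Hv]. exists (u ** v). now apply inC_act. Qed.

Lemma in_cone_lincomb x y t : in_cone x -> in_cone y -> 0 <= t <= 1 ->
  in_cone (lincomb (1 - t) t x y).
Proof. intros [v Hv] [u Hu] Ht. now apply (cone_convex v u). Qed.

Lemma in_cone_midn K x : in_cone x -> in_cone (midn K x).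
Proof.
  intro Hx. induction K as [|K IH]; trivial. change (midn (S K) x) with (mid (midn K x)).
  rewrite mid_def. replace (/ 2) with (1 - / 2) at 1 by lra.
  apply in_cone_lincomb; trivial; [now apply in_cone_act|lra].
Qed.

Lemma in_cone_uavg P : (1 <= P)%nat -> in_cone (uavg w P).
Proof.
  intro HP. unfold uavg.
  assert (H : forall x, in_cone x -> in_cone (lincomb (/ INR P) 0 (usum w P x) x)).
  { induction P as [|[|P] IH]; [lia| |]; intros x Hx.
    - replace (lincomb (/ INR 1) 0 (usum w 1 x) x) with x; trivial.
      apply functional_extensionality. intro r. simpl. unfold lincomb. field.
    - specialize (IH ltac:(lia) (act w x) (in_cone_act w x Hx)).
      set (n := S P) in *. assert (Hn : 1 <= INR n) by (apply (le_INR 1); lia).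
      replace (lincomb (/ INR (S n)) 0 (usum w (S n) x) x) with
        (lincomb (1 - INR n / (INR n + 1)) (INR n / (INR n + 1)) x
           (lincomb (/ INR n) 0 (usum w n (act w x)) (act w x))).
      + apply in_cone_lincomb; trivial. split.
        * apply Rmult_le_pos; [lra|]. apply Rlt_le, Rinv_0_lt_compat. lra.
        * apply Rmult_le_reg_r with (INR n + 1); [lra|]. unfold Rdiv.
          rewrite Rmult_assoc, Rinv_l; lra.
      + apply functional_extensionality. intro r. rewrite S_INR.
        change (usum w (S n) x) with (lincomb 1 1 x (usum w n (act w x))).
        unfold lincomb. field. lra. }
  apply H. exists e. intros r Hr. rewrite val_def. gsimp. rewrite act_one. unfold one_pt. lra.
Qed.

(** With constant sign on the window, the hull bounds would keep the root at distance 1 from zero at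
    [z]. This leaves finitely many walls through [z]. *)
Lemma vanishing_sign_change M z u r : in_hull w M z -> cS X r -> val u r z = 0 ->
  exists i, (0 <= i < Z.of_nat M)%Z /\ orb u r x0 i * orb u r x0 (i + 1) < 0.
Proof.
  intros Hz Hr E. apply NNPP. intro No. rewrite <- (orb_zero w) in E.
  destruct (constant_sign (orb u r x0) (fun k => 0 <= k <= Z.of_nat M)%Z) as [H|H].
  - intro k. now apply orb_one_dichotomy.
  - lia.
  - intros k H1 H2 H. apply No. exists k. split; [lia|trivial].
  - apply (in_hull_orb w M z) in H; trivial. lra.
  - apply (in_hull_orb_upper w M z) in H; trivial. lra.
Qed.

(* Reach the chamber of [midn K one_pt] along midpoints, which stay in the
   geodesic intervals [v, w v]; then walk to a generic balanced point: by
   [sorted_root_all] the walls crossed on the way change sign exactly once along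
   each orbit, so that each crossing is a left or right descent. *)
Theorem straight_point (Q : cW X -> Prop) :
  Q e ->
  (forall v a b, Q v -> inv v ** w ** v = a ** b -> len (a ** b) = (len a + len b)%nat ->
     Q (v ** a)) ->
  (forall v s, Q v -> cS X s -> len (inv v ** w ** v) = S (len (s ** (inv v ** w ** v))) ->
     Q (v ** s)) ->
  (forall v s, Q v -> cS X s -> len (inv v ** w ** v) = S (len (inv v ** w ** v ** s)) ->
     Q (v ** s)) ->
  exists v z M, Q v /\ inC v z /\ in_hull w M z /\
    (forall u r, cS X r -> val u r z = 0 -> forall j, orb u r z j = 0) /\
    (forall u r i j k, cS X r -> (i < j < k)%Z ->
       0 < orb u r z i -> orb u r z j < 0 -> 0 < orb u r z k -> False).
Proof.
  intros Q1 Qint Ql Qr.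
  destruct (inversions e w) as [L [HL1 HL2]].
  destruct (common_period L) as [P [HP HPL]].
  (* [y] below needs a window of length [P], and its translate [y'] by [w^P] one of length 2 P. *)
  set (N := (P + P)%nat).
  destruct (uniform_exponent L N P HL1 HPL) as [K HK].
  specialize (HK K (le_n K)).
  assert (HA := sorted_root_all L N P K HL1 HL2 HK).
  assert (StA : forall i, exists v, Q v /\ inC v (midn i x0)).
  { induction i as [|i [v [Qv Hv]]].
    - exists e. split; trivial. change (midn 0 x0) with x0. rewrite <- (act_one x0).
      apply inC_chp.
    - set (x := midn i x0) in *.
      (* [v'] lies on a minimal gallery from [v] to [w ** v]; crossing walls towards [w ** v]
         preserves this. *)
      set (Q' := fun v' => (len (inv v ** v') + len (inv v' ** w ** v) = len (inv v ** w ** v))%nat).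
      destruct (walk Q' v (w ** v) x (act w x)) with (t := / 2) as [v' [Qv' Hv']]; trivial.
      + unfold Q'. gsimp. rewrite len_one. reflexivity.
      + now apply inC_act.
      + intros v' s t Hv' Hs _ _ _ Hneg. unfold Q' in *.
        assert (Hn := val_neg_side (w ** v) (act w x) v' s Hs (inC_act v w x Hv) Hneg).
        destruct (val_chp_dichotomy v' s (w ** v) Hs) as [[C _]|[_ C]]; [lra|].
        assert (L1 := len_mul (inv v ** v') s). assert (L2 := len_gen s Hs).
        assert (L3 := len_mul (inv v ** (v' ** s)) (inv (v' ** s) ** w ** v)).
        assert (E3 : inv v ** (v' ** s) ** (inv (v' ** s) ** w ** v) = inv v ** w ** v)
          by (gsimp; reflexivity).
        rewrite E3 in L3. clear E3. gsimp_in L1. gsimp_in L3. gsimp_in Hv'. gsimp_in C. gsimp.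
        rewrite (gen_inv s) in * by trivial. lia.
      + lra.
      + exists v'. split.
        * replace v' with (v ** (inv v ** v')) by (gsimp; reflexivity).
          apply (Qint v _ (inv v' ** w ** v)); trivial.
          -- gsimp. reflexivity.
          -- unfold Q' in Qv'. rewrite Qv'. f_equal. gsimp. reflexivity.
        * change (midn (S i) x0) with (mid x). rewrite mid_def.
          now replace (/ 2) with (1 - / 2) at 1 by lra. }
  destruct (StA K) as [v0 [Qv0 Hv0]].
  (* A root with a single sign change cannot vanish at both [midn K y] and [midn K y'], which are
     [P] steps apart on one orbit. Hence some point of the segment between them avoids any finite
     set of such walls. *)
  set (y := uavg w P). set (y' := act (zp (Z.of_nat P)) y).
  assert (Fy : orbit_hull w N y) by (apply (orbit_hull_le P); [unfold N; lia|now apply orbit_hull_uavg]).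
  assert (Fy' : orbit_hull w N y') by (apply orbit_hull_act, orbit_hull_uavg; trivial).
  (* A root vanishing at [z] changes sign at some time 0 <= i < N + K, so it is a multiple of a
     translate by such an [i] of a root in [L]: these are all the walls to avoid. *)
  set (cand := flat_map (fun q => map (fun i =>
    (orb (fst q) (snd q) (midn K y) (- Z.of_nat i), orb (fst q) (snd q) (midn K y') (- Z.of_nat i)))
    (seq 0 (N + K))) L).
  destruct (avoid_zeros cand) as [t [Ht Hcand]].
  set (u := lincomb (1 - t) t y y'). set (z := midn K u).
  assert (Fu : orbit_hull w N u) by (apply orbit_hull_lincomb; trivial; lra).
  assert (Bu : balanced w P u).
  { apply balanced_lincomb; [|apply balanced_act]; apply balanced_uavg; trivial. }
  assert (Hz : in_hull w (N + K) z) by (apply in_hull_midn, Fu).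
  assert (Cu : in_cone z).
  { apply in_cone_midn, in_cone_lincomb; [| |lra]; [|apply in_cone_act]; now apply in_cone_uavg. }
  destruct Cu as [vz Hvz].
  assert (Hgen : forall a r, cS X r -> val a r z = 0 -> forall j, orb a r z j = 0).
  { intros a r Hr E.
    destruct (vanishing_sign_change _ z a r Hz Hr E) as [i [Hi Hc]].
    destruct (sign_change_inversion w L a r i Hr HL2 Hc) as [q [Hq Eq]].
    destruct (same_wall_proportional (zp (- i) ** a) r (fst q) (snd q) Hr (HL1 q Hq) Eq)
      as [c [Hc0 Ec]].
    assert (Eorb : forall x j, orb a r x j = c * orb (fst q) (snd q) x (j - i)).
    { intros x j. assert (H := Ec (act (zp (j - i)) x)).
      rewrite <- !(orb_zero w), orb_val_shift, !orb_shift in H.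
      replace (0 + i + (j - i))%Z with j in H by lia. now rewrite H, Z.add_0_l. }
    assert (Eq0 : orb (fst q) (snd q) z (- i) = 0).
    { rewrite <- (orb_zero w), Eorb in E. apply Rmult_integral in E.
      destruct E as [E|E]; [easy|]. now rewrite Z.sub_0_l in E. }
    assert (EP : (- i + 1 + Z.of_nat (P - 1) = - i + Z.of_nat P)%Z) by lia.
    destruct (classic (orb (fst q) (snd q) (midn K y) (- i) = 0 /\
      orb (fst q) (snd q) (midn K y) (- i + Z.of_nat P) = 0)) as [[A1 A2]|NA].
    2: { exfalso. apply (Hcand (orb (fst q) (snd q) (midn K y) (- i)) (orb (fst q) (snd q) (midn K y') (- i))).
      - apply in_flat_map. exists q. split; trivial. apply in_map_iff. exists (Z.to_nat i).
        replace (Z.of_nat (Z.to_nat i)) with i by lia. split; [reflexivity|]. apply in_seq. lia.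
      - unfold y'. rewrite <- act_midn, orb_shift by apply zpow_comm. exact NA.
      - unfold z, u in Eq0. rewrite midn_lincomb, orb_lincomb in Eq0. exact Eq0. }
    destruct (HA (fst q) (snd q) (HL1 q Hq)) as [H|[H|[H|[H|H]]]].
    - specialize (H u Fu (- i)%Z). fold z in H. lra.
    - specialize (H u Fu (- i)%Z). fold z in H. lra.
    - exfalso. assert (Hpos : forall n, 0 < orb (fst q) (snd q) (midn K y) (- i + 1 + Z.of_nat n)).
      { induction n as [|n IH]; [rewrite Z.add_0_r; apply H; trivial; lra|].
        replace (- i + 1 + Z.of_nat (S n))%Z with (- i + 1 + Z.of_nat n + 1)%Z by lia.
        apply H; trivial. lra. }
      specialize (Hpos (P - 1)%nat). rewrite EP in Hpos. lra.
    - exfalso. assert (Hneg : forall n, orb (fst q) (snd q) (midn K y) (- i + 1 + Z.of_nat n) < 0).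
      { induction n as [|n IH]; [rewrite Z.add_0_r; apply H; trivial; lra|].
        replace (- i + 1 + Z.of_nat (S n))%Z with (- i + 1 + Z.of_nat n + 1)%Z by lia.
        apply H; trivial. lra. }
      specialize (Hneg (P - 1)%nat). rewrite EP in Hneg. lra.
    - intro j. rewrite Eorb. unfold z. rewrite (H u Bu). ring. }
  destruct (walk Q v0 vz (midn K x0) z Qv0 Hv0 Hvz) with (t := 1) as [v [Qv Hv]]; [|lra|].
  - intros v s t' Qv Hs Ht' Hin E0 Hneg.
    set (p := lincomb (1 - t') t' (midn K x0) z) in *.
    assert (Ep : p = midn K (lincomb (1 - t') t' x0 u)) by (unfold p, z; now rewrite midn_lincomb).
    assert (Fp : orbit_hull w N (lincomb (1 - t') t' x0 u)).
    { apply orbit_hull_lincomb; trivial. apply orbit_hull_one; trivial. }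
    rewrite <- (orb_zero w) in E0, Hneg. rewrite Ep in E0.
    destruct (HA v s Hs) as [H|[H|[H|[H|H]]]].
    + specialize (H _ Fp 0%Z). lra.
    + specialize (H _ Fp 0%Z). lra.
    (* Zero now and positive one step after any nonnegative value means negative at time -1. The
       wall then separates [v] from [inv w ** v], which makes [s] a right descent. The mirrored case
       uses time 1 and a left descent. *)
    + apply Qr; trivial.
      assert (Hm : orb v s p (-1) < 0).
      { rewrite Ep. apply Rnot_le_lt. intro C. apply (H _ Fp (-1)%Z) in C. simpl in C. lra. }
      assert (Hn := val_neg_side (zp (-1) ** v) (act (zp (-1)) p) v s Hs (inC_act v _ p Hin) Hm).
      destruct (val_chp_dichotomy v s (zp (-1) ** v) Hs) as [[C _]|[_ C]]; [lra|].
      assert (Ez : zp (-1) = inv w) by (rewrite <- (zpow_one w) at 2; now rewrite <- zpow_opp).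
      rewrite Ez, <- (len_inv (_ ** _)), <- (len_inv (s ** _)) in C. gsimp_in C.
      rewrite (gen_inv s) in C by trivial. gsimp. exact C.
    + apply Ql; trivial.
      assert (Hm : orb v s p 1 < 0).
      { rewrite Ep. apply (H _ Fp 0%Z). lra. }
      assert (Hn := val_neg_side (zp 1 ** v) (act (zp 1) p) v s Hs (inC_act v _ p Hin) Hm).
      destruct (val_chp_dichotomy v s (zp 1 ** v) Hs) as [[C _]|[_ C]]; [lra|].
      rewrite (zpow_one w) in C. gsimp_in C. gsimp. exact C.
    + exfalso. unfold z in Hneg. rewrite (H u Bu) in Hneg. lra.
  - exists v, z, (N + K)%nat. split; [trivial|split; [|split; [trivial|split; [trivial|]]]].
    + replace z with (lincomb (1 - 1) 1 (midn K x0) z); trivial.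
      apply functional_extensionality. intro r. unfold lincomb. ring.
    + intros a r i j k Hr Hijk H1 H2 H3.
      destruct (HA a r Hr) as [H|[H|[H|[H|H]]]].
      * specialize (H u Fu j). fold z in H. lra.
      * specialize (H u Fu i). fold z in H. lra.
      * assert (Hpos : forall n, 0 < orb a r z (i + Z.of_nat n)).
        { induction n as [|n IH]; [now rewrite Z.add_0_r|].
          replace (i + Z.of_nat (S n))%Z with (i + Z.of_nat n + 1)%Z by lia. apply H; trivial.
          fold z. lra. }
        specialize (Hpos (Z.to_nat (j - i))).
        replace (i + Z.of_nat (Z.to_nat (j - i)))%Z with j in Hpos by lia. lra.
      * assert (Hng : forall n, orb a r z (j + Z.of_nat n) < 0).
        { induction n as [|n IH]; [now rewrite Z.add_0_r|].
          replace (j + Z.of_nat (S n))%Z with (j + Z.of_nat n + 1)%Z by lia. apply H; trivial.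
          fold z. lra. }
        specialize (Hng (Z.to_nat (k - j))).
        replace (j + Z.of_nat (Z.to_nat (k - j)))%Z with k in Hng by lia. lra.
      * specialize (H u Bu i). fold z in H. lra.
Qed.

End StraightPoint.

(** * Parabolic cosets, walls of a gallery, and the straight conjugate *)

Fixpoint refl_list (p : cW X) (l : list (cW X)) : list (cW X) :=
  match l with
  | [] => []
  | s :: l => cmul X (cmul X p s) (inv p) :: refl_list (cmul X p s) l
  end.

Definition min_in_coset (J : cW X -> Prop) (x : cW X) : Prop :=
  forall u, in_WJ X J u -> len x <= len (cmul X x u).

Lemma list_of_bounded {A : Type} (P : A -> Prop) (l0 : list A) :
  (forall a, P a -> In a l0) -> exists l, forall a, P a <-> In a l.
Proof.
  intro H. exists (filter (fun a => if excluded_middle_informative (P a) then true else false) l0).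
  intro a. rewrite filter_In. destruct (excluded_middle_informative (P a)) as [Pa|Na].
  - split; auto.
  - split; [easy|]. now intros [_ C].
Qed.

Section Parabolic.
Local Notation x0 := one_pt.
Local Notation chp u := (act u one_pt).
Local Open Scope R_scope.

Lemma in_WJ_mul J u v : in_WJ X J u -> in_WJ X J v -> in_WJ X J (u ** v).
Proof.
  intros [l [Hl ->]] [k [Hk ->]]. exists (l ++ k). split; [now apply Forall_app|].
  symmetry. apply wprod_app.
Qed.

Lemma in_WJ_inv (J : cW X -> Prop) u : (forall s, J s -> cS X s) -> in_WJ X J u -> in_WJ X J (inv u).
Proof.
  intros HJ [l [Hl ->]]. exists (rev l). split; [now apply Forall_rev|].
  symmetry. apply wprod_rev. revert Hl. now apply Forall_impl.
Qed.

Lemma in_WJ_gen (J : cW X -> Prop) s : J s -> in_WJ X J s.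
Proof. intro Hs. exists [s]. split; [auto|]. simpl. gsimp. reflexivity. Qed.

Lemma min_in_coset_exists J w : exists d, in_WJ X J d /\ min_in_coset J (w ** d).
Proof.
  destruct (nat_least (fun n => exists d, in_WJ X J d /\ n = len (w ** d))) as [n [[d [Hd En]] Hmin]].
  - exists (len (w ** e)), e. split; trivial. apply in_WJ_one.
  - exists d. split; trivial. intros u Hu. rewrite <- En. apply Hmin. exists (d ** u).
    split; [now apply in_WJ_mul|]. f_equal. gsimp. reflexivity.
Qed.

(** A wall crossed within the coset x [W_J] belongs to a reflection preserving that coset, because
    [exchange] deletes a letter of [J]. *)
Lemma wall_in_coset (J : cW X -> Prop) v s x u : (forall r, J r -> cS X r) -> cS X s ->
  in_WJ X J u -> val v s (chp x) * val v s (chp (x ** u)) < 0 ->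
  exists d, in_WJ X J d /\ v ** s ** inv v ** x = x ** d.
Proof.
  intros HJ Hs [l [Hl ->]] H.
  destruct (exchange J v s x l HJ Hs Hl H) as [l' [H1 [_ H3]]].
  exists (word l' ** inv (word l)). split.
  - apply in_WJ_mul; [now exists l'|apply in_WJ_inv; trivial; now exists l].
  - apply (grp_cancel_r GX (word l)). gsimp. gsimp_in H3. exact H3.
Qed.

(** A wall of the coset that separated [e] from [x] would let its reflection shorten [x] inside the
    coset. *)
Lemma min_in_coset_side (J : cW X -> Prop) v s x d : cS X s -> min_in_coset J x ->
  in_WJ X J d -> v ** s ** inv v ** x = x ** d -> 0 < val v s (chp e) * val v s (chp x).
Proof.
  intros Hs Hmin Hd E.
  destruct (Rlt_dec (val v s (chp e) * val v s (chp x)) 0) as [C|C].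
  - apply strong_exchange in C; trivial. rewrite E in C. specialize (Hmin d Hd). lia.
  - destruct (val_chp_dichotomy v s e Hs) as [[A _]|[A _]],
      (val_chp_dichotomy v s x Hs) as [[A' _]|[A' _]]; nra.
Qed.

Lemma min_in_coset_len (J : cW X -> Prop) x u : (forall s, J s -> cS X s) -> min_in_coset J x ->
  in_WJ X J u -> len (x ** u) = (len x + len u)%nat.
Proof.
  intros HJ Hmin Hu. apply len_additive. intros v s Hs H1 H2 H3.
  destruct (wall_in_coset J v s x u HJ Hs Hu) as [d [Hd Ed]]; [nra|].
  assert (H := min_in_coset_side J v s x d Hs Hmin Hd Ed). nra.
Qed.

Lemma min_in_coset_inv (J : cW X -> Prop) x : (forall s, J s -> cS X s) -> min_in_coset J x ->
  (forall u, in_WJ X J u -> in_WJ X J (inv x ** u ** x)) -> min_in_coset J (inv x).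
Proof.
  intros HJ Hmin Hn u Hu. rewrite len_inv, <- (len_inv (inv x ** u)). gsimp.
  replace (inv u ** x) with (x ** (inv x ** inv u ** x)) by (gsimp; reflexivity).
  apply Hmin, Hn, in_WJ_inv; trivial.
Qed.

Lemma finitely_many_of_length n : exists l, forall u, (len u <= n)%nat -> In u l.
Proof.
  destruct (cs_finite X HX) as [S0 HS]. induction n as [|n [l Hl]].
  - exists [e]. intros u Hu. left. symmetry. apply len_zero. lia.
  - exists (e :: flat_map (fun s => map (fun u => s ** u) l) S0). intros u Hu.
    destruct (classic (u = e)) as [->|N]; [now left|right].
    destruct (left_descent u N) as [s [Hs L]]. apply in_flat_map. exists s.
    split; [now apply HS|]. apply in_map_iff. exists (s ** u).
    split; [now apply gen_cancel|]. apply Hl. lia.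
Qed.

(** With the next two lemmas: for a reduced word, [refl_list] enumerates the walls between the ends
    of the gallery, each exactly once. *)
Lemma refl_list_complete v s p l : cS X s -> Forall (cS X) l ->
  val v s (chp p) * val v s (chp (p ** word l)) < 0 ->
  In (v ** s ** inv v) (refl_list p l).
Proof.
  intros Hs Hl. revert p. induction Hl as [|r l Hr Hl IH]; intros p H.
  - simpl in H. gsimp_in H. nra.
  - change (word (r :: l)) with (r ** word l) in H. simpl.
    destruct (Rlt_dec (val v s (chp p) * val v s (chp (p ** r))) 0) as [N|N].
    + left. symmetry. now apply wall_unique.
    + right. apply IH. revert H N. rewrite !mulA.
      destruct (val_chp_dichotomy v s p Hs) as [[A1 _]|[A1 _]],
        (val_chp_dichotomy v s (p ** r) Hs) as [[A2 _]|[A2 _]]; intros; nra.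
Qed.

Lemma refl_list_sound p l t : Forall (cS X) l -> len (word l) = length l ->
  In t (refl_list p l) ->
  exists v s, cS X s /\ t = v ** s ** inv v /\
    val v s (chp p) * val v s (chp (p ** word l)) < 0.
Proof.
  intros Hl. revert p. induction Hl as [|r l Hr Hl IH]; intros p L Ht; [easy|].
  assert (L' : len (word l) = length l) by (apply (reduced_tail r); auto).
  change (word (r :: l)) with (r ** word l) in *.
  assert (Hend : val p r (chp (p ** (r ** word l))) <= -1).
  { destruct (val_chp_dichotomy p r (p ** (r ** word l)) Hr) as [[_ A]|[A _]]; trivial.
    gsimp_in A. rewrite gen_cancel in A by trivial. simpl in L. lia. }
  destruct Ht as [<-|Ht].
  - exists p, r. split; [trivial|split; [reflexivity|]]. rewrite val_self by trivial. lra.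
  - destruct (IH (p ** r) L' Ht) as [v [s [Hs [E H]]]]. exists v, s.
    split; [trivial|split; [trivial|]]. rewrite <- mulA in H.
    destruct (Rlt_dec (val v s (chp p) * val v s (chp (p ** r))) 0) as [N|N].
    + exfalso. destruct (same_wall_proportional v s p r Hs Hr) as [k [_ Ek]].
      { now apply wall_unique. }
      rewrite !Ek, val_self_gen in H by trivial.
      rewrite !Ek, val_self_gen, val_self in N by trivial. nra.
    + destruct (val_chp_dichotomy v s p Hs) as [[A1 _]|[A1 _]],
        (val_chp_dichotomy v s (p ** r) Hs) as [[A2 _]|[A2 _]]; nra.
Qed.

Lemma refl_list_NoDup p l : Forall (cS X) l -> len (word l) = length l ->
  NoDup (refl_list p l).
Proof.
  intros Hl. revert p. induction Hl as [|r l Hr Hl IH]; intros p L; [constructor|].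
  assert (L' : len (word l) = length l) by (apply (reduced_tail r); auto).
  simpl. constructor; [|now apply IH]. intro Ht.
  destruct (refl_list_sound (p ** r) l _ Hl L' Ht) as [v [s [Hs [E H]]]].
  destruct (same_wall_proportional v s p r Hs Hr (eq_sym E)) as [k [_ Ek]].
  rewrite !Ek, val_self_gen in H by trivial.
  destruct (val_chp_dichotomy p r (p ** r ** word l) Hr) as [[_ A]|[A _]].
  - gsimp_in A. rewrite gen_cancel in A by trivial. simpl in L. unfold wprod in *. lia.
  - nra.
Qed.

Lemma refl_list_length p l : length (refl_list p l) = length l.
Proof. revert p. induction l as [|s l IH]; intro p; simpl; auto. Qed.

Lemma stabilizer_refl u r z : cS X r -> val u r z = 0 -> act (u ** r ** inv u) z = z.
Proof.
  intros Hr E. rewrite !act_mul, (act_gen r), refl_fix by trivial.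
  apply act_inv_r.
Qed.

(** Move the point of [straight_point] to [z0] in the fundamental chamber and let [J] be its zeros,
    so that [W_J] is its stabilizer. Roots vanish on the whole orbit of [z0] or nowhere on it, hence
    all orbit points have the same stabilizer and the shortest element [x] of the coset normalizes
    it. *)
Theorem straight_conjugate (w : cW X) (Q : cW X -> Prop) :
  Q e ->
  (forall v a b, Q v -> inv v ** w ** v = a ** b -> len (a ** b) = (len a + len b)%nat ->
     Q (v ** a)) ->
  (forall v s, Q v -> cS X s -> len (inv v ** w ** v) = S (len (s ** (inv v ** w ** v))) ->
     Q (v ** s)) ->
  (forall v s, Q v -> cS X s -> len (inv v ** w ** v) = S (len (inv v ** w ** v ** s)) ->
     Q (v ** s)) ->
  exists v (J : cW X -> Prop) x d, Q v /\ (forall s, J s -> cS X s) /\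
    (exists l, forall u, in_WJ X J u <-> In u l) /\
    in_WJ X J d /\ inv v ** w ** v = x ** d /\ min_in_coset J x /\
    (forall u, in_WJ X J u -> in_WJ X J (inv x ** u ** x)) /\
    (forall u, in_WJ X J u -> in_WJ X J (x ** u ** inv x)) /\
    (forall k, len (pw x k) = (k * len x)%nat).
Proof.
  intros Q1 Q2 Q3 Q4.
  destruct (straight_point w Q Q1 Q2 Q3 Q4) as [v [z [M [Qv [Hv [Hz [AL SC]]]]]]].
  set (z0 := act (inv v) z). set (wt := inv v ** w ** v) in *.
  set (J := fun s => cS X s /\ z0 s = 0).
  assert (Ez : act v z0 = z) by apply act_inv_r.
  assert (HJ : forall s, J s -> cS X s) by (intros s [Hs _]; exact Hs).
  assert (P0 : forall s, cS X s -> 0 <= z0 s) by (intros s Hs; exact (Hv s Hs)).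
  assert (C0 : inC e z0).
  { intros s Hs. rewrite val_def. gsimp. rewrite act_one. auto. }
  assert (Fix : forall u, act u z0 = z0 -> in_WJ X J u).
  { intros u Hu. apply stabilizer_in_WJ; trivial. intros s Hs.
    rewrite val_def. gsimp. rewrite Hu. auto. }
  assert (Horb : forall u r k, val u r (act (zpow wt k) z0) = orb w (v ** u) r z k).
  { intros u r k. rewrite orb_def, !val_def. rewrite <- Ez, <- !act_mul.
    assert (E : v ** zpow wt k = zpow w k ** v).
    { induction k as [|k IH|k IH] using Z.peano_ind.
      - rewrite !zpow_zero. gsimp. reflexivity.
      - unfold Z.succ. rewrite !zpow_succ, mulA.
        replace (v ** wt) with (w ** v) by (unfold wt; gsimp; reflexivity).
        rewrite <- !mulA, IH. reflexivity.
      - apply (grp_cancel_l GX w). rewrite (mulA w (zpow w _)).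
        rewrite <- zpow_succ. replace (w ** (v ** zpow wt (Z.pred k)))
          with (v ** (wt ** zpow wt (Z.pred k))) by (unfold wt; gsimp; reflexivity).
        rewrite <- zpow_succ. replace (Z.pred k + 1)%Z with k by lia. exact IH. }
    assert (EE : inv u ** zpow wt k = inv (v ** u) ** zpow w k ** v)
      by (gsimp; rewrite <- E; gsimp; reflexivity).
    now rewrite EE. }
  assert (AL0 : forall u r k, cS X r -> val u r (act (zpow wt k) z0) = 0 ->
    forall j, val u r (act (zpow wt j) z0) = 0).
  { intros u r k Hr E j. rewrite Horb in *. rewrite orb_val in E.
    assert (H := AL _ r Hr E (j - k)%Z). rewrite orb_val_shift in H.
    replace (j - k + k)%Z with j in H by lia. exact H. }
  destruct (min_in_coset_exists J wt) as [d [Hd Hmin]]. set (x := wt ** d) in *.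
  assert (Fd : act d z0 = z0) by (apply (in_WJ_fix J); auto).
  assert (Fz : forall k u, in_WJ X J u -> act u (act (zpow wt k) z0) = act (zpow wt k) z0).
  { intros k u Hu. apply (in_WJ_fix J); trivial. intros s [Hs Es]. split; trivial.
    assert (H := AL0 e s 0%Z Hs). rewrite zpow_zero, !act_one, val_def in H.
    revert H. gsimp. rewrite act_one. intro H. specialize (H Es k). rewrite val_def in H.
    revert H. gsimp. now rewrite act_one. }
  assert (Fx : forall k, act (pw x k) z0 = act (zpow wt (Z.of_nat k)) z0).
  { induction k as [|k IH].
    - reflexivity.
    - simpl gpow. rewrite act_mul, IH. unfold x. rewrite act_mul, Fz by trivial.
      rewrite <- act_mul, <- zpow_succ. do 2 f_equal. lia. }
  assert (N1 : forall u, in_WJ X J u -> in_WJ X J (inv x ** u ** x)).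
  { intros u Hu. apply Fix. rewrite !act_mul.
    assert (E := Fx 1%nat). simpl gpow in E. revert E. gsimp. intro E.
    rewrite E, Fz, <- E by trivial. apply act_inv_l. }
  assert (Zx : act (inv x) z0 = act (zpow wt (-1)) z0).
  { assert (E1 : zpow wt (-1) = inv wt)
      by exact (eq_trans (zpow_opp wt 1) (f_equal inv (zpow_one wt))).
    unfold x. gsimp. rewrite act_mul, <- E1. apply Fz, in_WJ_inv; trivial. }
  assert (N2 : forall u, in_WJ X J u -> in_WJ X J (x ** u ** inv x)).
  { intros u Hu. apply Fix. rewrite !act_mul, Zx, Fz, <- Zx by trivial. apply act_inv_r. }
  (* Reflections of roots vanishing at [z0] lie in [W_J]; minimality of [x] keeps [e] and [x] on the
     same side of their walls, and [Side] iterates this. *)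
  assert (Side1 : forall u r, cS X r -> val u r z0 = 0 ->
    0 < val u r (chp e) * val u r (chp x)).
  { intros u r Hr E.
    assert (Ht : in_WJ X J (u ** r ** inv u)) by now apply Fix, stabilizer_refl.
    apply (min_in_coset_side J u r x (inv x ** (u ** r ** inv u) ** x)); auto.
    gsimp. reflexivity. }
  assert (Side : forall k u r, cS X r -> val u r z0 = 0 ->
    0 < val u r (chp e) * val u r (chp (pw x k))).
  { induction k as [|k IH]; intros u r Hr E.
    - simpl. destruct (val_chp_dichotomy u r e Hr) as [[A _]|[A _]]; nra.
    - replace (pw x (S k)) with (pw x k ** x).
      + set (y := pw x k) in *.
        assert (E' : val (inv y ** u) r z0 = 0).
        { rewrite <- val_act. unfold y. rewrite Fx. apply (AL0 u r 0%Z); trivial.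
          rewrite zpow_zero, act_one. exact E. }
        assert (H1 := Side1 (inv y ** u) r Hr E'). assert (H2 := IH u r Hr E).
        rewrite <- !val_act, <- !act_mul in H1. revert H1. gsimp. intro H1.
        destruct (val_chp_dichotomy u r e Hr) as [[A1 _]|[A1 _]],
          (val_chp_dichotomy u r y Hr) as [[A2 _]|[A2 _]]; nra.
      + replace (S k) with (k + 1)%nat by lia. rewrite (gpow_add GX). simpl. gsimp. reflexivity. }
  exists v, J, x, (inv d). split; [trivial|split; [trivial|split]].
  (* Finiteness of [W_J]: [z0] lies in both chambers [e] and [u], so every wall between them
     contains it, hence changes sign in the window of length [M] and is listed in [T0]. Thus
     [len u <= length T0]. *)
  { destruct (inversions e w) as [L [HL1 HL2]].
    set (T0 := flat_map (fun q => map (fun i => inv v ** zpow w (Z.of_nat i) **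
       (fst q ** snd q ** inv (fst q)) ** inv (inv v ** zpow w (Z.of_nat i))) (seq 0 M)) L).
    destruct (finitely_many_of_length (length T0)) as [l Hl].
    apply (list_of_bounded _ l). intros u Hu. apply Hl.
    destruct (reduced_word u) as [k [Hk [Ek Lk]]]. rewrite <- Lk, <- (refl_list_length e k).
    apply NoDup_incl_length; [apply refl_list_NoDup; trivial; now rewrite <- Ek, Lk|].
    intros t Ht. apply refl_list_sound in Ht; trivial; [|now rewrite <- Ek, Lk].
    destruct Ht as [a [r [Hr [-> Hsep]]]]. revert Hsep. gsimp. rewrite <- Ek. intro Hsep.
    assert (Eu : act u z0 = z0) by (apply (in_WJ_fix J); auto).
    assert (Cu : inC u z0).
    { intros s Hs. rewrite <- Eu at 1. rewrite val_act. gsimp. apply (C0 s Hs). }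
    assert (E0 : val a r z0 = 0).
    { destruct (val_chp_dichotomy a r e Hr) as [[A1 _]|[A1 _]],
        (val_chp_dichotomy a r u Hr) as [[A2 _]|[A2 _]]; try nra.
      - apply Rle_antisym; [apply (inC_neg u)|apply (inC_pos e)]; trivial; lra.
      - apply Rle_antisym; [apply (inC_neg e)|apply (inC_pos u)]; trivial; lra. }
    assert (E1 : val (v ** a) r z = 0).
    { rewrite <- Ez, val_act. gsimp. exact E0. }
    destruct (vanishing_sign_change w M z (v ** a) r Hz Hr E1) as [i [Hi Hc]].
    destruct (sign_change_inversion w L (v ** a) r i Hr HL2 Hc) as [q [Hq Eq]].
    apply in_flat_map. exists q. split; trivial. apply in_map_iff. exists (Z.to_nat i).
    replace (Z.of_nat (Z.to_nat i)) with i by lia. split; [|apply in_seq; lia].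
    rewrite <- Eq, zpow_opp. gsimp. reflexivity. }
  split; [now apply in_WJ_inv|split; [|split; [trivial|split; [trivial|split; [trivial|]]]]].
  { assert (EW : forall q, q = q ** d ** inv d) by (intro q; gsimp; reflexivity). apply EW. }
  induction k as [|k IH]; [apply len_one|].
  replace (pw x (S k)) with (pw x k ** x)
    by (replace (S k) with (k + 1)%nat by lia; rewrite (gpow_add GX); simpl; gsimp; reflexivity).
  assert (Egp : pw x k ** x = pw x (S k))
    by (replace (S k) with (k + 1)%nat by lia; rewrite (gpow_add GX); simpl; gsimp; reflexivity).
  rewrite len_additive, IH; [simpl; lia|].
  (* A failure of additivity is a root negative at [e], positive at x^k and negative at x^(k+1).
     [Side] excludes it if the root vanishes on the orbit of [z0], and [SC] if it does not. *)
  intros u r Hr H1 H2 H3. rewrite Egp in H3.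
  assert (Cx : forall i, inC (pw x i) (act (zpow wt (Z.of_nat i)) z0)).
  { intro i. rewrite <- Fx. rewrite <- (grp_oner GX (gpow _ _ _ i)) at 1.
    now apply inC_act. }
  assert (V0 : val u r z0 <= 0) by (apply (inC_neg e); trivial).
  assert (Vk := inC_pos _ _ u r Hr (Cx k) H2).
  assert (Vk1 := inC_neg _ _ u r Hr (Cx (S k)) H3).
  assert (NZ : forall i, val u r (act (zpow wt i) z0) <> 0).
  { intros i E. assert (E0 := AL0 u r i Hr E 0%Z). rewrite zpow_zero, act_one in E0.
    assert (S1 := Side k u r Hr E0). nra. }
  assert (NZ0 := NZ 0%Z). rewrite zpow_zero, act_one in NZ0.
  destruct k as [|k].
  - simpl in H2. lra.
  (* [SC] forbids the pattern + - +, so the opposite root is taken. *)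
  - apply (SC (v ** (u ** r)) r 0%Z (Z.of_nat (S k)) (Z.of_nat (S (S k))) Hr); [lia| | |].
    + rewrite <- Horb, zpow_zero, act_one, val_gen by trivial. lra.
    + rewrite <- Horb, val_gen by trivial. specialize (NZ (Z.of_nat (S k))). lra.
    + rewrite <- Horb, val_gen by trivial. specialize (NZ (Z.of_nat (S (S k)))). lra.
Qed.

End Parabolic.

Definition sphere_size (B : Bldg X) (w : cW X) (k : nat) : Prop :=
  forall x, exists l : list (ch B), NoDup l /\ length l = k /\ forall y, In y l <-> wdist B x y = w.

Definition qprod (q : cW X -> nat) (l : list (cW X)) : nat :=
  fold_right (fun s n => q s * n) 1 l.

(** * Spheres and parallel residues in buildings *)

Section Building.
Context {B : Bldg X} (HB : is_building X B).
Local Notation dl := (wdist B).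

Lemma dl_refl x : dl x x = e.
Proof. now apply (WD1 X B HB). Qed.

Lemma dl_step x' x y s : cS X s -> dl x' x = s ->
  (dl x' y = s ** dl x y \/ dl x' y = dl x y) /\
  (len (s ** dl x y) = S (len (dl x y)) -> dl x' y = s ** dl x y).
Proof.
  intros Hs E. destruct (WD2 X B HB x y x' s (dl x y) eq_refl Hs E) as [H1 H2].
  split; trivial. intro L. apply (H2 (len (dl x y))); apply wlen_len; congruence.
Qed.

Lemma dl_gen_sym x y s : cS X s -> dl x y = s -> dl y x = s.
Proof.
  intros Hs E. destruct (dl_step x y x s Hs E) as [[H|H] _]; rewrite dl_refl in H.
  - apply (grp_cancel_l GX s). rewrite <- H. symmetry. now apply gen_sq.
  - symmetry in H. apply (WD1 X B HB) in H. rewrite H, dl_refl in E.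
    now destruct (gen_neq_one s Hs).
Qed.

Lemma dl_neighbour x y s : cS X s ->
  exists x', dl x' x = s /\ dl x x' = s /\ dl x' y = s ** dl x y.
Proof.
  intros Hs. destruct (WD3 X B HB x y s (dl x y) eq_refl Hs) as [x' [H1 H2]].
  exists x'. split; [trivial|split; trivial]. now apply dl_gen_sym.
Qed.

Lemma dl_comp x y z : len (dl x y ** dl y z) = len (dl x y) + len (dl y z) ->
  dl x z = dl x y ** dl y z.
Proof.
  remember (len (dl x y)) as n eqn:En. revert x En. induction n as [|n IH]; intros x En L.
  - assert (E := len_zero _ (eq_sym En)). rewrite E. apply (WD1 X B HB) in E. subst.
    gsimp. reflexivity.
  - destruct (left_descent (dl x y)) as [s [Hs Ls]].
    { intro E. rewrite E, len_one in En. lia. }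
    destruct (dl_neighbour x y s Hs) as [x' [H1 [H2 H3]]].
    assert (L2 := len_mul s (dl x' y ** dl y z)). assert (L1 := len_gen s Hs).
    assert (L3 := len_mul (dl x' y) (dl y z)).
    assert (E3 : s ** (dl x' y ** dl y z) = dl x y ** dl y z).
    { rewrite H3. gsimp. now rewrite gen_cancel. }
    rewrite E3 in L2. rewrite H3 in L3.
    assert (IH' : dl x' z = dl x' y ** dl y z).
    { apply IH; rewrite H3; [lia|]. rewrite <- H3 in *. lia. }
    destruct (dl_step x x' z s Hs H2) as [_ H]. rewrite IH', E3 in H. apply H.
    rewrite H3 in *. lia.
Qed.

Lemma dl_len_triangle x y z : len (dl x z) <= len (dl x y) + len (dl y z) /\
  (len (dl x z) = len (dl x y) + len (dl y z) -> dl x z = dl x y ** dl y z).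
Proof.
  remember (len (dl x y)) as n eqn:En. revert x En. induction n as [|n IH]; intros x En.
  - assert (E := len_zero _ (eq_sym En)). rewrite E. apply (WD1 X B HB) in E. subst.
    gsimp. split; [lia|trivial].
  - destruct (left_descent (dl x y)) as [s [Hs Ls]].
    { intro E. rewrite E, len_one in En. lia. }
    destruct (dl_neighbour x y s Hs) as [x' [H1 [H2 H3]]].
    destruct (IH x') as [IH1 IH2]; [rewrite H3; lia|].
    destruct (dl_step x x' z s Hs H2) as [[H|H] _].
    + rewrite H. assert (L2 := len_mul s (dl x' z)). assert (L1 := len_gen s Hs).
      split; [lia|]. intro E. rewrite IH2, H3 by lia. gsimp. now rewrite gen_cancel.
    + rewrite H. split; [lia|]. intro E. lia.
Qed.

Lemma dl_sym x y : dl y x = inv (dl x y).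
Proof.
  remember (len (dl x y)) as n eqn:En. revert x En. induction n as [|n IH]; intros x En.
  - assert (E := len_zero _ (eq_sym En)). rewrite E. apply (WD1 X B HB) in E. subst.
    rewrite dl_refl. gsimp. reflexivity.
  - destruct (left_descent (dl x y)) as [s [Hs Ls]].
    { intro E. rewrite E, len_one in En. lia. }
    destruct (dl_neighbour x y s Hs) as [x' [H1 [H2 H3]]].
    assert (IH' : dl y x' = inv (dl x y) ** s).
    { rewrite IH, H3; [|rewrite H3; lia]. gsimp. now rewrite (gen_inv s). }
    rewrite (dl_comp y x' x), IH', H1.
    + now rewrite gen_cancel_r.
    + rewrite IH', H1, gen_cancel_r, len_inv, (len_gen_eq s) by trivial.
      rewrite <- (len_inv (inv _ ** s)). gsimp. rewrite (gen_inv s) by trivial. lia.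
Qed.

(** No length condition is made on [a ** b]: [WD3] supplies a neighbour at distance [s ** w] whether
    this is longer or shorter than [w]. *)
Lemma dl_between x z a b : dl x z = a ** b -> exists y, dl x y = a /\ dl y z = b.
Proof.
  remember (len a) as n eqn:En. revert x a En. induction n as [|n IH]; intros x a En E.
  - assert (Ea := len_zero _ (eq_sym En)). subst a. exists x. split; [apply dl_refl|].
    rewrite E. gsimp. reflexivity.
  - destruct (left_descent a) as [s [Hs Ls]].
    { intros ->. rewrite len_one in En. lia. }
    destruct (dl_neighbour x z s Hs) as [x' [H1 [H2 H3]]].
    destruct (IH x' (s ** a)) as [y [Hy1 Hy2]]; [lia|rewrite H3, E; gsimp; reflexivity|].
    exists y. split; trivial. rewrite (dl_comp x x' y), H2, Hy1.
    + now rewrite gen_cancel.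
    + rewrite H2, Hy1, gen_cancel, (len_gen_eq s) by trivial. lia.
Qed.

Lemma dl_panel x y z s : cS X s -> dl x y = s -> dl x z = s -> y = z \/ dl y z = s.
Proof.
  intros Hs Hy Hz. assert (Hy' := dl_gen_sym x y s Hs Hy).
  destruct (dl_step y x z s Hs Hy') as [[H|H] _]; rewrite Hz in H.
  - left. rewrite gen_sq in H by trivial. now apply (WD1 X B HB).
  - now right.
Qed.

Lemma dl_target x y z : dl x y = dl x z -> len (dl x y ** dl y z) = len (dl x y) + len (dl y z) -> y = z.
Proof.
  intros E L. apply (WD1 X B HB). assert (H := dl_comp x y z L). rewrite <- E in H.
  apply (grp_cancel_l GX (dl x y)). rewrite <- H. gsimp. reflexivity.
Qed.

Lemma in_WJ_dl_trans (J : cW X -> Prop) x y z : (forall s, J s -> cS X s) ->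
  in_WJ X J (dl x y) -> in_WJ X J (dl y z) -> in_WJ X J (dl x z).
Proof.
  intros HJ [l [Hl El]] Hz. revert x El. induction Hl as [|s l Hs Hl IH]; intros x El.
  - apply (WD1 X B HB) in El. now subst.
  - change (word (s :: l)) with (s ** word l) in El.
    destruct (dl_between x y s (word l) El) as [x' [H1 H2]].
    destruct (dl_step x x' z s (HJ s Hs) H1) as [[H|H] _]; rewrite H.
    + apply in_WJ_cons; auto.
    + auto.
Qed.

Lemma in_WJ_dl_sym (J : cW X -> Prop) x y : (forall s, J s -> cS X s) ->
  in_WJ X J (dl x y) -> in_WJ X J (dl y x).
Proof. intros HJ H. rewrite dl_sym. now apply in_WJ_inv. Qed.

(** * Cardinalities of spheres *)

Section Counting.
Context (q : cW X -> nat) (Hq : forall s x, cS X s -> panel_count X B x s (q s)).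

Lemma sphere_size_unique (x : ch B) w k k' : sphere_size B w k -> sphere_size B w k' -> k = k' .
Proof.
  intros H H'. destruct (H x) as [l [H1 [H2 H3]]]. destruct (H' x) as [l' [H1' [H2' H3']]].
  rewrite <- H2, <- H2'. apply Nat.le_antisymm; apply NoDup_incl_length; trivial;
    intros y Hy; [apply H3', H3|apply H3, H3']; trivial.
Qed.

Lemma sphere_size_one : sphere_size B e 1.
Proof.
  intro x. exists [x]. split; [repeat constructor; easy|split; [reflexivity|]].
  intro y. rewrite (WD1 X B HB). simpl. intuition congruence.
Qed.

Lemma sphere_size_cons s w k : cS X s -> len (s ** w) = S (len w) -> sphere_size B w k ->
  sphere_size B (s ** w) (q s * k).
Proof.
  intros Hs L Hk x. destruct (Hq s x Hs) as [P [P1 [P2 P3]]].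
  (* The spheres of type [w] around the chambers [s]-adjacent to [x] are disjoint: two such centres
     are [s]-adjacent to each other, and [s ** w] is longer than [w]. *)
  assert (Hdisj : forall a b y, In a P -> In b P -> dl a y = w -> dl b y = w -> a = b).
  { intros a b y Ha Hb Ea Eb. apply P3 in Ha, Hb.
    destruct (dl_panel x a b s Hs Ha Hb) as [|E]; trivial. exfalso.
    destruct (dl_step a b y s Hs E) as [_ H]. rewrite Eb, Ea in H. specialize (H L).
    rewrite H in L at 2. lia. }
  assert (Main : exists l, NoDup l /\ length l = length P * k /\
    forall y, In y l <-> exists a, In a P /\ dl a y = w).
  { clear P2 P3. induction P as [|a P IH].
    - exists []. split; [constructor|split; [reflexivity|]]. intro y. split; [easy|].
      now intros [a [[] _]].
    - inversion P1 as [|? ? Na NP]; subst.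
      destruct IH as [l [L1 [L2 L3]]]; trivial.
      { intros b c y Hb Hc. apply Hdisj; now right. }
      destruct (Hk a) as [m [M1 [M2 M3]]]. exists (m ++ l). split; [|split].
      + apply NoDup_app; trivial. intros y Hy Hy'. apply M3 in Hy.
        apply L3 in Hy'. destruct Hy' as [b [Hb Eb]]. apply Na.
        rewrite (Hdisj a b y); trivial; [now left|now right].
      + rewrite length_app, M2, L2. reflexivity.
      + intro y. rewrite in_app_iff, M3, L3. split.
        * intros [H|[b [Hb Eb]]]; [exists a; split; [now left|trivial]|].
          exists b. split; [now right|trivial].
        * intros [b [[<-|Hb] Eb]]; [now left|right; now exists b]. }
  destruct Main as [l [L1 [L2 L3]]]. exists l. split; [trivial|split; [now rewrite L2, P2|]].
  intro y. rewrite L3. split.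
  - intros [a [Ha Ea]]. apply P3 in Ha. rewrite (dl_comp x a y), Ha, Ea; trivial.
    rewrite Ha, Ea, (len_gen_eq s) by trivial. lia.
  - intro E. destruct (dl_between x y s w E) as [a [Ha Ea]]. exists a. split; trivial. now apply P3.
Qed.

Lemma sphere_size_word l : Forall (cS X) l -> len (word l) = length l ->
  sphere_size B (word l) (qprod q l).
Proof.
  intro Hl. induction Hl as [|s l Hs Hl IH]; intro L; [apply sphere_size_one|].
  assert (L' : len (word l) = length l) by (apply (reduced_tail s); auto).
  apply (sphere_size_cons s (word l)); auto. rewrite L'. exact L.
Qed.

Lemma qprod_app l l' : qprod q (l ++ l') = qprod q l * qprod q l'.
Proof. unfold qprod. induction l as [|s l IH]; simpl; [lia|]. rewrite IH. lia. Qed.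

Lemma sphere_size_mul (x : ch B) a b k m : len (a ** b) = len a + len b ->
  sphere_size B a k -> sphere_size B b m -> sphere_size B (a ** b) (k * m).
Proof.
  intros L Ha Hb. destruct (reduced_word a) as [la [Fa [Ea La]]].
  destruct (reduced_word b) as [lb [Fb [Eb Lb]]].
  rewrite (sphere_size_unique x a k (qprod q la)); trivial.
  rewrite (sphere_size_unique x b m (qprod q lb)); trivial.
  - rewrite <- qprod_app, Ea, Eb, <- wprod_app. apply sphere_size_word; [now apply Forall_app|].
    rewrite wprod_app, <- Ea, <- Eb, length_app. lia.
  - rewrite Eb. apply sphere_size_word; trivial. now rewrite <- Eb.
  - rewrite Ea. apply sphere_size_word; trivial. now rewrite <- Ea.
Qed.

Lemma q_pos (x : ch B) s : cS X s -> 1 <= q s.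
Proof.
  intro Hs. destruct (Hq s x Hs) as [l [_ [L1 L2]]].
  destruct (dl_neighbour x x s Hs) as [y [_ [Hy _]]]. apply L2 in Hy.
  destruct l as [|a l]; [easy|simpl in L1; lia].
Qed.

Lemma qprod_pos (x : ch B) l : Forall (cS X) l -> 1 <= qprod q l.
Proof.
  intro Hl. induction Hl as [|s l Hs Hl IH]; simpl; [lia|].
  assert (H := q_pos x s Hs). unfold qprod in *. nia.
Qed.

(* Both sides count the chambers at Weyl distance [s v = v t]. *)
Lemma q_conjugate (x : ch B) s t v : cS X s -> cS X t -> s ** v = v ** t -> q s = q t.
Proof.
  intros Hs Ht.
  enough (H : forall v, len (s ** v) = S (len v) -> s ** v = v ** t -> q s = q t).
  { intro E. destruct (len_gen_mul s v Hs) as [L|L]; [now apply (H v)|].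
    apply (H (s ** v)).
    - now rewrite gen_cancel.
    - rewrite E at 2. rewrite gen_cancel by trivial. now rewrite gen_cancel_r. }
  clear v. intros v L E. destruct (reduced_word v) as [l [Hl [El Ll]]].
  assert (H1 : sphere_size B (s ** v) (qprod q (s :: l))).
  { replace (s ** v) with (word (s :: l)) by (rewrite El; reflexivity).
    apply sphere_size_word; [now constructor|]. simpl. rewrite Ll, <- L, El. reflexivity. }
  assert (H2 : sphere_size B (s ** v) (qprod q (l ++ [t]))).
  { rewrite E. replace (v ** t) with (word (l ++ [t]))
      by (rewrite wprod_app, <- El; simpl; gsimp; reflexivity).
    apply sphere_size_word; [apply Forall_app; auto|].
    rewrite wprod_app, <- El, length_app. simpl. gsimp. rewrite <- E, Ll. lia. }
  assert (H3 := sphere_size_unique x _ _ _ H1 H2). rewrite qprod_app in H3. simpl in H3.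
  assert (H4 := qprod_pos x l Hl). unfold qprod in *. nia.
Qed.

End Counting.
(** The shape of the Weyl distance between nearest chambers of two aligned residues of type [J]. *)
Definition normalizes (J : cW X -> Prop) (x : cW X) : Prop :=
  min_in_coset J x /\
  (forall u, in_WJ X J u -> in_WJ X J (cmul X (cmul X (inv x) u) x)) /\
  (forall u, in_WJ X J u -> in_WJ X J (cmul X (cmul X x u) (inv x))).

Definition residue_at (B : Bldg X) (J : cW X -> Prop) (c : ch B) (A : ch B -> Prop) : Prop :=
  forall y, A y <-> in_WJ X J (wdist B c y).

Lemma prod_rel_perm {T : Type} (f : T -> nat -> Prop) ts ts' : Permutation ts ts' ->
  forall n, prod_rel f ts n -> prod_rel f ts' n.
Proof.
  induction 1 as [|t ts ts' _ IH|t t' ts|ts1 ts2 ts3 _ IH1 _ IH2]; intros n H; trivial.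
  - inversion H; subst. constructor; auto.
  - inversion H as [|? ? k m Hk Hm]; subst. inversion Hm as [|? ? k' m' Hk' Hm']; subst.
    replace (k * (k' * m')) with (k' * (k * m')) by lia. repeat constructor; trivial.
  - auto.
Qed.

Lemma prod_rel_unique {T : Type} (f : T -> nat -> Prop) ts :
  (forall t k k', In t ts -> f t k -> f t k' -> k = k') ->
  forall n n', prod_rel f ts n -> prod_rel f ts n' -> n = n'.
Proof.
  induction ts as [|t ts IH]; intros Hf n n' H H'; inversion H; inversion H'; subst; trivial.
  f_equal; [apply (Hf t); trivial; now left|]. apply IH; trivial.
  intros t' k1 k2 Ht'. apply Hf. now right.
Qed.

(** * Aligned residues of the same type *)

Section ParallelResidues.
Context (J : cW X -> Prop) (HJ : forall s, J s -> cS X s).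
Local Notation chp u := (act u one_pt).
Local Notation WJ := (in_WJ X J).

Lemma normalizes_inv x : normalizes J x -> normalizes J (inv x).
Proof.
  intros [H1 [H2 H3]]. split; [|split].
  - now apply min_in_coset_inv.
  - intros u Hu. rewrite (grp_inv_inv GX). auto.
  - intros u Hu. rewrite (grp_inv_inv GX). auto.
Qed.

Lemma residue_at_self c A : residue_at B J c A -> A c.
Proof. intro H. apply H. rewrite dl_refl. apply in_WJ_one. Qed.

Lemma residue_at_rebase c c' A : residue_at B J c A -> A c' -> residue_at B J c' A.
Proof.
  intros H Hc' y. apply H in Hc'. rewrite (H y). split; intro Hy.
  - apply (in_WJ_dl_trans J _ c); trivial. now apply in_WJ_dl_sym.
  - now apply (in_WJ_dl_trans J _ c').
Qed.

Lemma dl_between_residues x c c' A A' y y' : normalizes J x ->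
  residue_at B J c A -> residue_at B J c' A' -> dl c c' = x -> A y -> A' y' ->
  exists u, WJ u /\ dl y y' = x ** u.
Proof.
  intros [N1 [N2 N3]] HA HA' E Hy Hy'. apply HA in Hy. apply HA' in Hy'.
  assert (H0 : exists u, WJ u /\ dl c y' = x ** u).
  { exists (dl c' y'). split; trivial. rewrite <- E. apply dl_comp.
    rewrite E. now apply (min_in_coset_len J). }
  apply in_WJ_dl_sym in Hy; trivial. destruct Hy as [l [Hl El]].
  revert y El. induction Hl as [|s l Hs Hl IH]; intros y El.
  - apply (WD1 X B HB) in El. now subst y.
  - destruct (dl_between y c s (word l) El) as [y1 [H1 H2]].
    destruct (IH y1 H2) as [u [Hu Eu]].
    destruct (dl_step y y1 y' s (HJ s Hs) H1) as [[H|H] _]; rewrite H, Eu.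
    + exists (inv x ** s ** x ** u). split; [|gsimp; reflexivity].
      apply in_WJ_mul; trivial. now apply N2, in_WJ_gen.
    + now exists u.
Qed.

Lemma parallel_proj_onto x c c' A A' : normalizes J x ->
  residue_at B J c A -> residue_at B J c' A' -> dl c c' = x -> proj_onto X B A A'.
Proof.
  intros N HA HA' E y. split; [now intros [z [_ [Hy _]]]|]. intro Hy.
  destruct (dl_between_residues x c c' A A' c y N HA HA' E (residue_at_self c A HA) Hy)
    as [u [Hu Eu]].
  (* This factorization exhibits a chamber [z] of [A] at distance exactly [x] from [y]; since [x] is
     shortest in its coset, [y] is the projection of [z]. *)
  assert (E2 : dl c y = (x ** u ** inv x) ** x) by (rewrite Eu; gsimp; reflexivity).
  destruct (dl_between c y _ _ E2) as [z [H1 H2]].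
  assert (Hz : A z) by (apply HA; rewrite H1; now apply N). exists z. split; trivial.
  split; trivial. intros z' n m Hz' Hn Hm. unfold gdist in *.
  apply wlen_len in Hn, Hm. subst.
  destruct (dl_between_residues (dl c c') c c' A A' z z' N HA HA' eq_refl Hz Hz') as [u' [Hu' ->]].
  rewrite H2. now apply N.
Qed.

Lemma parallel_aligned x c c' A A' : normalizes J x ->
  residue_at B J c A -> residue_at B J c' A' -> dl c c' = x -> aligned X B A A'.
Proof.
  intros N HA HA' E. split.
  - now apply (parallel_proj_onto x c c').
  - apply (parallel_proj_onto (inv x) c' c); trivial; [now apply normalizes_inv|].
    now rewrite dl_sym, E.
Qed.

(** By alignment, a chamber [c1] that is [s]-adjacent to [c] is the projection of some chamber of
    [A']. The wall of [s] is therefore crossed inside the coset x [W_J], which puts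
    [inv x ** s ** x] into [W_J]. *)
Lemma aligned_half c c' A A' :
  residue_at B J c A -> residue_at B J c' A' ->
  (forall z z', A z -> A' z' -> len (dl c c') <= len (dl z z')) ->
  proj_onto X B A' A ->
  min_in_coset J (dl c c') /\
  (forall u, WJ u -> WJ (inv (dl c c') ** u ** dl c c')).
Proof.
  intros HA HA' Hmin Hp. set (x := dl c c') in *.
  assert (Hc := residue_at_self c A HA). assert (Hc' := residue_at_self c' A' HA').
  assert (M1 : min_in_coset J x).
  { intros u Hu. destruct (dl_between c c' (x ** u) (inv u)) as [z [H1 H2]].
    { gsimp. reflexivity. }
    rewrite <- H1. apply Hmin; trivial. apply (residue_at_rebase c' c'); trivial.
    apply in_WJ_dl_sym; trivial. rewrite H2. now apply in_WJ_inv. }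
  split; trivial.
  assert (Hgen : forall s, J s -> WJ (inv x ** s ** x)).
  { intros s Js. assert (Hs := HJ s Js).
    destruct (dl_neighbour c c' s Hs) as [c1 [H1 [H2 H3]]].
    assert (Hc1 : A c1) by (apply HA; rewrite H2; now apply in_WJ_gen).
    assert (L1 : len (s ** x) = S (len x)).
    { destruct (len_gen_mul s x Hs) as [L|L]; trivial. specialize (Hmin c1 c' Hc1 Hc').
      rewrite H3 in Hmin. fold x in Hmin. lia. }
    apply Hp in Hc1. destruct Hc1 as [c1' [Hc1' [Hc1 Hpr]]].
    assert (Hu := proj1 (HA' c1') Hc1'). set (u := dl c' c1') in *.
    assert (Ecc : dl c c1' = x ** u).
    { apply dl_comp. now apply (min_in_coset_len J). }
    (* Otherwise [c] would be nearer to [c1'] than its projection [c1]. *)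
    assert (Hlt : len (x ** u) = S (len (s ** (x ** u)))).
    { destruct (len_gen_mul s (x ** u) Hs) as [L|L]; trivial. exfalso.
      destruct (dl_step c1 c c1' s Hs H1) as [_ H]. rewrite Ecc in H. specialize (H L).
      assert (Hle : len (dl c1' c1) <= len (dl c1' c)).
      { apply (Hpr c); trivial; unfold gdist; now apply wlen_len. }
      rewrite (dl_sym c1), (dl_sym c), !len_inv, H, Ecc in Hle. lia. }
    destruct (wall_in_coset J e s x u HJ Hs Hu) as [d [Hd Ed]].
    - destruct (val_chp_dichotomy e s x Hs) as [[A1 _]|[_ A1]],
        (val_chp_dichotomy e s (x ** u) Hs) as [[_ A2]|[A2 _]].
      + gsimp_in A2. lia.
      + nra.
      + gsimp_in A1. lia.
      + gsimp_in A1. lia.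
    - gsimp_in Ed. replace (inv x ** s ** x) with d; trivial.
      apply (grp_cancel_l GX x). rewrite <- Ed. gsimp. reflexivity. }
  intros u [l [Hl ->]]. induction Hl as [|s l Hs Hl IH].
  - simpl. gsimp. apply in_WJ_one.
  - change (word (s :: l)) with (s ** word l).
    replace (inv x ** (s ** word l) ** x) with
      ((inv x ** s ** x) ** (inv x ** word l ** x)) by (gsimp; reflexivity).
    apply in_WJ_mul; auto.
Qed.

Lemma aligned_parallel c0 c0' A A' :
  residue_at B J c0 A -> residue_at B J c0' A' -> aligned X B A A' ->
  exists c c', residue_at B J c A /\ residue_at B J c' A' /\ normalizes J (dl c c').
Proof.
  intros HA HA' [P1 P2].
  destruct (nat_least (fun n => exists c c', A c /\ A' c' /\ n = len (dl c c')))
    as [n [[c [c' [Hc [Hc' En]]]] Hmin]].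
  { exists (len (dl c0 c0')), c0, c0'. repeat split; now apply residue_at_self. }
  assert (Rc := residue_at_rebase c0 c A HA Hc). assert (Rc' := residue_at_rebase c0' c' A' HA' Hc').
  assert (M : forall z z', A z -> A' z' -> len (dl c c') <= len (dl z z')).
  { intros z z' Hz Hz'. rewrite <- En. apply Hmin. now exists z, z'. }
  exists c, c'. split; [trivial|split; [trivial|]].
  destruct (aligned_half c c' A A' Rc Rc' M P2) as [H1 H2].
  destruct (aligned_half c' c A' A Rc' Rc) as [H3 H4]; trivial.
  { intros z z' Hz Hz'. rewrite (dl_sym c c'), (dl_sym z' z), !len_inv. auto. }
  split; [trivial|split; trivial]. intros u Hu. assert (H := H4 u Hu).
  rewrite (dl_sym c c') in H. now rewrite (grp_inv_inv GX) in H.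
Qed.

(** The product is used because [(v, s)] may name either root of the wall, whereas [in_root] always
    means the one containing [e]. *)
Lemma in_root_val v s u : cS X s ->
  in_root X (v ** s ** inv v) u <-> (0 < val v s (chp e) * val v s (chp u))%R.
Proof.
  intros Hs. assert (T : in_root X (v ** s ** inv v) u <-> len u < len (v ** s ** inv v ** u)).
  { unfold in_root. split.
    - intro H. apply H; now apply wlen_len.
    - intros H n m Hn Hm. apply wlen_len in Hn, Hm. now subst. }
  rewrite T. clear T. split.
  - intro H. destruct (Rlt_dec (val v s (chp e) * val v s (chp u)) 0) as [C|C].
    + apply strong_exchange in C; trivial. lia.
    + destruct (val_chp_dichotomy v s e Hs) as [[A1 _]|[A1 _]],
        (val_chp_dichotomy v s u Hs) as [[A2 _]|[A2 _]]; nra.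
  - intro H. assert (C := strong_exchange v s (v ** s ** inv v ** u) Hs).
    rewrite (act_mul (v ** s ** inv v)), val_reflection in C by trivial.
    assert (E : v ** s ** inv v ** (v ** s ** inv v ** u) = u).
    { gsimp. rewrite gen_cancel by trivial. gsimp. reflexivity. }
    rewrite E in C. apply C. lra.
Qed.

(** * Separating walls and their thickness *)

Section Apartment.
Context (q : cW X -> nat) (Hq : forall s x, cS X s -> panel_count X B x s (q s)).

(** A wall cutting [A] or [A'] within the apartment comes, seen from [u0], from a reflection
    preserving the coset x [W_J]; by minimality of [x] it cannot separate [u0] from [u0 ** x]. So
    every wall crossed by a minimal gallery between these two separates the whole residues. *)
Lemma separating_walls x c c' A A' phi u0 l t : normalizes J x ->
  residue_at B J c A -> residue_at B J c' A' -> dl c c' = x ->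
  apt_iso X B phi -> A (phi u0) -> A' (phi (u0 ** x)) ->
  Forall (cS X) l -> x = word l -> len x = length l ->
  (In t (refl_list u0 l) <-> is_reflection X t /\ wall_separates X B phi t A A').
Proof.
  intros [N1 [N2 N3]] HA HA' E Hphi Hu Hux Hl El Ll.
  assert (RA := residue_at_rebase c _ A HA Hu). assert (RA' := residue_at_rebase c' _ A' HA' Hux).
  split.
  - intro Ht. apply refl_list_sound in Ht; trivial; [|now rewrite <- El].
    destruct Ht as [v [s [Hs [-> Hsep]]]]. rewrite <- El in Hsep. split; [now exists v, s|].
    assert (Side : forall u, A (phi u) -> (0 < val v s (chp u0) * val v s (chp u))%R).
    { intros u Hu'. destruct (Rlt_dec (val v s (chp u0) * val v s (chp u)) 0) as [C|C].
      - exfalso. apply RA in Hu'. rewrite Hphi in Hu'.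
        destruct (wall_in_coset J v s u0 (inv u0 ** u) HJ Hs Hu') as [d [Hd Ed]].
        { gsimp. exact C. }
        assert (H := min_in_coset_side J (inv u0 ** v) s x (inv x ** d ** x) Hs N1 (N2 d Hd)).
        rewrite <- !val_act, <- !act_mul in H. revert H. gsimp. intro H.
        gsimp_in Ed.
        assert (EE : inv u0 ** v ** s ** inv v ** u0 = d)
          by (apply (grp_cancel_l GX u0); gsimp; exact Ed).
        assert (H' := H ltac:(rewrite <- EE; gsimp; reflexivity)). lra.
      - destruct (val_chp_dichotomy v s u0 Hs) as [[A1 _]|[A1 _]],
          (val_chp_dichotomy v s u Hs) as [[A2 _]|[A2 _]]; nra. }
    assert (Side' : forall u, A' (phi u) -> (0 < val v s (chp (u0 ** x)) * val v s (chp u))%R).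
    { intros u Hu'. destruct (Rlt_dec (val v s (chp (u0 ** x)) * val v s (chp u)) 0) as [C|C].
      - exfalso. apply RA' in Hu'. rewrite Hphi in Hu'.
        destruct (wall_in_coset J v s (u0 ** x) (inv (u0 ** x) ** u) HJ Hs Hu') as [d [Hd Ed]].
        { gsimp. exact C. }
        assert (H := min_in_coset_side J (inv u0 ** v) s x d Hs N1 Hd).
        rewrite <- !val_act, <- !act_mul in H. revert H. gsimp. intro H.
        gsimp_in Ed.
        assert (H' := H ltac:(apply (grp_cancel_l GX u0); gsimp; exact Ed)). lra.
      - destruct (val_chp_dichotomy v s (u0 ** x) Hs) as [[A1 _]|[A1 _]],
          (val_chp_dichotomy v s u Hs) as [[A2 _]|[A2 _]]; nra. }
    destruct (val_chp_dichotomy v s e Hs) as [[A0 _]|[A0 _]],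
      (val_chp_dichotomy v s u0 Hs) as [[A1 _]|[A1 _]],
      (val_chp_dichotomy v s (u0 ** x) Hs) as [[A2 _]|[A2 _]]; try nra.
    1, 4: left. 3, 4: right.
    all: split; intros u Hu'; rewrite (in_root_val v s u Hs).
    all: try specialize (Side u Hu'); try specialize (Side' u Hu').
    all: destruct (val_chp_dichotomy v s u Hs) as [[A3 _]|[A3 _]]; nra.
  - intros [[v [s [Hs ->]]] Hw]. apply refl_list_complete; trivial. rewrite <- El.
    destruct (val_chp_dichotomy v s e Hs) as [[A0 _]|[A0 _]],
      (val_chp_dichotomy v s u0 Hs) as [[A1 _]|[A1 _]],
      (val_chp_dichotomy v s (u0 ** x) Hs) as [[A2 _]|[A2 _]]; try nra.
    all: exfalso; destruct Hw as [[W1 W2]|[W1 W2]]; specialize (W1 _ Hu); specialize (W2 _ Hux);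
      rewrite (in_root_val v s u0 Hs) in W1; rewrite (in_root_val v s (u0 ** x) Hs) in W2.
    all: first [apply W2; nra | apply W1; nra].
Qed.

Lemma refl_list_thickness p l : Forall (cS X) l ->
  prod_rel (wall_thickness X q) (refl_list p l) (qprod q l).
Proof.
  intro Hl. revert p. induction Hl as [|s l Hs Hl IH]; intro p; [constructor|].
  constructor; auto. exists p, s. split; [trivial|split; [gsimp|]]; reflexivity.
Qed.

Lemma wall_thickness_unique (x : ch B) t k k' :
  wall_thickness X q t k -> wall_thickness X q t k' -> k = k'.
Proof.
  intros [u [s [Hs [E ->]]]] [u' [s' [Hs' [E' ->]]]].
  apply (q_conjugate q Hq x s s' (inv u ** u')); trivial.
  apply (grp_cancel_l GX u). gsimp. rewrite <- E'.
  rewrite mulA, <- E. gsimp. reflexivity.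
Qed.

Lemma qval_word x c c' A A' l n : normalizes J x ->
  residue_at B J c A -> residue_at B J c' A' -> dl c c' = x ->
  Forall (cS X) l -> x = word l -> len x = length l ->
  qval X B q A A' n -> n = qprod q l.
Proof.
  intros N HA HA' E Hl El Ll [phi [Hphi [[u1 H1] [[u2 H2] [ts [T1 [T2 T3]]]]]]].
  destruct (dl_between_residues x c c' A A' _ _ N HA HA' E H1 H2) as [v [Hv Ev]].
  rewrite Hphi in Ev.
  (* The apartment need not contain [c] or [c'], but from its chamber in [A] a gallery of type [x]
     inside it still ends in [A']. *)
  assert (H3 : A' (phi (u1 ** x))).
  { apply (residue_at_rebase c' _ A' HA' H2). rewrite Hphi.
    replace (inv u2 ** (u1 ** x)) with (inv (inv u1 ** u2) ** x) by (gsimp; reflexivity).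
    rewrite Ev. gsimp. now apply in_WJ_inv. }
  assert (Perm : Permutation ts (refl_list u1 l)).
  { apply NoDup_Permutation; trivial.
    - apply refl_list_NoDup; trivial. now rewrite <- El.
    - intro t. rewrite T2. symmetry. now apply (separating_walls x c c'). }
  apply (prod_rel_unique (wall_thickness X q) (refl_list u1 l)).
  - intros t k k' _. apply (wall_thickness_unique c).
  - now apply (prod_rel_perm _ ts).
  - now apply refl_list_thickness.
Qed.

Lemma qval_exists x c c' A A' l phi : normalizes J x ->
  residue_at B J c A -> residue_at B J c' A' -> dl c c' = x ->
  Forall (cS X) l -> x = word l -> len x = length l ->
  apt_iso X B phi -> phi e = c -> phi x = c' -> qval X B q A A' (qprod q l).
Proof.
  intros N HA HA' E Hl El Ll Hphi Ec Ec'.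
  assert (H1 : A (phi e)) by (rewrite Ec; now apply residue_at_self).
  assert (H2 : A' (phi x)) by (rewrite Ec'; now apply residue_at_self).
  exists phi. split; [trivial|split; [now exists e|split; [now exists x|]]].
  exists (refl_list e l). split; [|split].
  - apply refl_list_NoDup; trivial. now rewrite <- El.
  - intro t. apply (separating_walls x c c'); trivial. gsimp. exact H2.
  - now apply refl_list_thickness.
Qed.

End Apartment.
End ParallelResidues.

Lemma finite_union {A C : Type} (P : list A) (R : A -> C -> Prop) :
  (forall a, In a P -> exists l, forall y, R a y -> In y l) ->
  exists L, forall a y, In a P -> R a y -> In y L.
Proof.
  induction P as [|a P IH]; intro H; [now exists []|].
  destruct IH as [L HL]; [intros; apply H; now right|].
  destruct (H a (or_introl eq_refl)) as [l Hl]. exists (l ++ L). intros b y [<-|Hb] Hy.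
  - apply in_app_iff. left. auto.
  - apply in_app_iff. right. eauto.
Qed.

Lemma power_growth C m m0 : (forall k, m0 ^ k <= C * m ^ k) -> m0 <= m.
Proof.
  intro H. destruct (le_lt_dec m0 m) as [|Hlt]; trivial. exfalso.
  (* Bernoulli's inequality, cleared of denominators. With k = C m + 1 it would give m + k <= C
     m. *)
  assert (Bern : forall k, m ^ k * (m + k) <= (m + 1) ^ k * m).
  { induction k as [|k IH]; simpl; nia. }
  set (k := C * m + 1). specialize (H k). specialize (Bern k).
  assert (P : (m + 1) ^ k <= m0 ^ k) by (apply Nat.pow_le_mono_l; lia).
  destruct m as [|m].
  - unfold k in *. rewrite Nat.mul_0_r in *. simpl in *. lia.
  - assert (Q : 1 <= S m ^ k) by (assert (S m ^ k <> 0) by (apply Nat.pow_nonzero; lia); lia).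
    assert (E : S m ^ k * (S m + k) <= S m ^ k * (C * S m)) by nia.
    apply Nat.mul_le_mono_pos_l in E; unfold k in E; lia.
Qed.

(** * Stabilizers and displacement *)

Section GroupAction.
Context (Hlf : locally_finite X B) (G : (ch B -> ch B) -> Prop) (HGsub : is_subgroup (Aut X B) G).

Lemma G_dl h x y : G h -> dl (h x) (h y) = dl x y.
Proof. intro Hh. apply (proj1 HGsub) in Hh. now apply Hh. Qed.

Lemma G_comp h k : G h -> G k -> G (fun x => h (k x)).
Proof. apply HGsub. Qed.

Lemma G_inv h : G h -> exists k, G k /\ (forall x, k (h x) = x) /\ (forall x, h (k x) = x).
Proof.
  intro Hh. destruct (proj2 (proj2 (proj2 HGsub)) h Hh) as [k [Hk E]].
  exists k. split; [trivial|split; intro; apply E].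
Qed.

Lemma G_iter h k : G h -> G (Nat.iter k h).
Proof. intro Hh. induction k as [|k IH]; [exact (proj1 (proj2 HGsub))|]. exact (G_comp _ _ Hh IH). Qed.

Lemma finite_ball c n : exists l, forall y, len (dl c y) <= n -> In y l.
Proof.
  destruct (cs_finite X HX) as [S0 HS]. induction n as [|n [l Hl]].
  - exists [c]. intros y Hy. left. apply (WD1 X B HB), len_zero. lia.
  - destruct (finite_union (list_prod l S0) (fun p y => dl (fst p) y = snd p)) as [L HL].
    { intros [x s] Hp. apply in_prod_iff in Hp. destruct Hp as [_ Hs]. apply Hlf, HS, Hs. }
    exists (c :: L). intros y Hy. destruct (classic (c = y)) as [E|N]; [now left|right].
    destruct (right_descent (dl c y)) as [s [Hs Ls]].
    { intro E. now apply (WD1 X B HB) in E. }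
    destruct (dl_between c y (dl c y ** s) s) as [z [H1 H2]];
      [now rewrite gen_cancel_r|].
    apply (HL (z, s)); trivial. apply in_prod; [|now apply HS]. apply Hl. rewrite H1. lia.
Qed.

Lemma finite_residue J c A : (exists l, forall w, in_WJ X J w <-> In w l) ->
  residue_at B J c A -> exists l, forall y, A y -> In y l.
Proof.
  intros [lw Hlw] HA.
  destruct (finite_union lw (fun w y => dl c y = w)) as [L HL].
  { intros w _. destruct (finite_ball c (len w)) as [l Hl]. exists l. intros y <-. now apply Hl. }
  exists L. intros y Hy. apply (HL (dl c y)); trivial. apply Hlw, HA, Hy.
Qed.

Definition finitely_covered {I : Type} (O : I -> (ch B -> ch B) -> Prop) (K : (ch B -> ch B) -> Prop) :=
  exists l : list I, forall k, K k -> exists i, In i l /\ O i k.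

Lemma finitely_covered_split {I : Type} (O : I -> (ch B -> ch B) -> Prop) K y l :
  (forall k, K k -> In (k y) l) -> ~ finitely_covered O K ->
  exists z, ~ finitely_covered O (fun k => K k /\ k y = z).
Proof.
  intros Hl HK. apply NNPP. intro N. apply HK.
  assert (HN : forall z, finitely_covered O (fun k => K k /\ k y = z)).
  { intro z. apply NNPP. intro Nz. apply N. now exists z. }
  destruct (finite_union l (fun z i => In i (epsilon (inhabits []) (fun li : list I =>
    forall k, K k /\ k y = z -> exists i, In i li /\ O i k)))) as [L HL].
  { intros z _. now exists (epsilon (inhabits []) (fun li : list I =>
      forall k, K k /\ k y = z -> exists i, In i li /\ O i k)). }
  exists L. intros k Hk.
  destruct (epsilon_spec (inhabits []) _ (HN (k y)) k (conj Hk eq_refl)) as [i [Hi Oi]].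
  exists i. split; trivial. apply (HL (k y)); auto.
Qed.

Lemma finitely_covered_refine {I : Type} (O : I -> (ch B -> ch B) -> Prop) K l :
  (forall y, exists m, forall k, K k -> In (k y) m) -> ~ finitely_covered O K ->
  exists k0, K k0 /\ ~ finitely_covered O (fun k => K k /\ forall y, In y l -> k y = k0 y).
Proof.
  revert K. induction l as [|y l IH]; intros K HK Hc.
  - assert (E : exists k0, K k0).
    { apply NNPP. intro N. apply Hc. exists []. intros k Hk. exfalso. apply N. now exists k. }
    destruct E as [k0 H0]. exists k0. split; trivial. intros [li Hli]. apply Hc. exists li.
    intros k Hk. apply Hli. now split.
  - destruct (HK y) as [m Hm]. destruct (finitely_covered_split O K y m Hm Hc) as [z Hz].
    destruct (IH (fun k => K k /\ k y = z) ltac:(intro y'; destruct (HK y') as [m' Hm']; exists m'; intros k [Hk _]; auto) Hz)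
      as [k0 [[H0 E0] H1]].
    exists k0. split; trivial. intros [li Hli]. apply H1. exists li.
    intros k [[Hk Ek] Ek']. apply Hli. split; trivial. intros y' [<-|Hy']; [congruence|auto].
Qed.

(* Koenig's lemma: choose automorphisms [f n] which extend each other on the balls
   around [c] and near which no finite subfamily covers. *)
Lemma compact_of_finite_orbit (K : (ch B -> ch B) -> Prop) c F :
  (forall k, K k -> G k) ->
  (forall h, is_aut X B h -> (forall l, exists k, K k /\ forall x, In x l -> k x = h x) -> K h) ->
  (forall k, K k -> In (k c) F) -> compact_in G K.
Proof.
  intros HKG Hcl HF. split; trivial. intros I O HO Hcov. change (finitely_covered O K).
  apply NNPP. intro Hbad.
  assert (Hfin : forall y, exists m, forall k, K k -> In (k y) m).
  { intro y. destruct (finite_union F (fun a z => len (dl a z) <= len (dl c y))) as [L HL].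
    { intros a _. apply finite_ball. }
    exists L. intros k Hk. apply (HL (k c)); auto. rewrite G_dl by auto. lia. }
  set (ball := fun n => epsilon (inhabits []) (fun l => forall y, len (dl c y) <= n -> In y l)).
  assert (Hball : forall n y, len (dl c y) <= n -> In y (ball n)).
  { intro n. exact (epsilon_spec (inhabits []) _ (finite_ball c n)). }
  set (agree := fun n (k0 k : ch B -> ch B) => K k /\ forall y, len (dl c y) <= n -> k y = k0 y).
  set (good := fun n k0 => K k0 /\ ~ finitely_covered O (agree n k0)).
  assert (Step : forall n K', (forall k, K' k -> K k) -> ~ finitely_covered O K' ->
    exists k, K' k /\ good n k).
  { intros n K' HK' Hb.
    destruct (finitely_covered_refine O K' (ball n)) as [k [Hk1 Hk2]]; trivial.
    { intro y. destruct (Hfin y) as [m Hm]. exists m. auto. }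
    exists k. split; [trivial|split; [auto|]]. intros [li Hli]. apply Hk2. exists li.
    intros k' [H1 H2]. apply Hli. split; auto. }
  destruct (Step 0 K (fun _ H => H) Hbad) as [f0 [_ Hf0]].
  set (f := fix f n := match n with 0 => f0
    | S n => epsilon (inhabits f0) (fun k => agree n (f n) k /\ good (S n) k) end).
  assert (Hf : forall n, good n (f n) /\ agree n (f n) (f (S n))).
  { assert (Hn : forall n, good n (f n) -> agree n (f n) (f (S n)) /\ good (S n) (f (S n))).
    { intros n [_ Hg]. simpl. apply (epsilon_spec (inhabits f0)).
      apply Step; trivial. now intros k [Hk _]. }
    assert (Hg : forall n, good n (f n)) by (induction n as [|n IH]; [trivial|apply Hn, IH]).
    intro n. split; [trivial|]. apply Hn, Hg. }
  assert (Hstab : forall n m y, len (dl c y) <= n -> n <= m -> f m y = f n y).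
  { intros n m y Hy Hnm. induction Hnm as [|m Hnm IH]; trivial. rewrite <- IH.
    apply (proj2 (Hf m)). lia. }
  set (h := fun y => f (len (dl c y)) y).
  assert (Hh : forall n y, len (dl c y) <= n -> h y = f n y).
  { intros n y Hy. unfold h. symmetry. now apply Hstab. }
  assert (HfK : forall n, K (f n)) by (intro n; apply (Hf n)).
  assert (Haut : is_aut X B h).
  { assert (Hiso : forall x y, dl (h x) (h y) = dl x y).
    { intros x y. rewrite (Hh (len (dl c x) + len (dl c y)) x), (Hh (len (dl c x) + len (dl c y)) y) by lia.
      apply G_dl, HKG, HfK. }
    split; trivial.
    (* The preimage of [z] under [f r] lies in the ball of radius [r] around [c], where [h] agrees
       with [f r]. *)
    assert (Hsurj : forall z, exists y, h y = z).
    { intro z. set (r := len (dl (h c) z)). destruct (G_inv (f r) (HKG _ (HfK r))) as [k [Gk [_ Ek]]].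
      exists (k z). rewrite (Hh r); [apply Ek|].
      rewrite <- (G_dl (f r)), Ek, <- (Hh r c) by
        (try apply HKG, HfK; rewrite dl_refl, len_one; lia).
      unfold r. lia. }
    exists (fun z => epsilon (inhabits c) (fun y => h y = z)).
    assert (Hr : forall z, h (epsilon (inhabits c) (fun y => h y = z)) = z)
      by (intro z; apply (epsilon_spec (inhabits c) (fun y => h y = z)), Hsurj).
    intro z. split; trivial. apply (WD1 X B HB). rewrite <- Hiso, Hr. apply dl_refl. }
  assert (Hmax : forall l : list (ch B), exists n, forall y, In y l -> len (dl c y) <= n).
  { induction l as [|y l [n IH]]; [now exists 0|]. exists (len (dl c y) + n).
    intros y' [<-|Hy']; [lia|]. specialize (IH y' Hy'). lia. }
  assert (HhK : K h).
  { apply Hcl; trivial. intro l. destruct (Hmax l) as [n Hn]. exists (f n). split; trivial.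
    intros y Hy. symmetry. apply Hh. auto. }
  (* An open set containing [h] contains all members of [K] agreeing with [f n] on a large ball, so
     a single index covers them, against [good n]. *)
  destruct (Hcov h HhK) as [i Hi]. destruct (proj2 (HO i) h Hi) as [l Hl].
  destruct (Hmax l) as [n Hn]. apply (proj2 (proj1 (Hf n))). exists [i].
  intros k [Hk1 Hk2]. exists i. split; [now left|]. apply Hl; [auto|].
  intros y Hy. rewrite Hk2 by auto. symmetry. apply Hh. auto.
Qed.

(** * Stabilizers of residues *)

Section Residue.
Context (J : cW X -> Prop) (HJ : forall s, J s -> cS X s).

Lemma residue_img h c A : G h -> residue_at B J c A -> residue_at B J (h c) (img h A).
Proof.
  intros Gh HA y. destruct (G_inv h Gh) as [k [Gk [E1 E2]]]. split.
  - intros [z [Hz ->]]. rewrite G_dl by trivial. now apply HA.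
  - intro Hy. exists (k y). split; [|now rewrite E2]. apply HA. now rewrite <- (G_dl h), E2.
Qed.

Lemma stab_iff h c A : G h -> residue_at B J c A -> (stab G A h <-> A (h c)).
Proof.
  intros Gh HA. assert (Hi := residue_img h c A Gh HA). split.
  - intros [_ H]. apply H, (residue_at_self J (h c)), Hi.
  - intro Hc. split; trivial. intro y.
    rewrite (residue_at_rebase J HJ c (h c) A HA Hc y). symmetry. apply Hi.
Qed.

Lemma stab_subgroup c A : residue_at B J c A -> is_subgroup G (stab G A).
Proof.
  intro HA. assert (Hc := residue_at_self J c A HA).
  assert (Hone : G (fun x => x)) by apply HGsub.
  split; [now intros h [Hh _]|split; [|split]].
  - now apply (stab_iff _ c).
  - intros u v Hu Hv. assert (Gu := proj1 Hu). assert (Gv := proj1 Hv).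
    apply (stab_iff _ c); trivial; [now apply G_comp|].
    apply Hu. exists (v c). split; trivial. exact (proj1 (stab_iff v c A Gv HA) Hv).
  - intros u Hu. assert (Gu := proj1 Hu). destruct (G_inv u Gu) as [k [Gk [E1 E2]]].
    exists k. split; [|split; auto]. apply (stab_iff _ c); trivial.
    apply Hu in Hc. destruct Hc as [z [Hz Ez]]. now rewrite Ez, E1.
Qed.

Lemma stab_open c A : residue_at B J c A -> open_in G (stab G A).
Proof.
  intro HA. split; [now intros h [Hh _]|]. intros h Hh. exists [c]. intros h' Gh' E.
  apply (stab_iff h' c); trivial. rewrite E by now left. exact (proj1 (stab_iff h c A (proj1 Hh) HA) Hh).
Qed.

Lemma stab_compact c A : closed_in_Aut X B G -> (exists l, forall w, in_WJ X J w <-> In w l) ->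
  residue_at B J c A -> compact_in G (stab G A).
Proof.
  intros Hcl HW HA. destruct (finite_residue J c A HW HA) as [F HF].
  apply (compact_of_finite_orbit _ c F).
  - now intros h [Hh _].
  - intros h Hh Hl. assert (Gh : G h).
    { apply Hcl; trivial. intro l. destruct (Hl l) as [k [[Gk _] Hk]]. now exists k. }
    apply (stab_iff h c); trivial. destruct (Hl [c]) as [k [Hk Ek]].
    rewrite <- Ek by now left. exact (proj1 (stab_iff k c A (proj1 Hk) HA) Hk).
  - intros k Hk. apply HF. exact (proj1 (stab_iff k c A (proj1 Hk) HA) Hk).
Qed.

Lemma conjg_stab g h A : G g -> (conjg g (stab G A) h <-> stab G (img g A) h).
Proof.
  intro Gg. destruct (G_inv g Gg) as [g' [Gg' [E1 E2]]]. split.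
  - intros [u [[Gu Hu] E]]. assert (Eh : h = fun x => g (u (g' x))).
    { apply functional_extensionality. intro x. now rewrite <- E, E2. }
    split; [rewrite Eh; apply (G_comp g (fun x => u (g' x))); trivial; now apply G_comp|].
    intro y. split.
    + intros [z [Hz ->]]. apply Hu in Hz. destruct Hz as [t [Ht ->]].
      exists (g t). split; [now exists t|]. now rewrite E.
    + intros [z [[t [Ht ->]] ->]]. rewrite E. exists (u t). split; trivial.
      apply Hu. now exists t.
  - intros [Gh Hh]. exists (fun x => g' (h (g x))). split; [|intro x; now rewrite E2].
    split; [apply (G_comp g' (fun x => h (g x))); trivial; now apply G_comp|].
    intro y. split.
    + intro Hy. assert (H : img g A (g y)) by now exists y. apply Hh in H.
      destruct H as [z [[t [Ht ->]] Ez]]. exists t. split; trivial. now rewrite <- Ez, E1.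
    + intros [t [Ht ->]]. assert (H : img g A (h (g t))).
      { apply Hh. exists (g t). split; [now exists t|reflexivity]. }
      destruct H as [z [Hz Ez]]. now rewrite Ez, E1.
Qed.

(** The cosets correspond to the translates of [A] under the stabilizer of [gA]. Each translate
    contains exactly one chamber at distance [x] from [c], and Weyl transitivity reaches all such
    chambers from [c'] by elements fixing [c]. *)
Lemma stab_displacement g c c' A n : weyl_transitive X B G -> G g ->
  residue_at B J c (img g A) -> residue_at B J c' A -> normalizes J (dl c c') ->
  sphere_size B (dl c c') n -> displacement g (stab G A) n.
Proof.
  intros Hwt Gg HgA HA HN Hn. destruct HN as [N1 N2]. set (x := dl c c') in *.
  destruct (Hn c) as [ys [Y1 [Y2 Y3]]].
  set (rep := fun y => epsilon (inhabits (fun z => z)) (fun h => G h /\ h c = c /\ h c' = y)).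
  assert (Hrep : forall y, In y ys -> G (rep y) /\ rep y c = c /\ rep y c' = y).
  { intros y Hy. apply (epsilon_spec (inhabits (fun z : ch B => z))
      (fun h => G h /\ h c = c /\ h c' = y)). apply Hwt. symmetry. now apply Y3. }
  exists (map rep ys). split; [now rewrite length_map|split; [|split]].
  - intros r Hr. apply in_map_iff in Hr. destruct Hr as [y [<- Hy]].
    destruct (Hrep y Hy) as [R1 [R2 R3]]. apply conjg_stab; trivial.
    apply (stab_iff _ c); trivial. rewrite R2. now apply (residue_at_self J).
  - intros a Ha. apply conjg_stab in Ha; trivial. assert (Ga := proj1 Ha).
    destruct (G_inv a Ga) as [a' [Ga' [E1 E2]]].
    assert (Hac : img g A (a' c)).
    { apply (residue_at_self J) in HgA. apply Ha in HgA. destruct HgA as [z [Hz Ez]].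
      now rewrite Ez, E1. }
    destruct (parallel_proj_onto J HJ (inv x) c' c A (img g A)) with (y := a' c) as [_ P];
      trivial.
    { now apply normalizes_inv. }
    { now rewrite (dl_sym c). }
    destruct (P Hac) as [z [Hz [_ Hpr]]].
    destruct (dl_between_residues J HJ x c c' (img g A) A (a' c) z) as [u [Hu Eu]]; trivial.
    { now split. }
    (* [z1] is a chamber of [A] at distance [x] from [a' c], so [a z1] lies on the sphere around [c]
       and names the coset of [a]. *)
    destruct (dl_between (a' c) z x u Eu) as [z1 [Z1 Z2]].
    assert (Hz1 : A z1).
    { apply (residue_at_rebase J HJ c' z A HA Hz).
      apply in_WJ_dl_sym; trivial. now rewrite Z2. }
    assert (Hy : In (a z1) ys).
    { apply Y3. rewrite <- (E2 c), G_dl by trivial. exact Z1. }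
    exists (rep (a z1)). split; [now apply in_map|].
    destruct (Hrep _ Hy) as [R1 [R2 R3]]. destruct (G_inv _ R1) as [r' [Gr' [F1 F2]]].
    exists (fun t => r' (a t)). split; [|intro t; now rewrite F2].
    assert (Gb : G (fun t => r' (a t))) by now apply G_comp. split.
    + apply conjg_stab; trivial. apply (stab_iff _ (a' c)); trivial.
      { now apply (residue_at_rebase J HJ c). }
      rewrite E2, <- R2 at 1. rewrite F1. now apply (residue_at_self J).
    + apply (stab_iff _ z1); trivial; [now apply (residue_at_rebase J HJ c')|].
      rewrite <- R3, F1. now apply (residue_at_self J).
  - intros i j Hi Hj Hij [b [[_ Hb] E]]. apply Hij.
    rewrite <- Y2 in Hi, Hj.
    assert (Enth : forall k, k < length ys ->
      nth k (map rep ys) (fun z => z) = rep (nth k ys c)).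
    { intros k Hk. rewrite <- (map_nth rep). apply nth_indep. now rewrite length_map. }
    rewrite !Enth in E by trivial.
    destruct (Hrep _ (nth_In ys c Hi)) as [R1 [R2 R3]].
    destruct (Hrep _ (nth_In ys c Hj)) as [S1 [S2 S3]].
    apply (NoDup_nth ys c); trivial.
    assert (Hbc : A (b c')) by exact (proj1 (stab_iff b c' A (proj1 Hb) HA) Hb).
    apply HA in Hbc.
    assert (Hd : in_WJ X J (dl (nth i ys c) (nth j ys c))).
    { rewrite <- S3, E, <- R3 at 1. rewrite G_dl by trivial. exact Hbc. }
    assert (Ei : dl c (nth i ys c) = x) by (apply Y3, nth_In; trivial).
    assert (Ej : dl c (nth j ys c) = x) by (apply Y3, nth_In; trivial).
    (* Both chambers lie in one translate of [A] at distance [x] from [c]; minimality of [x] makes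
       them equal. *)
    apply (dl_target c); [congruence|]. rewrite Ei. now apply (min_in_coset_len J).
Qed.

End Residue.

(** * Growth along the powers of [g] *)

Context (HGwt : weyl_transitive X B G).

(** Covers g^k V g^-k by m^k left translates of V: conjugate rho V by [g], then cover g V g^-1
    again, so that rho becomes g rho g^-1 r_i. *)
Lemma iterated_cosets g V m : G g -> displacement g V m -> forall k, exists R,
  length R = m ^ k /\ forall v, V v -> exists rho b, In rho R /\ V b /\
    forall x, Nat.iter k g (v x) = rho (b (Nat.iter k g x)).
Proof.
  intros Gg [r [Lr [_ [Hcov _]]]]. destruct (G_inv g Gg) as [g' [Gg' [E1 E2]]].
  induction k as [|k [R [LR HR]]].
  - exists [fun x => x]. split; [reflexivity|]. intros v Hv. exists (fun x => x), v.
    split; [now left|split; trivial].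
  - exists (map (fun p => fun x => g (fst p (g' (snd p x)))) (list_prod R r)).
    split; [rewrite length_map, length_prod, LR, Lr; simpl; lia|].
    intros v Hv. destruct (HR v Hv) as [rho [b [Hrho [Hb E]]]].
    destruct (Hcov (fun x => g (b (g' x)))) as [ri [Hri [b' [[_ Hb'] E']]]].
    { exists b. split; trivial. intro x. now rewrite E1. }
    exists (fun x => g (rho (g' (ri x)))), b'. split; [|split; [trivial|]].
    + apply in_map_iff. exists (rho, ri). split; [reflexivity|]. now apply in_prod.
    + intro x. simpl. rewrite E. now rewrite <- E', !E1.
Qed.

Lemma compact_finite_orbit V c : compact_in G V -> exists l, forall v, V v -> In (v c) l.
Proof.
  intros [HVG HV]. destruct (HV (ch B) (fun y h => G h /\ h c = y)) as [l Hl].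
  - intro y. split; [now intros h [Gh _]|]. intros h [_ Hh]. exists [c]. intros h' Gh' E.
    split; trivial. rewrite <- Hh. apply E. now left.
  - intros v Hv. exists (v c). auto.
  - exists l. intros v Hv. destruct (Hl v Hv) as [y [Hy [_ <-]]]. exact Hy.
Qed.

Lemma compact_finite_cosets K V : compact_in G K -> is_subgroup G V -> open_in G V ->
  exists l, forall k, K k -> exists u v, In u l /\ V v /\ forall x, k x = u (v x).
Proof.
  intros [HKG HK] HVs [HVG HVo].
  destruct (HK (ch B -> ch B) (fun u h => G u /\ G h /\ exists v, V v /\ forall x, h x = u (v x)))
    as [l Hl].
  - intro u. split; [now intros h [_ [Gh _]]|]. intros h [Gu [Gh [v [Hv E]]]].
    destruct (HVo v Hv) as [F HF]. exists F. intros h' Gh' E'. split; [trivial|split; trivial].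
    destruct (G_inv u Gu) as [u' [Gu' [E1 E2]]]. exists (fun x => u' (h' x)). split.
    + apply HF; [now apply (G_comp)|]. intros x Hx. now rewrite E', E, E1.
    + intro x. now rewrite E2.
  - intros k Hk. exists k. split; [auto|split; [auto|]]. exists (fun x => x). split; [apply HVs|trivial].
  - exists l. intros k Hk. destruct (Hl k Hk) as [u [Hu [_ [_ [v [Hv E]]]]]]. now exists u, v.
Qed.

(* The chambers at Weyl distance [dl (g^k y) c] from [g^k y] form the orbit of
   [c] under the stabilizer of [g^k y], hence meet few translates of [V c]. *)
Lemma orbit_growth (K : (ch B -> ch B) -> Prop) g V m c : G g -> compact_in G K ->
  compact_open_subgroup G V -> displacement g V m ->
  exists C, forall k y n, (forall h, G h -> h y = y -> K h) ->
    sphere_size B (dl (Nat.iter k g y) c) n -> n <= C * m ^ k.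
Proof.
  intros Gg HK [HVs [HVo HVc]] Hd.
  destruct (compact_finite_cosets K V HK HVs HVo) as [us Hus].
  destruct (compact_finite_orbit V c HVc) as [zs Hzs].
  (* [us] depends on [K] and [V], [zs] on [V] and [c]: the constant is independent of [k] and
     [y]. *)
  exists (length us * length zs). intros k y n Hy Hn.
  destruct (iterated_cosets g V m Gg Hd k) as [R [LR HR]].
  destruct (G_inv _ (G_iter g k Gg)) as [g' [Gg' [E1 E2]]].
  set (gk := Nat.iter k g) in *.
  set (L := map (fun p => gk (fst p (g' (fst (snd p) (snd (snd p)))))) (list_prod us (list_prod R zs))).
  destruct (Hn (gk y)) as [l [L1 [L2 L3]]]. rewrite <- L2.
  replace (length us * length zs * m ^ k) with (length L)
    by (unfold L; rewrite length_map, !length_prod, LR; lia).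
  apply NoDup_incl_length; trivial. intros z Hz. apply L3 in Hz.
  destruct (HGwt (gk y) c (gk y) z (eq_sym Hz)) as [h [Gh [H1 H2]]].
  assert (Hu : K (fun x => g' (h (gk x)))).
  { apply Hy; [|now rewrite H1, E1]. apply (G_comp g' (fun x => h (gk x))); trivial.
    apply (G_comp); trivial. now apply G_iter. }
  destruct (Hus _ Hu) as [u [v [Hu1 [Hv E]]]].
  destruct (HR v Hv) as [rho [b [Hrho [Hb Eb]]]].
  apply in_map_iff. exists (u, (rho, b c)). split.
  - simpl. rewrite <- (E2 c) at 1. fold gk in Eb. rewrite <- Eb, E1, <- E, E2, E2. exact H2.
  - apply in_prod; trivial. apply in_prod; auto.
Qed.

(** Let [c1] lie at distance [a] on the way from [c] to [g c]. Then [c1] and [g c1] are joined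
    through [g c] by [b] and then [a]; the triangle inequality and minimality force equality of
    lengths, and equality forces the distance to be [b ** a]. *)
Lemma minimal_displacement_class g c0 : G g ->
  (forall c, len (dl c0 (g c0)) <= len (dl c (g c))) ->
  let w := dl c0 (g c0) in
  let Q := fun v => (exists c, dl c (g c) = inv v ** w ** v) /\ len (inv v ** w ** v) = len w in
  Q e /\
  (forall v a b, Q v -> inv v ** w ** v = a ** b -> len (a ** b) = len a + len b -> Q (v ** a)) /\
  (forall v s, Q v -> cS X s -> len (inv v ** w ** v) = S (len (s ** (inv v ** w ** v))) ->
     Q (v ** s)) /\
  (forall v s, Q v -> cS X s -> len (inv v ** w ** v) = S (len (inv v ** w ** v ** s)) ->
     Q (v ** s)).
Proof.
  intros Gg Hmin w Q.
  assert (Qint : forall v a b, Q v -> inv v ** w ** v = a ** b -> len (a ** b) = len a + len b ->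
    (exists c, dl c (g c) = b ** a) /\ len (b ** a) = len w).
  { intros v a b [[c Ec] Lc] Eab Lab. rewrite Eab in Ec, Lc.
    destruct (dl_between c (g c) a b Ec) as [c1 [H1 H2]].
    assert (H3 : dl (g c) (g c1) = a) by now rewrite (G_dl).
    destruct (dl_len_triangle c1 (g c) (g c1)) as [T1 T2]. rewrite H2, H3 in T1, T2.
    assert (M := Hmin c1). fold w in M.
    assert (E : dl c1 (g c1) = b ** a) by (apply T2; lia).
    split; [now exists c1|]. rewrite <- E. lia. }
  split; [|split; [|split]].
  - split; [exists c0; fold w; gsimp; reflexivity|]. f_equal. gsimp. reflexivity.
  - intros v a b Qv Eab Lab. destruct (Qint v a b Qv Eab Lab) as [H1 H2]. unfold Q.
    replace (inv (v ** a) ** w ** (v ** a)) with (b ** a); [now split|].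
    transitivity (inv a ** (inv v ** w ** v) ** a); [rewrite Eab|]; gsimp; reflexivity.
  - intros v s Qv Hs L.
    destruct (Qint v s (s ** (inv v ** w ** v)) Qv) as [H1 H2].
    + now rewrite gen_cancel.
    + rewrite gen_cancel, (len_gen_eq s) by trivial. lia.
    + unfold Q. replace (inv (v ** s) ** w ** (v ** s)) with (s ** (inv v ** w ** v) ** s); [now split|].
      gsimp. now rewrite (gen_inv s).
  - intros v s Qv Hs L.
    destruct (Qint v (inv v ** w ** v ** s) s Qv) as [H1 H2].
    + now rewrite gen_cancel_r.
    + rewrite gen_cancel_r, (len_gen_eq s) by trivial. lia.
    + unfold Q. replace (inv (v ** s) ** w ** (v ** s)) with (s ** (inv v ** w ** v ** s)); [now split|].
      gsimp. now rewrite (gen_inv s).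
Qed.

(** Since [g c] is reached by [x] only up to [W_J], the chain is followed in the residues of the g^k
    c: a parallel step of type [x] leads from each to the next, and straightness makes the distances
    multiply. *)
Lemma straight_chain J c x g k : (forall s, J s -> cS X s) -> G g -> normalizes J x ->
  (forall i, len (pw x i) = i * len x) ->
  (exists c', dl c c' = x /\ in_WJ X J (dl c' (g c))) ->
  exists y, in_WJ X J (dl (Nat.iter k g c) y) /\ dl c y = pw x k.
Proof.
  intros HJ Gg HN Hlen [c' [Ec Hc']].
  assert (Egp : forall i, pw x (S i) = pw x i ** x).
  { intro i. replace (S i) with (i + 1) by lia. rewrite (gpow_add GX).
    simpl. gsimp. reflexivity. }
  induction k as [|k [y [Hy Ey]]].
  - exists c. simpl. rewrite dl_refl. split; [apply in_WJ_one|reflexivity].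
  - set (gk := Nat.iter k g) in *. assert (Gk : G gk) by now apply G_iter.
    set (R := fun z => in_WJ X J (dl (gk c) z)). set (R' := fun z => in_WJ X J (dl (gk c') z)).
    destruct (dl_between_residues J HJ x (gk c) (gk c') R R' y (gk c')) as [u [Hu Eu]];
      trivial.
    + intro z. reflexivity.
    + intro z. reflexivity.
    + now rewrite (G_dl).
    + unfold R'. rewrite dl_refl. apply in_WJ_one.
    + destruct (dl_between y (gk c') x u Eu) as [z [Z1 Z2]]. exists z. split.
      * assert (Eg : Nat.iter (S k) g c = gk (g c)) by apply Nat.iter_succ_r.
        rewrite Eg. apply (in_WJ_dl_trans J _ (gk c')); trivial.
        -- rewrite (G_dl) by trivial. now apply in_WJ_dl_sym.
        -- apply in_WJ_dl_sym; trivial. now rewrite Z2.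
      * rewrite (dl_comp c y z), Ey, Z1; [symmetry; apply Egp|].
        rewrite Ey, Z1, <- Egp, !Hlen. simpl. lia.
Qed.

Lemma sphere_size_gpow (q : cW X -> nat) (Hq : forall s x, cS X s -> panel_count X B x s (q s))
  (c : ch B) x n k : (forall i, len (pw x i) = i * len x) ->
  sphere_size B x n -> sphere_size B (pw x k) (n ^ k).
Proof.
  intros Hlen Hn. induction k as [|k IH]; [now apply sphere_size_one|].
  apply (sphere_size_mul q Hq c x (pw x k)); trivial.
  assert (H := Hlen (S k)). simpl gpow in H. rewrite H, Hlen. reflexivity.
Qed.

End GroupAction.

End Building.

End CoxeterSystem.

(** * Tidiness of the stabilizer and the value of the scale *)

Theorem theorem4p8
  (X : Cox) (B : Bldg X)
  (HX : coxeter_system X) (HB : is_building X B)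
  (Hthick : thick X B) (Hlf : locally_finite X B)
  (G : (ch B -> ch B) -> Prop)
  (HGsub : is_subgroup (Aut X B) G) (HGcl : closed_in_Aut X B G)
  (HGwt : weyl_transitive X B G)
  (q : cW X -> nat)
  (Hq : forall s x, cS X s -> panel_count X B x s (q s))
  (g : ch B -> ch B) (Hg : G g)
  (A : ch B -> Prop) (HA : is_simplex X B A)
  (Hal : aligned X B A (img g A))
  (n : nat) (Hn : qval X B q (img g A) A n)
  (Hmin : forall R : ch B -> Prop, is_simplex X B R -> aligned X B R (img g R) ->
            forall m, qval X B q (img g R) R m -> n <= m) :
  tidy G g (stab G A) /\ scale G g n.
Proof.
  destruct HA as [J [HJ [HW [a0 Ha0]]]]. change (residue_at B J a0 A) in Ha0.
  assert (HgA := residue_img G HGsub J g a0 A Hg Ha0).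
  destruct (aligned_parallel HX HB J HJ (g a0) a0 (img g A) A HgA Ha0 (conj (proj2 Hal) (proj1 Hal)))
    as [c [c' [Rc [Rc' HN]]]].
  destruct (reduced_word HX (wdist B c c')) as [l [Hl [El Ll]]].
  assert (En := qval_word HX HB J HJ q Hq _ c c' (img g A) A l n HN Rc Rc' eq_refl Hl El (eq_sym Ll) Hn).
  assert (Hsz : sphere_size B (wdist B c c') n).
  { rewrite El, En. apply (sphere_size_word HX HB q Hq); trivial. now rewrite <- El. }
  assert (Hdisp : displacement g (stab G A) n)
    by exact (stab_displacement HX HB G HGsub J HJ g c c' A n HGwt Hg Rc Rc' HN Hsz).
  assert (Hco : compact_open_subgroup G (stab G A)).
  { split; [|split].
    - exact (stab_subgroup HX HB G HGsub J HJ a0 A Ha0).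
    - exact (stab_open HX HB G HGsub J HJ a0 A Ha0).
    - exact (stab_compact HX HB Hlf G HGsub J HJ a0 A HGcl HW Ha0). }
  assert (Hopt : forall V m, compact_open_subgroup G V -> displacement g V m -> n <= m).
  { clear J HJ HW a0 Ha0 HgA c c' Rc Rc' HN l Hl El Ll En Hsz Hdisp Hco.
    (* [Hn] supplies a chamber to start from and an apartment, which Weyl transitivity later moves
       onto [c'] and [c]. *)
    destruct Hn as [phi [Hphi [[u0 _] _]]].
    destruct (nat_least (fun n => exists c, n = len (wdist B c (g c)))) as [n0 [[c0 En0] Hmin0]].
    { now exists (len (wdist B (phi u0) (g (phi u0)))), (phi u0). }
    destruct (minimal_displacement_class HX HB G HGsub g c0 Hg) as [Q1 [Q2 [Q3 Q4]]].
    { intro c. rewrite <- En0. apply Hmin0. now exists c. }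
    destruct (straight_conjugate HX _ _ Q1 Q2 Q3 Q4)
      as [v [J [x [d [[[c Ec] _] [HJ [HW [Hd [Ex [N1 [N2 [N3 Hlen]]]]]]]]]]]].
    rewrite Ex in Ec. assert (HN : normalizes J x) by (split; auto).
    assert (HNi := normalizes_inv HX J HJ x HN).
    destruct (dl_between HX HB c (g c) x d Ec) as [c' [H1 H2]].
    assert (H1' : wdist B c' c = cinv X x) by (rewrite (dl_sym HX HB c), H1; reflexivity).
    set (R := fun y => in_WJ X J (wdist B c y)).
    assert (HR : residue_at B J c R) by (intro y; reflexivity).
    assert (HR' : residue_at B J c' (img g R)).
    { apply (residue_at_rebase HX HB J HJ (g c)); [now apply (residue_img G HGsub J)|].
      apply (residue_img G HGsub J g c R Hg HR).
      apply (in_WJ_dl_sym HX HB); trivial. now rewrite H2. }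
    (* [qval] is taken from [gR] to [R], while [x] leads from [R] to [gR]; hence the inverse. *)
    destruct (reduced_word HX (cinv X x)) as [l [Hl [El Ll]]].
    assert (Hle : n <= qprod q l).
    { apply (Hmin R).
      - exists J. split; [trivial|split; [trivial|now exists c]].
      - exact (parallel_aligned HX HB J HJ x c c' R (img g R) HN HR HR' H1).
      - destruct (HGwt (phi (cone X)) (phi (cinv X x)) c' c) as [h [Gh [E1 E2]]].
        { rewrite Hphi, H1'. gsimp. reflexivity. }
        apply (qval_exists HX HB J HJ q (cinv X x) c' c _ _ l (fun u => h (phi u))); trivial.
        + now rewrite Ll.
        + intros u u'. rewrite (G_dl G HGsub); trivial. }
    intros V m HV Hdm. apply (Nat.le_trans _ _ _ Hle).
    assert (HK := stab_compact HX HB Hlf G HGsub J HJ c R HGcl HW HR).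
    destruct (orbit_growth G HGsub HGwt (stab G R) g V m c Hg HK HV Hdm) as [C HC].
    apply (power_growth C). intro k.
    destruct (straight_chain HX HB G HGsub J c x g k HJ Hg HN Hlen) as [y [Hy Ey]].
    { exists c'. split; trivial. now rewrite H2. }
    (* [orbit_growth] expects a centre of the form g^k y. Pulled back by g^k, the end of the chain
       lies in [R], so its stabilizer is contained in the compact group [stab G R] for every [k]. *)
    destruct (G_inv G HGsub _ (G_iter G HGsub g k Hg)) as [g' [Gg' [E1 E2]]].
    assert (Ry : R (g' y)).
    { unfold R. rewrite <- (G_dl G HGsub (Nat.iter k g)), E2 by (now apply G_iter). exact Hy. }
    apply (HC k (g' y)).
    - intros h Gh Hh. apply (stab_iff HX HB G HGsub J HJ h (g' y)); trivial.
      + exact (residue_at_rebase HX HB J HJ c (g' y) R HR Ry).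
      + now rewrite Hh.
    - rewrite E2, (dl_sym HX HB c), Ey, <- (gpow_inv (cs_group X HX)).
      apply (sphere_size_gpow HX HB q Hq c).
      + intro i. now rewrite (gpow_inv (cs_group X HX)), !(len_inv HX).
      + rewrite El. apply (sphere_size_word HX HB q Hq); trivial. now rewrite <- El. }
  split.
  - split; trivial. exists n. split; trivial.
  - exists (stab G A). split; [trivial|split; trivial].
Qed.
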